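(* Every connected complex manifold $M$ has a norming volume form.
   Context: For a positive continuous volume form $V$ on a complex manifold $M$ (with associated measure $dV$) and a measurable function $u$ on $M$, put $\|u\|_V=\int_M|u|\,dV$; for a measurable set $E\subset M$, put $\|u\|_{L^1(E,V)}=\int_E|u|\,dV$. ''Negative'' means $\le 0$, and negative plurisubharmonic functions are assumed not to be identically $-\infty$. The notation $A\Subset M$ means that $A$ is relatively compact in $M$. A positive continuous volume form $V$ on $M$ is called norming if for each compact set $F\subset M$ there is a constant $C(F)>0$, and for every increasing sequence of open sets $M_j\Subset M$ with $\bigcup_j M_j=M$ there is a sequence of numbers $\varepsilon_j>0$ converging to $0$, such that for every negative plurisubharmonic function $u$ on $M$: (1) $\|u\|_V<\infty$; (2) $u(z)\le -C(F)\|u\|_V$ for every $z\in F$; (3) $\|u\|_{L^1(M\setminus M_j,V)}\le\varepsilon_j\|u\|_V$ for every $j$. (The constants $C(F)$ and $\varepsilon_j$ do not depend on $u$.) *)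

(* Defs.v *)
From HB Require Import structures.
From mathcomp Require Import all_boot all_order all_algebra.
From mathcomp Require Import all_classical all_reals all_analysis.
From mathcomp Require Import complex.

Set Implicit Arguments.
Unset Strict Implicit.
Unset Printing Implicit Defensive.

Import Order.TTheory GRing.Theory Num.Theory.
Import numFieldNormedType.Exports.

Local Open Scope classical_set_scope.
Local Open Scope ring_scope.
Local Open Scope complex_scope.

(* [R[i]^o] is the alias of [R[i]] that carries the topology and the structure
   of normed module over [R[i]]. *)
Notation Cvec R n := 'rV[R[i]^o]_n.

Notation Borel T := (g_sigma_algebraType (@open T)).

(* The library declares [m1 \x m2] sigma-finite canonically only when [m1] and
   [m2] are subprobabilities, hence this alias. *)
Section prod_measure.
Context d1 d2 (T1 : measurableType d1) (T2 : measurableType d2) (R : realType).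
Variables (m1 : {sigma_finite_measure set T1 -> \bar R})
  (m2 : {sigma_finite_measure set T2 -> \bar R}).

Definition prod_measure := (m1 \x m2)%E.

HB.instance Definition _ := Measure.on prod_measure.

Let prod_sigma_finite : sigma_finite setT prod_measure.
Proof.
have /sigma_finiteP[F [TF ndF Foo]] := sigma_finiteT m1.
have /sigma_finiteP[G [TG ndG Goo]] := sigma_finiteT m2.
exists (fun n => F n `*` G n).
  rewrite -setXTT TF TG predeqE => -[x y]; split.
    move=> [/= [n _ Fnx] [k _ Gky]]; exists (maxn n k) => //; split.
    - by move: x Fnx; exact/subsetPset/ndF/leq_maxl.
    - by move: y Gky; exact/subsetPset/ndG/leq_maxr.
  by move=> [n _ []/= ? ?]; split; exists n.
move=> k; have [? ?] := Foo k; have [? ?] := Goo k.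
split; first exact: measurableX.
by rewrite /prod_measure product_measure1E// lte_mul_pinfty// ge0_fin_numE.
Qed.

HB.instance Definition _ := Measure_isSigmaFinite.Build _ _ _ prod_measure
  prod_sigma_finite.

End prod_measure.

Section tuple_measure.
Context d (T : measurableType d) (R : realType).
Variable m : {sigma_finite_measure set T -> \bar R}.

Definition tcons n (x : T * n.-tuple T) : n.+1.-tuple T :=
  [tuple of x.1 :: x.2].

Lemma measurable_tcons n : measurable_fun setT (@tcons n).
Proof. exact: measurable_cons. Qed.

HB.instance Definition _ n := isMeasurableFun.Build _ _ _ _
  (@tcons n) (@measurable_tcons n).

Section tcons_measure.
Variables (n : nat) (mn : {sigma_finite_measure set (n.-tuple T) -> \bar R}).

Definition tcons_measure := pushforward (prod_measure m mn) (@tcons n).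

Let tcons0 : tcons_measure set0 = 0%E.
Proof. exact: measure0. Qed.

Let tcons_ge0 A : (0 <= tcons_measure A)%E.
Proof. exact: measure_ge0. Qed.

Let tcons_sigma_additive : semi_sigma_additive tcons_measure.
Proof. exact: measure_semi_sigma_additive. Qed.

HB.instance Definition _ := isMeasure.Build _ _ _ tcons_measure
  tcons0 tcons_ge0 tcons_sigma_additive.

Let tcons_sigma_finite : sigma_finite setT tcons_measure.
Proof.
have [F FT Ffin] := sigma_finiteT (prod_measure m mn).
pose g (t : n.+1.-tuple T) := (thead t, [tuple of behead t]).
have mg : measurable_fun setT g.
  apply/measurable_fun_pairP; split; last exact: measurable_behead.
  exact: (measurable_tnth ord0).
have gK x : g (tcons x) = x.
  by case: x => a b; rewrite /g/= theadE; congr (_, _); exact: val_inj.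
exists (fun k => g @^-1` (F k)).
  by rewrite -preimage_bigcup -FT preimage_setT.
move=> k; have [mF Foo] := Ffin k; split.
  by rewrite -[X in measurable X]setTI; exact: mg.
rewrite /tcons_measure /pushforward -comp_preimage.
by rewrite (_ : g \o _ = id) ?preimage_id//; apply/funext => x /=.
Qed.

HB.instance Definition _ := Measure_isSigmaFinite.Build _ _ _ tcons_measure
  tcons_sigma_finite.

End tcons_measure.

Fixpoint tuple_measure n : {sigma_finite_measure set (n.-tuple T) -> \bar R} :=
  match n with
  | 0 => \d_([tuple] : 0.-tuple T)
  | n'.+1 => tcons_measure (tuple_measure n')
  end.

End tuple_measure.

Section lebesgue_Cvec.
Context (R : realType) (n : nat).
Local Notation RR := (measurableTypeR R * measurableTypeR R)%type.

Definition Cvec_of_tuple (t : n.-tuple RR) : Borel (Cvec R n) :=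
  \row_j ((tnth t j).1 +i* (tnth t j).2).

Lemma ltc_norm_coord (a b e : R) : `|a| < e / 2 -> `|b| < e / 2 ->
  `|a +i* b| < e%:C.
Proof.
move=> ae be.
have -> : a +i* b = a%:C + 'i * b%:C by rewrite [LHS]complexE.
apply: le_lt_trans (ler_normD _ _) _.
rewrite normrM !normc_def/= !expr0n/= !addr0 add0r expr1n sqrtr1 mul1r !sqrtr_sqr.
by rewrite -rmorphD ltcR [ltRHS](splitr e) ltrD.
Qed.

Lemma measurable_Cvec_of_tuple : measurable_fun setT Cvec_of_tuple.
Proof.
apply: (@measurability _ _ _ (Borel (Cvec R n)) _ _ (@open (Cvec R n))) => // _ [U oU <-].
rewrite setTI.
pose box (p : n.-tuple (rat * rat) * nat) : set (n.-tuple RR) :=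
  \bigcap_(j : 'I_n)
    ((fun t : n.-tuple RR => (tnth t j).1) @^-1` ball (ratr (tnth p.1 j).1 : R) p.2.+1%:R^-1 `&`
     (fun t : n.-tuple RR => (tnth t j).2) @^-1` ball (ratr (tnth p.1 j).2 : R) p.2.+1%:R^-1).
have mbox p : measurable (box p).
  apply: fin_bigcap_measurable => [|j _]; first exact: finite_finset.
  have mj := @measurable_tnth _ RR n j.
  apply: measurableI.
  - rewrite -[X in measurable X]setTI.
    by apply: (measurableT_comp measurable_fst mj) => //; rewrite ball_itv; exact: measurable_itv.
  - rewrite -[X in measurable X]setTI.
    by apply: (measurableT_comp measurable_snd mj) => //; rewrite ball_itv; exact: measurable_itv.
have -> : Cvec_of_tuple @^-1` U =
    \bigcup_p (if `[< box p `<=` Cvec_of_tuple @^-1` U >] then box p else set0).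
  apply/seteqP; split => [t /= Ut|t [p _]]; last by case: asboolP => // + bt; exact.
  have /nbhs_ballP[e e0 eU] : nbhs (Cvec_of_tuple t) U by exact: open_nbhs_nbhs.
  move: e0 eU; case: e => e e' /=; rewrite ltcE/= => /andP[/eqP-> {e'} e0] eU.
  have [k ke] : exists k : nat, k.+1%:R^-1 < e / 4.
    exists (Num.truncn (e / 4)^-1).
    by rewrite invf_plt ?posrE ?divr_gt0// truncnS_gt.
  have qP (x : R) : exists q : rat, ball (ratr q : R) k.+1%:R^-1 x.
    have /rat_in_itvoo[q] : x - k.+1%:R^-1 < x + k.+1%:R^-1.
      by rewrite ltrD2l gtrN ?invr_gt0.
    rewrite in_itv/= => qx; exists q.
    by change (`|ratr q - x| < k.+1%:R^-1); rewrite ltr_distl.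
  have /choice[q Hq] := qP.
  pose p : n.-tuple (rat * rat) * nat :=
    ([tuple (q (tnth t j).1, q (tnth t j).2) | j < n], k).
  have bt : box p t by move=> j _; rewrite /= !tnth_mktuple; split; exact: Hq.
  exists p => //; case: asboolP => // -[] s bs; apply: eU.
  have near (x y z : R) : ball z k.+1%:R^-1 x -> ball z k.+1%:R^-1 y ->
      `|x - y| < e / 2.
    rewrite /ball/= => zx zy; rewrite (splitr (e / 2)).
    rewrite -mulrA -invfM -natrM.
    rewrite (le_lt_trans (ler_distD z _ _))// ltrD//.
      by rewrite distrC (lt_trans zx).
    exact: (lt_trans zy).
  split=> [|i j]; first by rewrite ltcE/= eqxx.
  have [t1 t2] := bt j I; have [s1 s2] := bs j I.
  rewrite /ball/= !mxE.
  rewrite (_ : _ - _ = ((tnth t j).1 - (tnth s j).1) +i*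
    ((tnth t j).2 - (tnth s j).2))//.
  by apply: ltc_norm_coord; [exact: near t1 s1|exact: near t2 s2].
apply: countable_bigcupT_measurable => // p.
by case: asboolP.
Qed.

Definition lebesgue2 : {sigma_finite_measure set RR -> \bar R} :=
  prod_measure lebesgue_measure lebesgue_measure.

HB.instance Definition _ := isMeasurableFun.Build _ _ _ _
  Cvec_of_tuple measurable_Cvec_of_tuple.

Definition lebesgue_Cvec := pushforward (tuple_measure lebesgue2 n) Cvec_of_tuple.

Let lebesgue0 : lebesgue_Cvec set0 = 0%E.
Proof. exact: measure0. Qed.

Let lebesgue_ge0 A : (0 <= lebesgue_Cvec A)%E.
Proof. exact: measure_ge0. Qed.

Let lebesgue_sigma_additive : semi_sigma_additive lebesgue_Cvec.
Proof. exact: measure_semi_sigma_additive. Qed.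

HB.instance Definition _ := isMeasure.Build _ _ _ lebesgue_Cvec
  lebesgue0 lebesgue_ge0 lebesgue_sigma_additive.

End lebesgue_Cvec.

Section complex_manifold.
Context (R : realType) (n : nat) (M : topologicalType).

(* [cmap] and [cinv] are meaningful only on [dom] and on [cmap @` dom]. *)
Record chart := Chart {
  dom : set M ;
  cmap : M -> Cvec R n ;
  cinv : Cvec R n -> M ;
  dom_open : open dom ;
  rng_open : open (cmap @` dom) ;
  cmapK : {in dom, cancel cmap cinv} ;
  cmap_continuous : {in dom, continuous cmap} ;
  cinv_continuous : {in cmap @` dom, continuous cinv} }.

Definition rng (c : chart) : set (Cvec R n) := cmap c @` dom c.

Definition transition (c c' : chart) : Cvec R n -> Cvec R n :=
  cmap c' \o cinv c.

(* [differentiable] is Frechet differentiability over [R[i]]. *)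
Definition holomorphic (U : set (Cvec R n)) (f : Cvec R n -> Cvec R n) :=
  forall z, U z -> differentiable f z.

Record complex_manifold := ComplexManifold {
  atlas : set chart ;
  atlas_cover : \bigcup_(c in atlas) dom c = [set: M] ;
  atlas_holomorphic : forall c c', atlas c -> atlas c' ->
    holomorphic (cmap c @` (dom c `&` dom c')) (transition c c') ;
  manifold_hausdorff : hausdorff_space M ;
  manifold_second_countable : @second_countable M }.

End complex_manifold.

Section plurisubharmonic.
Context (R : realType).
Local Open Scope ereal_scope.

Definition usc_on (T : topologicalType) (U : set T) (f : T -> \bar R) :=
  forall x, U x -> forall a : R, f x < a%:E -> \forall y \near x, f y < a%:E.

(* Here [D] is meant to be open; the function identically equal to [-oo] is
   subharmonic. *)
Definition subharmonic (D : set R[i]^o) (g : R[i]^o -> \bar R) :=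
  [/\ usc_on D g,
      forall z, D z -> g z < +oo &
      forall (c : R[i]) (r : R), (0 < r)%R ->
        [set z | (`|z - c| <= r%:C)%R] `<=` D ->
        g c <= ((2 * pi)^-1)%:E *
          \int[lebesgue_measure]_(t in `[0%R, (2 * pi)%R])
            g (c + r%:C * (cos t +i* sin t))%R ].

Definition psh_on n (U : set (Cvec R n)) (f : Cvec R n -> \bar R) :=
  [/\ usc_on U f,
      forall z, U z -> f z < +oo &
      forall a b : Cvec R n,
        subharmonic [set l : R[i]^o | U (a + l *: b)%R]
          (fun l => f (a + l *: b)%R) ].

Context (n : nat) (M : topologicalType) (X : complex_manifold R n M).

Definition psh (u : M -> \bar R) :=
  forall c, atlas X c -> psh_on (rng c) (u \o cinv c).

Definition negative_psh (u : M -> \bar R) :=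
  [/\ psh u, forall x, u x <= 0 & exists x, u x != -oo].

End plurisubharmonic.

Section volume_form.
Context (R : realType) (n : nat) (M : ptopologicalType).
Variable X : complex_manifold R n M.

(* In the chart [c] with coordinates [z_j = x_j + i y_j] the form is
   [density c z dx_1 /\ dy_1 /\ ... /\ dx_n /\ dy_n]; the real Jacobian of a
   holomorphic map is the square of the modulus of its complex Jacobian. *)
Record volume_form := VolumeForm {
  density : chart R n M -> Cvec R n -> R ;
  density_gt0 : forall c z, atlas X c -> rng c z -> 0 < density c z ;
  density_continuous : forall c, atlas X c -> {in rng c, continuous (density c)} ;
  density_transition : forall c c' x, atlas X c -> atlas X c' ->
    dom c x -> dom c' x ->
    (density c (cmap c x))%:C =
      `|\det (jacobian (transition c c') (cmap c x))| ^+ 2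
      * (density c' (cmap c' x))%:C }.

Implicit Type mu : {measure set (Borel M) -> \bar R}.

(* [M] being second countable, at most one Borel measure has this property. *)
Definition measure_of_form (V : volume_form) mu :=
  forall c (A : set (Borel M)), atlas X c -> measurable A -> A `<=` dom c ->
    mu A = (\int[@lebesgue_Cvec R n]_(z in cmap c @` A) (density V c z)%:E)%E.

Definition norm1 mu (E : set M) (u : M -> \bar R) : \bar R :=
  (\int[mu]_(x in E) `|u x|)%E.

Definition exhaustion (E : nat -> set M) :=
  [/\ forall j, open (E j) /\ precompact (E j),
      forall j, E j `<=` E j.+1 &
      \bigcup_j E j = [set: M] ].

Definition norming (V : volume_form) := exists2 mu, measure_of_form V mu &
  [/\ forall u, negative_psh X u -> (norm1 mu setT u < +oo)%E,
      forall F : set M, compact F -> exists2 C : R, 0 < C &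
        forall u, negative_psh X u -> forall z, F z ->
          (u z <= - (C%:E * norm1 mu setT u))%E &
      forall E : nat -> set M, exhaustion E ->
        exists eps : nat -> R, [/\ forall j, 0 < eps j,
          eps @ \oo --> (0 : R) &
          forall u, negative_psh X u -> forall j,
            (norm1 mu (~` E j) u <= (eps j)%:E * norm1 mu setT u)%E ] ].

End volume_form.

(* Main.v *)
From HB Require Import structures.
From mathcomp Require Import all_boot all_order all_algebra fingroup perm.
From mathcomp Require Import all_classical all_reals all_analysis measurable_realfun.
From mathcomp Require Import complex ring lra.
Require Import Defs.

(** Cover [M] by countably many coordinate discs [D k].  For a negative
plurisubharmonic [u] let [mass u k] be the integral of [- u] over [D k] in the
chart.  The sub-mean value inequality gives [mass u k <= const * - u x] for
[x] in [D k] (Harnack); integrating it over the intersection of two overlapping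
discs makes their masses comparable, and by connectedness every [mass u k] is
comparable to [mass u 0], with constants independent of [u].  Take
[V = sum_k a_k * chi_k], where [chi_k] is a tent function on [D k] times the
Lebesgue form of the chart: if [a_k] decreases fast enough, the densities
converge locally uniformly, and the part of the [V]-norm carried by the [k]-th
disc is at most [2 ^- k * mass u 0].  The three properties follow, since
[mass u 0] is also bounded by a multiple of the norm.

That such a [V] induces a measure on [M] requires the change of variables
formula for biholomorphic maps, here with a holomorphic map meaning one that is
complex differentiable at each point.  Goursat's theorem gives the maximum
principle on discs, hence a Schwarz lemma, hence strict differentiability, so
that the image of a small disc is almost its image under the differential;
linear maps scale the measure by the squared modulus of the determinant, and
averaging over small discs turns the resulting local inequality into an
inequality of measures.  The inverse map provides the opposite inequality. *)

(** No constant depends on [u]: the comparison constants come only from measures of discs and of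
    overlaps of discs. The norm of [Cvec R n] is the maximum norm, so a disc is a polydisc; the
    sub-mean value inequality over it uses no more than its stability under complex scalars of
    modulus at most 1. That [u] is not identically [-oo] makes one mass finite, and comparability
    then makes all of them finite.

    The weights meet two demands: they beat the comparison constants, which may grow along the
    sequence of discs, and the suprema of the densities on earlier discs, as the cover need not be
    locally finite. The measure is a sum of pushforwards from the charts, so that countable
    additivity is free and the change of variables only identifies it in each chart.

    Goursat's theorem is applied in logarithmic polar coordinates, where an annulus is a rectangle,
    so that neither paths nor winding numbers enter. *)

Set Implicit Arguments.
Unset Strict Implicit.
Unset Printing Implicit Defensive.

Import Order.TTheory GRing.Theory Num.Theory.
Import numFieldNormedType.Exports.

Local Open Scope classical_set_scope.
Local Open Scope ring_scope.
Local Open Scope complex_scope.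

(** * The real norm of a complex normed space *)

Section real_norm.
Context (R : realType).
Implicit Types V W : normedModType R[i].

(** The norm of a complex normed space takes its values in [R[i]]; the real part loses nothing, by
    [rnormE], and gives access to the total order of [R]. *)
Definition rnorm V (v : V) : R := complex.Re `|v|.

Lemma rnormE V (v : V) : `|v| = (rnorm v)%:C.
Proof. by have := normr_ge0 v; rewrite /rnorm; case: `|v| => a b; rewrite lecE/= => /andP[/eqP-> _]. Qed.

Lemma rnorm_ge0 V (v : V) : 0 <= rnorm v.
Proof. by rewrite -lecR -rnormE normr_ge0. Qed.

Lemma rnorm_gt0 V (v : V) : (0 < rnorm v) = (v != 0).
Proof. by rewrite -ltcR -rnormE normr_gt0. Qed.

Lemma rnorm0 V : rnorm (0 : V) = 0.
Proof. by rewrite /rnorm normr0. Qed.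

Lemma rnormN V (v : V) : rnorm (- v) = rnorm v.
Proof. by rewrite /rnorm normrN. Qed.

Lemma rnorm_dist V (v w : V) : rnorm (v - w) = rnorm (w - v).
Proof. by rewrite -rnormN opprB. Qed.

Lemma rnormD V (v w : V) : rnorm (v + w) <= rnorm v + rnorm w.
Proof. by rewrite -lecR rmorphD/= -!rnormE ler_normD. Qed.

Lemma rnormB V (v w : V) : rnorm (v - w) <= rnorm v + rnorm w.
Proof. by rewrite -(rnormN w); exact: rnormD. Qed.

Lemma ler_rnorm_dist V (v w : V) :
  `|rnorm v - rnorm w| <= rnorm (v - w).
Proof.
have H (a b : V) : rnorm a - rnorm b <= rnorm (a - b).
  by rewrite lerBlDr -[in leLHS](subrK b a) rnormD.
by rewrite ler_norml H andbT lerNl opprB rnorm_dist H.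
Qed.

Lemma rnormZ V (a : R[i]^o) (v : V) : rnorm (a *: v) = rnorm a * rnorm v.
Proof. by apply: (@complexI R); rewrite rmorphM/= -!rnormE normrZ. Qed.

Lemma rnormM (a b : R[i]^o) : rnorm (a * b : R[i]^o) = rnorm a * rnorm b.
Proof. exact: rnormZ. Qed.

Lemma rnormV (a : R[i]^o) : rnorm (a^-1 : R[i]^o) = (rnorm a)^-1.
Proof. by apply: (@complexI R); rewrite fmorphV/= -!rnormE normfV. Qed.

Lemma rnorm1 : rnorm (1 : R[i]^o) = 1.
Proof. by rewrite /rnorm normr1. Qed.

Lemma rnorm_real (a : R) : rnorm (a%:C : R[i]^o) = `|a|.
Proof. by rewrite /rnorm normc_def/= expr0n addr0 sqrtr_sqr. Qed.

Lemma rnormcE (a b : R) : rnorm (a +i* b : R[i]^o) = Num.sqrt (a ^+ 2 + b ^+ 2).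
Proof. by rewrite /rnorm normc_def. Qed.

Lemma rnorm_Re (z : R[i]^o) : `|complex.Re z| <= rnorm z.
Proof. by rewrite -lecR -rnormE; exact: normc_ge_Re. Qed.

Lemma rnorm_Im (z : R[i]^o) : `|complex.Im z| <= rnorm z.
Proof.
case: z => a b; rewrite rnormcE/= -sqrtr_sqr; apply: ler_wsqrtr.
by rewrite lerDr sqr_ge0.
Qed.

Lemma rnorm_le_ReIm (a b : R) : rnorm (a +i* b : R[i]^o) <= `|a| + `|b|.
Proof.
have -> : (a +i* b : R[i]^o) = a%:C + 'i * b%:C by rewrite [LHS]complexE.
by rewrite (le_trans (rnormD _ _))// rnormM rnorm_real -/(0 +i* 1) rnormcE
  expr0n expr1n add0r sqrtr1 mul1r rnorm_real.
Qed.

Lemma rnorm_unit (t : R) : rnorm (cos t +i* sin t : R[i]^o) = 1.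
Proof. by rewrite rnormcE cos2Dsin2 sqrtr1. Qed.

Lemma ball_rnorm V (x y : V) (e : R) : ball x e%:C y = (rnorm (x - y) < e) :> Prop.
Proof. by rewrite -ball_normE/= rnormE ltcR. Qed.

Lemma nbhs_rnormP V (x : V) (A : set V) :
  nbhs x A <-> exists2 e : R, 0 < e & forall y, rnorm (x - y) < e -> A y.
Proof.
split=> [/nbhs_ballP[e e0 eA]|[e e0 eA]].
  move: e0 eA; case: e => e e' /=; rewrite ltcE/= => /andP[/eqP-> {e'} e0] eA.
  by exists e => // y xy; apply: eA; rewrite ball_rnorm.
apply/nbhs_ballP; exists e%:C => /=; first by rewrite ltcR.
by move=> y; rewrite ball_rnorm; exact: eA.
Qed.

Lemma rnorm_continuous V W (f : V -> W) x : {for x, continuous f} <->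
  forall e : R, 0 < e -> exists2 d : R, 0 < d &
    forall y, rnorm (x - y) < d -> rnorm (f x - f y) < e.
Proof.
split=> [fx e e0|fx A /nbhs_rnormP[e e0 eA]].
  apply/nbhs_rnormP; apply: (fx [set z | rnorm (f x - z) < e]).
  by apply/nbhs_rnormP; exists e.
by have [d d0 xd] := fx _ e0; apply/nbhs_rnormP; exists d => // y /xd; exact: eA.
Qed.

Lemma rnorm_continuousR V (f : V -> R) x : {for x, continuous f} <->
  forall e : R, 0 < e -> exists2 d : R, 0 < d &
    forall y, rnorm (x - y) < d -> `|f x - f y| < e.
Proof.
split=> [fx e e0|fx A /nbhs_ballP[e e0 eA]].
  apply/nbhs_rnormP; apply: (fx (ball (f x) e)).
  by apply/nbhs_ballP; exists e.
by have [d d0 xd] := fx _ e0; apply/nbhs_rnormP; exists d => // y /xd; exact: eA.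
Qed.

Lemma littleo_rnorm V W (x : V) (f : V -> W) : differentiable f x ->
  forall e : R, 0 < e -> exists2 d : R, 0 < d &
    forall y, rnorm (x - y) < d ->
      rnorm (f y - f x - 'd f x (y - x)) <= e * rnorm (y - x).
Proof.
move=> /diff_locallyxC dfx e e0.
have /eqaddoP/(_ e%:C) : (fun h => f (x + h)) = (fun h => f x + 'd f x h) +o_ (0 : V) id.
  by apply/funext => h; exact: dfx.
rewrite ltcR => /(_ e0)/nbhs_rnormP[d d0 xd]; exists d => // y xy.
have /xd : rnorm (0 - (y - x)) < d by rewrite sub0r opprB.
move=> H; have {H} : `|f (x + (y - x)) - (f x + 'd f x (y - x))| <= e%:C * `|y - x| := H.
by rewrite [x + _]addrC subrK !rnormE -rmorphM/= lecR opprD addrA.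
Qed.

(** The norm of [Cvec R n] is the maximum norm; [rnorm_lt] and [rnorm_le] are the converse
    bounds. *)
Lemma coord_rnorm n (v : Cvec R n) j : rnorm (v 0 j : R[i]^o) <= rnorm v.
Proof.
apply/ler_addgt0Pr => d d0.
have : ball v (rnorm v + d)%:C 0 by rewrite ball_rnorm subr0 ltrDl.
by move=> -[_ /(_ 0 j)]; rewrite mxE [ball _ _ _]ball_rnorm subr0 => /ltW.
Qed.

Lemma rnorm_lt n (v : Cvec R n) e : 0 < e ->
  (forall j, rnorm (v 0 j : R[i]^o) < e) -> rnorm v < e.
Proof.
move=> e0 ve; rewrite -ltcR -rnormE; have [v0|v0] := eqVneq (mx_norm v) 0.
  by rewrite [X in X < _](_ : _ = 0)// ltcR.
have [[i j] ij] := mx_norm_neq0 v0.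
by rewrite [X in X < _](_ : _ = `|v i j|)// (ord1 i) rnormE ltcR.
Qed.

Lemma rnorm_le n (v : Cvec R n) e : 0 <= e ->
  (forall j, rnorm (v 0 j : R[i]^o) <= e) -> rnorm v <= e.
Proof.
move=> e0 ve; apply/ler_addgt0Pr => d d0; apply/ltW/rnorm_lt => [|j].
  exact: ltr_wpDl.
by rewrite (le_lt_trans (ve j))// ltrDl.
Qed.

End real_norm.

(** * Goursat's theorem *)

Section segment_integral.
Context (R : realType).
Implicit Types (f g : R -> R) (a b c : R).

Local Notation int f a b := (\int[lebesgue_measure]_(x in `[a, b]) f x).

Lemma continuous_segment_integrable f a b : {in `[a, b], continuous f} ->
  lebesgue_measure.-integrable `[a, b] (EFin \o f).
Proof.
move=> cf; apply: continuous_compact_integrable; first exact: segment_compact.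
by apply: continuous_in_subspaceT => x; rewrite inE/= => /cf.
Qed.

Lemma Rintegral_segmentD f a b c : a <= b <= c -> {in `[a, c], continuous f} ->
  int f a c = int f a b + int f b c.
Proof.
move=> /andP[ab bc] cf; apply/eqP; rewrite addrC -subr_eq; apply/eqP.
rewrite Rintegral_itvB ?bnd_simp//; last exact: continuous_segment_integrable.
rewrite Rintegral_itv_obnd_cbnd//.
apply: integrableS (continuous_segment_integrable cf) => //.
by apply: subset_itvr; rewrite bnd_simp.
Qed.

Lemma lebesgue_measure_segment a b : a <= b ->
  fine (@lebesgue_measure R `[a, b]%classic) = b - a.
Proof.
rewrite lebesgue_measure_itv/= lte_fin le_eqVlt => /predU1P[->|ab].
  by rewrite ltxx subrr.
by rewrite ab -EFinB.
Qed.

Lemma Rintegral_segment_near f a b K E : a <= b -> {in `[a, b], continuous f} ->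
  {in `[a, b], forall x, `|f x - K| <= E} ->
  `|int f a b - K * (b - a)| <= E * (b - a).
Proof.
move=> ab cf fK.
have cstK k : lebesgue_measure.-integrable `[a, b] (EFin \o cst (k : R)).
  by apply: continuous_segment_integrable => x _; exact: cst_continuous.
have fi := continuous_segment_integrable cf.
have cst_int k : int (cst k) a b = k * (b - a).
  by rewrite Rintegral_cst//= lebesgue_measure_segment.
rewrite ler_distl -!cst_int -RintegralB// -RintegralD//; apply/andP; split;
  apply: le_Rintegral => //=; [|move=> x xab| |move=> x xab].
- rewrite (_ : _ \o _ = EFin \o cst (K - E))//.
- by have := fK x xab; rewrite ler_distl => /andP[].
- rewrite (_ : _ \o _ = EFin \o cst (K + E))//.
- by have := fK x xab; rewrite ler_distl => /andP[].
Qed.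

End segment_integral.

Section goursat.
Context (R : realType).

(* The closed 1-form is [Q ds + P dt] ; [dP/ds = dQ/dt = A] at the point. *)
Definition closed_at (P Q : R -> R -> R) (s t : R) :=
  exists A B C : R, forall e : R, 0 < e -> exists2 d : R, 0 < d &
    forall s' t', `|s' - s| < d -> `|t' - t| < d ->
      `|P s' t' - P s t - (A * (s' - s) + B * (t' - t))| <= e * (`|s' - s| + `|t' - t|) /\
      `|Q s' t' - Q s t - (C * (s' - s) + A * (t' - t))| <= e * (`|s' - s| + `|t' - t|).

Lemma linear_approx_continuous (f : R -> R) (x A : R) :
  (forall e : R, 0 < e -> exists2 d : R, 0 < d &
    forall y, `|y - x| < d -> `|f y - f x - A * (y - x)| <= e * `|y - x|) ->
  {for x, continuous f}.
Proof.
move=> fx; apply/cvgrPdist_lt => /= e e0; have [d d0 dP] := fx 1 ltr01.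
have K0 : 0 < 1 + `|A| by rewrite ltr_pwDl.
exists (Num.min d (e / (1 + `|A|))) => /=; first by rewrite lt_min d0 divr_gt0.
move=> y /=; rewrite distrC lt_min => /andP[/dP]; rewrite mul1r => H1.
rewrite ltr_pdivlMr// => H2; rewrite distrC.
have -> : f y - f x = f y - f x - A * (y - x) + A * (y - x) by rewrite subrK.
rewrite (le_lt_trans (ler_normD _ _))// normrM; apply: le_lt_trans H2.
by rewrite [leRHS]mulrDr mulr1 lerD// mulrC.
Qed.

Lemma segment_dist (x L y z : R) : x <= y <= x + L -> x <= z <= x + L ->
  `|z - y| <= L.
Proof. by move=> ? ?; rewrite ler_distl; lra. Qed.

Lemma nested_segments (u l : nat -> R) : (forall k, 0 <= l k) ->
  (forall k, u k <= u k.+1) -> (forall k, u k.+1 + l k.+1 <= u k + l k) ->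
  exists s, forall k, u k <= s <= u k + l k.
Proof.
move=> l0 incr decr.
have incr' i k : u i <= u (k + i)%N.
  by elim: k => // k ih; rewrite addSn (le_trans ih).
have decr' i k : u (k + i)%N + l (k + i)%N <= u i + l i.
  by elim: k => // k ih; rewrite addSn (le_trans _ ih).
have ul i k : u i <= u k + l k.
  have [/subnK <-|/ltnW/subnK <-] := leqP i k.
    by apply: (le_trans (incr' _ (k - i)%N)); rewrite lerDl.
  by apply: le_trans (decr' _ (i - k)%N); rewrite lerDl.
exists (sup (range u)) => k; apply/andP; split.
  apply: ub_le_sup; last by exists k.
  by exists (u 0%N + l 0%N) => _ [i _ <-].
by apply: ge_sup => [|_ [i _ <-]//]; exists (u 0%N), 0%N.
Qed.

Variables (P Q : R -> R -> R) (a0 b0 c0 d0 : R).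
Hypotheses (ab0 : a0 <= b0) (cd0 : c0 <= d0).
Hypothesis PQ : forall s t, a0 <= s <= b0 -> c0 <= t <= d0 -> closed_at P Q s t.

Let contP s : a0 <= s <= b0 -> {in `[c0, d0], continuous (P s)}.
Proof.
move=> sab t tcd; have [A [B [C H]]] := PQ sab tcd.
apply: (@linear_approx_continuous _ _ B) => e e0; have [d dd0 dP] := H _ e0.
exists d => // y yt; have := dP s y; rewrite subrr normr0 mulr0 !add0r.
by move=> /(_ dd0 yt)[].
Qed.

Let contQ t : c0 <= t <= d0 -> {in `[a0, b0], continuous (Q ^~ t)}.
Proof.
move=> tcd s sab; have [A [B [C H]]] := PQ sab tcd.
apply: (@linear_approx_continuous _ _ C) => e e0; have [d dd0 dP] := H _ e0.
exists d => // y yt; have := dP y t; rewrite subrr normr0 !mulr0 !addr0.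
by move=> /(_ yt dd0)[].
Qed.

(** The counterclockwise integral of [Q ds + P dt] along the boundary of the rectangle. *)
Let Phi a b c d :=
  \int[lebesgue_measure]_(t in `[c, d]) (P b t - P a t)
  - \int[lebesgue_measure]_(s in `[a, b]) (Q s d - Q s c).

Let contPB a b c d : a0 <= a <= b0 -> a0 <= b <= b0 -> c0 <= c -> d <= d0 ->
  {in `[c, d], continuous (fun t => P b t - P a t)}.
Proof.
move=> ha hb hc hd x; rewrite in_itv/= => /andP[cx xd].
have xcd : x \in `[c0, d0] by rewrite in_itv/= (le_trans hc)// (le_trans _ hd).
by apply: (@continuousB _ R^o R^o); exact: contP.
Qed.

Let contQB a b c d : c0 <= c <= d0 -> c0 <= d <= d0 -> a0 <= a -> b <= b0 ->
  {in `[a, b], continuous (fun s => Q s d - Q s c)}.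
Proof.
move=> ha hb hc hd x; rewrite in_itv/= => /andP[cx xd].
have xcd : x \in `[a0, b0] by rewrite in_itv/= (le_trans hc)// (le_trans _ hd).
by apply: (@continuousB _ R^o R^o); [exact: (contQ hb)|exact: (contQ ha)].
Qed.

Let Phi_splits a m b c d : a0 <= a -> a <= m <= b -> b <= b0 ->
  c0 <= c -> c <= d -> d <= d0 ->
  Phi a b c d = Phi a m c d + Phi m b c d.
Proof.
move=> h1 /andP[h2 h3] h4 h5 h6 h7; rewrite /Phi.
have Ha : a0 <= a <= b0 by lra.
have Hb : a0 <= b <= b0 by lra.
have Hm : a0 <= m <= b0 by lra.
have Hc : c0 <= c <= d0 by lra.
have Hd : c0 <= d <= d0 by lra.
rewrite (@Rintegral_segmentD _ (fun s => Q s d - Q s c) a m b) ?h2//; last exact: contQB.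
suff -> : \int[lebesgue_measure]_(t in `[c, d]) (P b t - P a t) =
  \int[lebesgue_measure]_(t in `[c, d]) (P m t - P a t) +
  \int[lebesgue_measure]_(t in `[c, d]) (P b t - P m t) by ring.
rewrite -RintegralD//; last 2 first.
- by apply: continuous_segment_integrable; exact: contPB.
- by apply: continuous_segment_integrable; exact: contPB.
by apply: eq_Rintegral => t _; ring.
Qed.

Let Phi_splitt a b c m d : a0 <= a -> a <= b -> b <= b0 ->
  c0 <= c -> c <= m <= d -> d <= d0 ->
  Phi a b c d = Phi a b c m + Phi a b m d.
Proof.
move=> h1 h4 h5 h6 /andP[h2 h3] h7; rewrite /Phi.
have Ha : a0 <= a <= b0 by lra.
have Hb : a0 <= b <= b0 by lra.
have Hm : c0 <= m <= d0 by lra.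
have Hc : c0 <= c <= d0 by lra.
have Hd : c0 <= d <= d0 by lra.
rewrite (@Rintegral_segmentD _ (fun s => P b s - P a s) c m d) ?h2//; last exact: contPB.
suff -> : \int[lebesgue_measure]_(s in `[a, b]) (Q s d - Q s c) =
  \int[lebesgue_measure]_(s in `[a, b]) (Q s m - Q s c) +
  \int[lebesgue_measure]_(s in `[a, b]) (Q s d - Q s m) by ring.
rewrite -RintegralD//; last 2 first.
- by apply: continuous_segment_integrable; exact: contQB.
- by apply: continuous_segment_integrable; exact: contQB.
by apply: eq_Rintegral => t _; ring.
Qed.

Let w k : R := (b0 - a0) / 2 ^+ k.
Let h k : R := (d0 - c0) / 2 ^+ k.

Let inside k (p : R * R) :=
  [/\ a0 <= p.1, p.1 + w k <= b0, c0 <= p.2 & p.2 + h k <= d0].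

Let Phik k (p : R * R) := Phi p.1 (p.1 + w k) p.2 (p.2 + h k).

Let wS k : w k = w k.+1 + w k.+1.
Proof. by rewrite /w exprS; field; rewrite expf_neq0. Qed.

Let hS k : h k = h k.+1 + h k.+1.
Proof. by rewrite /h exprS; field; rewrite expf_neq0. Qed.

Let w_ge0 k : 0 <= w k.
Proof. by rewrite divr_ge0 ?subr_ge0// exprn_ge0. Qed.

Let h_ge0 k : 0 <= h k.
Proof. by rewrite divr_ge0 ?subr_ge0// exprn_ge0. Qed.

(** The boundary integrals of the four quarters add up to that of the rectangle, so one of them
    carries at least a quarter of it. *)
Let bisect K k p : inside k p -> K <= `|Phik k p| ->
  exists p' : R * R, inside k.+1 p' /\ [/\ K / 4 <= `|Phik k.+1 p'|,
    p.1 <= p'.1, p'.1 + w k.+1 <= p.1 + w k, p.2 <= p'.2 & p'.2 + h k.+1 <= p.2 + h k].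
Proof.
case: p => a c; rewrite /inside/Phik/= => -[h1 h2 h3 h4] HK.
have Hw := wS k; have Hh := hS k; have w0 := w_ge0 k.+1; have h0 := h_ge0 k.+1.
set w' := w k.+1 in Hw w0 *; set h' := h k.+1 in Hh h0 *.
have : Phi a (a + w k) c (c + h k) =
  Phi a (a + w') c (c + h') + Phi (a + w') (a + w' + w') c (c + h') +
  (Phi a (a + w') (c + h') (c + h' + h') +
   Phi (a + w') (a + w' + w') (c + h') (c + h' + h')).
  rewrite (@Phi_splitt _ _ _ (c + h')); [|lra..].
  rewrite (@Phi_splits _ (a + w') _ c); [|lra..].
  rewrite (@Phi_splits _ (a + w') _ (c + h')); [|lra..].
  by rewrite Hw Hh !addrA.
move=> E.
have : [\/ K / 4 <= `|Phi a (a + w') c (c + h')|,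
  K / 4 <= `|Phi (a + w') (a + w' + w') c (c + h')|,
  K / 4 <= `|Phi a (a + w') (c + h') (c + h' + h')| |
  K / 4 <= `|Phi (a + w') (a + w' + w') (c + h') (c + h' + h')|].
  case: (leP (K/4) `|Phi a (a + w') c (c + h')|) => [|H1]; first by constructor.
  case: (leP (K/4) `|Phi (a + w') (a + w' + w') c (c + h')|) => [|H2]; first by constructor.
  case: (leP (K/4) `|Phi a (a + w') (c + h') (c + h' + h')|) => [|H3]; first by constructor.
  constructor 4; rewrite leNgt; apply/negP => H4.
  move: HK; rewrite E leNgt => /negP; apply.
  rewrite (le_lt_trans (ler_normD _ _))//.
  rewrite (le_lt_trans (lerD (ler_normD _ _) (ler_normD _ _)))//; lra.
case=> H; [exists (a, c)|exists (a + w', c)|exists (a, c + h')|exists (a + w', c + h')];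
  split=> //=; clear E HK; split=> //=; clear H; lra.
Qed.

Theorem goursat_rectangle :
  \int[lebesgue_measure]_(t in `[c0, d0]) (P b0 t - P a0 t) =
  \int[lebesgue_measure]_(s in `[a0, b0]) (Q s d0 - Q s c0).
Proof.
apply/eqP; rewrite -subr_eq0 -normr_eq0; apply/eqP; rewrite -/(Phi a0 b0 c0 d0).
set K := `|_|.
have K00 : K = `|Phik 0 (a0, c0)|.
  by rewrite /Phik/= /w /h !expr0 !divr1 ![_ + (_ - _)]addrC !subrK.
have in0 : inside 0 (a0, c0).
  by rewrite /inside/= /w /h !expr0 !divr1; split => //; lra.
have [next nextP] : exists next : nat -> (R * R)%type -> (R * R)%type, forall k p,
    inside k p /\ K / 4 ^+ k <= `|Phik k p| ->
    inside k.+1 (next k p) /\ [/\ K / 4 ^+ k.+1 <= `|Phik k.+1 (next k p)|,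
    p.1 <= (next k p).1, (next k p).1 + w k.+1 <= p.1 + w k,
    p.2 <= (next k p).2 & (next k p).2 + h k.+1 <= p.2 + h k].
  have H (kp : nat * (R * R)) : exists p', inside kp.1 kp.2 /\ K / 4 ^+ kp.1 <= `|Phik kp.1 kp.2| ->
    inside kp.1.+1 p' /\ [/\ K / 4 ^+ kp.1.+1 <= `|Phik kp.1.+1 p'|,
    kp.2.1 <= p'.1, p'.1 + w kp.1.+1 <= kp.2.1 + w kp.1,
    kp.2.2 <= p'.2 & p'.2 + h kp.1.+1 <= kp.2.2 + h kp.1].
    case: kp => k p /=; have [[ikp Kp]|nkp] := pselect (inside k p /\ K / 4 ^+ k <= `|Phik k p|).
      have [p' Hp'] := bisect ikp Kp; exists p' => _; move: Hp'.
      by rewrite exprSr invfM mulrA.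
    by exists p.
  have [f fP] := choice H; exists (fun k p => f (k, p)) => k p; exact: (fP (k, p)).
pose p k := nat_rect (fun=> (R * R)%type) (a0, c0) next k.
have pP k : inside k (p k) /\ K / 4 ^+ k <= `|Phik k (p k)|.
  elim: k => [|k /nextP[? []]//]; by rewrite expr0 divr1 K00; split.
have [s sP] : exists s, forall k, (p k).1 <= s <= (p k).1 + w k.
  by apply: nested_segments => // k; have /nextP[_ []] := pP k.
have [t tP] : exists t, forall k, (p k).2 <= t <= (p k).2 + h k.
  by apply: nested_segments => // k; have /nextP[_ []] := pP k.
have [A [B [C H]]] : closed_at P Q s t.
  apply: PQ; [have /andP[] := sP 0%N|have /andP[] := tP 0%N].
    by rewrite /p/= /w expr0 divr1 [_ + (_ - _)]addrC subrK => -> ->.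
  by rewrite /p/= /h expr0 divr1 [_ + (_ - _)]addrC subrK => -> ->.
apply/eqP; rewrite eq_le normr_ge0 andbT.
set D := (b0 - a0) + (d0 - c0).
have D0 : 0 <= D by rewrite addr_ge0// subr_ge0.
apply/ler_addgt0Pr => e e0; rewrite add0r.
(* The [k]-th rectangle contributes at most [2 * e' * (D / 2 ^+ k) ^+ 2], and [4 ^+ k] times this is
   at most [e]. Using [D + 1] instead of [D] admits a degenerate rectangle. *)
pose e' := e / (2 * (D + 1) ^+ 2).
have D1 : 0 < D + 1 by rewrite ltr_wpDl.
have e'0 : 0 < e' by rewrite divr_gt0// mulr_gt0// exprn_gt0.
have [d dd0 dP] := H _ e'0.
have [k kd] : exists k, D / 2 ^+ k < d.
  exists (Num.truncn (D / d)); set N := Num.truncn _.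
  rewrite ltr_pdivrMr ?exprn_gt0// mulrC -ltr_pdivrMr//.
  have := truncnS_gt (D / d); rewrite -/N => /lt_le_trans; apply.
  by rewrite -natrX ler_nat ltn_expl.
have [[i1 i2 i3 i4] Kk] := pP k.
move: (sP k) (tP k) => /andP[s1 s2] /andP[t1 t2].
have wk0 := w_ge0 k; have hk0 := h_ge0 k.
have whD : w k + h k = D / 2 ^+ k by rewrite /w /h -mulrDl.
set W := w k in i2 s2 wk0 whD *; set G := h k in i4 t2 hk0 whD *.
set a := (p k).1 in i1 i2 s1 s2 *; set c := (p k).2 in i3 i4 t1 t2 *.
suff : `|Phik k (p k)| <= 2 * e' * (W + G) ^+ 2.
  move=> /(le_trans Kk); rewrite ler_pdivrMr ?exprn_gt0//.
  move=> /le_trans; apply; rewrite whD.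
  have -> : 4 ^+ k = (2 ^+ k) ^+ 2 :> R by rewrite -exprM mulnC exprM; congr (_ ^+ k); ring.
  have X0 : 2 ^+ k != 0 :> R by rewrite expf_neq0.
  have -> : 2 * e' * (D / 2 ^+ k) ^+ 2 * (2 ^+ k) ^+ 2 = e * (D ^+ 2 / (D + 1) ^+ 2).
    by rewrite /e'; field; rewrite X0 gt_eqF.
  rewrite ger_pMr// ler_pdivrMr ?exprn_gt0// mul1r.
  by rewrite ler_sqr ?nnegrE// ?lerDl// ltW.
rewrite /Phik -/a -/c -/W -/G /Phi.
have WG0 : W + G < d by rewrite whD.
have WG1 : W < d by rewrite (le_lt_trans _ WG0)// lerDl.
have WG2 : G < d by rewrite (le_lt_trans _ WG0)// lerDr.
have dPk s' t' : a <= s' <= a + W -> c <= t' <= c + G ->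
    `|P s' t' - P s t - (A * (s' - s) + B * (t' - t))| <= e' * (W + G) /\
    `|Q s' t' - Q s t - (C * (s' - s) + A * (t' - t))| <= e' * (W + G).
  move=> /(segment_dist (introT andP (conj s1 s2))) Hs.
  move=> /(segment_dist (introT andP (conj t1 t2))) Ht.
  have [X1 X2] := dP _ _ (le_lt_trans Hs WG1) (le_lt_trans Ht WG2).
  have Y : e' * (`|s' - s| + `|t' - t|) <= e' * (W + G) by rewrite ler_pM2l// lerD.
  by split; [exact: le_trans X1 Y|exact: le_trans X2 Y].
have aa : a <= a <= a + W by rewrite lexx lerDl.
have aW : a <= a + W <= a + W by rewrite lexx andbT lerDl.
have cc : c <= c <= c + G by rewrite lexx lerDl.
have cG : c <= c + G <= c + G by rewrite lexx andbT lerDl.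
have aa0 : a0 <= a <= b0 by rewrite i1 (le_trans _ i2)// lerDl.
have aW0 : a0 <= a + W <= b0 by rewrite i2 (le_trans i1)// lerDl.
have cc0 : c0 <= c <= d0 by rewrite i3 (le_trans _ i4)// lerDl.
have cG0 : c0 <= c + G <= d0 by rewrite i4 (le_trans i3)// lerDl.
set I1 := \int[_]_(_ in _) _; set I2 := \int[_]_(_ in _) _.
(* The affine parts of [P] and [Q] at the limit point contribute [A * W * G] to each of the two
   integrals; these cancel in [Phi] because the form is closed there. *)
have E1 : `|I1 - A * W * ((c + G) - c)| <= 2 * e' * (W + G) * ((c + G) - c).
  apply: Rintegral_segment_near; [by rewrite lerDl|exact: contPB|].
  move=> t'; rewrite in_itv/= => t'P.
  have [X1 _] := dPk _ _ aW t'P; have [X2 _] := dPk _ _ aa t'P.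
  rewrite (_ : _ - _ = (P (a + W) t' - P s t - (A * (a + W - s) + B * (t' - t)))
    - (P a t' - P s t - (A * (a - s) + B * (t' - t)))); last by ring.
  by rewrite (le_trans (ler_normB _ _))// -mulrA mulr2n mulrDl mul1r lerD.
have E2 : `|I2 - A * G * ((a + W) - a)| <= 2 * e' * (W + G) * ((a + W) - a).
  apply: Rintegral_segment_near; [by rewrite lerDl|exact: contQB|].
  move=> s'; rewrite in_itv/= => s'P.
  have [_ X1] := dPk _ _ s'P cG; have [_ X2] := dPk _ _ s'P cc.
  rewrite (_ : _ - _ = (Q s' (c + G) - Q s t - (C * (s' - s) + A * (c + G - t)))
    - (Q s' c - Q s t - (C * (s' - s) + A * (c - t)))); last by ring.
  by rewrite (le_trans (ler_normB _ _))// -mulrA mulr2n mulrDl mul1r lerD.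
move: E1 E2; rewrite ![_ + _ - _]addrAC !subrr !add0r => E1 E2.
have -> : I1 - I2 = (I1 - A * W * G) - (I2 - A * G * W) by ring.
rewrite (le_trans (ler_normB _ _))// (le_trans (lerD E1 E2))//.
by rewrite -mulrDr [G + W]addrC -[leLHS]mulrA.
Qed.

End goursat.

(** * Circle means of holomorphic functions *)

Section circle_mean.
Context (R : realType).

Lemma is_derive_approx (f : R -> R) (x df : R) : is_derive x 1 f df ->
  forall e : R, 0 < e -> exists2 d : R, 0 < d &
    forall h, `|h| < d -> `|f (x + h) - f x - df * h| <= e * `|h|.
Proof.
move=> [fx dfx] e e0.
have : h^-1 *: ((f \o shift x) (h *: 1) - f x) @[h --> (0 : R)^'] --> df.
  by rewrite -dfx; exact: fx.
move=> /cvgrPdist_le/(_ _ e0)[d /= d0 dP]; exists d => // h hd.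
have [->|h0] := eqVneq h 0; first by rewrite addr0 subrr mulr0 subrr !normr0 mulr0.
have := dP h; rewrite /= sub0r normrN => /(_ hd h0).
rewrite [h *: _](_ : _ = h); last by rewrite /GRing.scale/= mulr1.
rewrite -(@ler_pM2r _ `|h|) ?normr_gt0// -normrM; apply: le_trans.
rewrite -[leRHS]normrN le_eqVlt; apply/orP; left; apply/eqP; congr (`|_|).
by rewrite /GRing.scale/= (addrC h); field.
Qed.

Definition cpolar (s t : R) : R[i]^o := (expR s * cos t) +i* (expR s * sin t).

Lemma cpolarD s t u v : cpolar (s + u) (t + v) = cpolar s t * cpolar u v.
Proof.
rewrite /cpolar expRD cosD sinD; apply/eqP; rewrite eq_complex/=.
by apply/andP; split; apply/eqP; ring.
Qed.

Lemma rnorm_cpolar s t : rnorm (cpolar s t) = expR s.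
Proof.
have -> : cpolar s t = (expR s)%:C * (cos t +i* sin t).
  by apply/eqP; rewrite eq_complex/= !mul0r subr0 addr0 !eqxx.
by rewrite rnormM rnorm_real rnorm_unit mulr1 ger0_norm ?expR_ge0.
Qed.

Lemma cpolar_approx0 e : 0 < e -> exists2 d : R, 0 < d & forall u v,
  `|u| < d -> `|v| < d ->
  rnorm (cpolar u v - 1 - (u +i* v) : R[i]^o) <= e * (`|u| + `|v|).
Proof.
(* The bounds [H1] and [H2] add up to the coefficient [2 * e1 + 3 * e1] of [|v|]. The cap 1 yields
   [|sin v| <= 2 * |v|] and [|1 + u| <= 2]. *)
move=> e0; pose e1 := Num.min (e / 5) 1.
have e10 : 0 < e1 by rewrite lt_min divr_gt0/=.
have e11 : e1 <= 1 by rewrite ge_min lexx orbT.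
have e15 : 5 * e1 <= e by rewrite mulrC -ler_pdivlMr// ge_min lexx.
have [d1 d10 dP1] := is_derive_approx (is_derive_expR 0) e10.
have [d2 d20 dP2] := is_derive_approx (is_derive_cos 0) e10.
have [d3 d30 dP3] := is_derive_approx (is_derive_sin 0) e10.
exists (Num.min (Num.min d1 (e1 / 2)) (Num.min d2 d3)).
  by rewrite !lt_min d10 d20 d30 divr_gt0.
move=> u v; rewrite !lt_min => /andP[/andP[/dP1 + ue] _] /andP[_ /andP[/dP2 + /dP3]].
rewrite !add0r expR0 sin0 cos0 oppr0 mul0r !addr0 !subr0 !mul1r => U V1 V2.
have cv : `|cos v| <= 1 by rewrite ler_norml cos_geN1 cos_le1.
have u1 : `|expR u - 1| <= e1.
  have -> : expR u - 1 = (expR u - 1 - u) + u by ring.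
  rewrite (le_trans (ler_normD _ _))// (le_trans (lerD U (lexx _)))//.
  have := normr_ge0 u; nra.
have v1 : `|sin v| <= 2 * `|v|.
  have -> : sin v = (sin v - v) + v by ring.
  rewrite (le_trans (ler_normD _ _))// (le_trans (lerD V2 (lexx _)))//.
  have := normr_ge0 v; nra.
have H1 : `|expR u * cos v - 1 - u| <= e1 * `|u| + 2 * e1 * `|v|.
  have -> : expR u * cos v - 1 - u = (expR u - 1 - u) * cos v + (1 + u) * (cos v - 1) by ring.
  rewrite (le_trans (ler_normD _ _))// !normrM lerD//.
    by rewrite -[leRHS]mulr1 ler_pM.
  rewrite -mulrA ler_pM// (le_trans (ler_normD _ _))// normr1; lra.
have H2 : `|expR u * sin v - v| <= 3 * e1 * `|v|.
  have -> : expR u * sin v - v = (expR u - 1) * sin v + (sin v - v) by ring.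
  rewrite (le_trans (ler_normD _ _))// normrM.
  rewrite (le_trans (lerD (ler_pM _ _ u1 v1) V2))//; lra.
have -> : cpolar u v - 1 - (u +i* v) =
  (expR u * cos v - 1 - u) +i* (expR u * sin v - v) :> R[i]^o.
  by apply/eqP; rewrite eq_complex/= subr0 !eqxx.
rewrite (le_trans (rnorm_le_ReIm _ _))// (le_trans (lerD H1 H2))//.
have := normr_ge0 u; have := normr_ge0 v; nra.
Qed.

Lemma cpolar_approx s t e : 0 < e -> exists2 d : R, 0 < d & forall s' t',
  `|s' - s| < d -> `|t' - t| < d ->
  rnorm (cpolar s' t' - cpolar s t - cpolar s t * ((s' - s) +i* (t' - t)) : R[i]^o)
    <= e * (`|s' - s| + `|t' - t|).
Proof.
move=> e0; have es : 0 < expR s by exact: expR_gt0.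
have [d d0 dP] := cpolar_approx0 (divr_gt0 e0 es).
exists d => // s' t' ss tt.
have -> : cpolar s' t' = cpolar s t * cpolar (s' - s) (t' - t).
  by rewrite -cpolarD ![_ + (_ - _)]addrC !subrK.
have -> : cpolar s t * cpolar (s' - s) (t' - t) - cpolar s t -
  cpolar s t * ((s' - s) +i* (t' - t)) = cpolar s t *
  (cpolar (s' - s) (t' - t) - 1 - ((s' - s) +i* (t' - t))) by ring.
rewrite rnormM rnorm_cpolar mulrC -ler_pdivlMr//.
by rewrite (le_trans (dP _ _ ss tt))// mulrAC.
Qed.

Definition has_cderiv (h : R[i]^o -> R[i]^o) (z D : R[i]^o) :=
  forall e : R, 0 < e -> exists2 d : R, 0 < d & forall y : R[i]^o,
    rnorm (z - y) < d -> rnorm (h y - h z - D * (y - z) : R[i]^o) <= e * rnorm (y - z).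

(** The form is the imaginary part of [h (exp w) dw] with [w = s + i t]. By the chain rule
    [h (exp w)] has derivative [D = D0 * z0], and the Cauchy-Riemann equations give the common
    coefficient [Re D]. *)
Lemma closed_at_cpolar (h : R[i]^o -> R[i]^o) s t D0 : has_cderiv h (cpolar s t) D0 ->
  closed_at (fun s t => complex.Re (h (cpolar s t)))
            (fun s t => complex.Im (h (cpolar s t))) s t.
Proof.
set z0 := cpolar s t => hz0; pose D := D0 * z0.
exists (complex.Re D), (- complex.Im D), (complex.Im D) => e e0.
pose K := rnorm z0 + rnorm D0 + 2.
have K0 : 0 < K by rewrite ltr_wpDl// addr_ge0 ?rnorm_ge0.
have [d1 d10 dP1] := hz0 _ (divr_gt0 e0 K0).
pose e1 := Num.min (e / K) 1.
have e10 : 0 < e1 by rewrite lt_min divr_gt0/=.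
have [d2 d20 dP2] := cpolar_approx s t e10.
exists (Num.min d2 (d1 / (2 * K))); first by rewrite lt_min d20 divr_gt0// mulr_gt0.
move=> s' t'; rewrite !lt_min => /andP[s1 s2] /andP[t1 t2].
have := dP2 _ _ s1 t1; rewrite -/z0.
set z := cpolar s' t'; set u := s' - s in s2 *; set v := t' - t in t2 *.
set N := `|u| + `|v|; have N0 : 0 <= N by rewrite addr_ge0.
set w := z - z0 - _ => wN.
have zz0 : z - z0 = z0 * (u +i* v) + w by rewrite /w; ring.
have zz0N : rnorm (z - z0) <= (rnorm z0 + 1) * N.
  rewrite zz0 (le_trans (rnormD _ _))// mulrDl lerD// ?rnormM.
    by rewrite ler_wpM2l ?rnorm_ge0// rnorm_le_ReIm.
  by rewrite (le_trans wN)// ler_wpM2r// ge_min lexx orbT.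
have NK : N < d1 / K.
  by rewrite (lt_le_trans (ltrD s2 t2))// [leRHS](_ : _ = d1 / (2 * K) + d1 / (2 * K))//; field; rewrite gt_eqF.
have main : rnorm (h z - h z0 - (u +i* v) * D : R[i]^o) <= e * N.
  have -> : h z - h z0 - (u +i* v) * D = (h z - h z0 - D0 * (z - z0)) + D0 * w.
    by rewrite /w /D; ring.
  rewrite (le_trans (rnormD _ _))//.
  have zd1 : rnorm (z0 - z) < d1.
    rewrite rnorm_dist (le_lt_trans zz0N)//.
    apply: (@le_lt_trans _ _ (K * N)); last by rewrite mulrC -ltr_pdivlMr.
    by rewrite ler_wpM2r// /K -addrA lerD2l ler_wpDl ?rnorm_ge0// ler1n.
  rewrite (le_trans (lerD (dP1 _ zd1) (lexx _)))// rnormM.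
  have := ler_wpM2l (ltW (divr_gt0 e0 K0)) zz0N.
  have /(ler_wpM2l (rnorm_ge0 D0)) : rnorm w <= e / K * N.
    by rewrite (le_trans wN)// ler_wpM2r// ge_min lexx.
  move=> H1 H2; rewrite (le_trans (lerD H2 H1))//.
  have -> : e / K * ((rnorm z0 + 1) * N) + rnorm D0 * (e / K * N) =
    (e * N) * ((rnorm z0 + 1 + rnorm D0) / K) by ring.
  rewrite ler_piMr// ?mulr_ge0// ?(ltW e0)// ler_pdivrMr// mul1r /K; lra.
split; (apply: le_trans main).
  rewrite [leLHS](_ : _ = `|complex.Re (h z - h z0 - (u +i* v) * D)|); first exact: rnorm_Re.
  congr (`|_|); case: (h z) => a b; case: (h z0) => a' b'; case: D => x y /=; ring.
rewrite [leLHS](_ : _ = `|complex.Im (h z - h z0 - (u +i* v) * D)|); first exact: rnorm_Im.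
congr (`|_|); case: (h z) => a b; case: (h z0) => a' b'; case: D => x y /=; ring.
Qed.

(* Goursat's theorem on a rectangle of the [(s, t)]-plane, [z = exp (s + i t)], says
   that the circle means of [h] do not depend on the radius. *)
Lemma Re_center_le (h : R[i]^o -> R[i]^o) (L : R[i]^o) (rho M : R) : 0 < rho ->
  (forall e : R, 0 < e -> exists2 d : R, 0 < d &
    forall z : R[i]^o, 0 < rnorm z < d -> rnorm (L - h z) < e) ->
  (forall z : R[i]^o, 0 < rnorm z <= rho -> exists D, has_cderiv h z D) ->
  (forall z : R[i]^o, rnorm z = rho -> rnorm (h z) <= M) ->
  complex.Re L <= M.
Proof.
move=> rho0 h0 dh hM; apply/ler_addgt0Pr => e e0.
have [d d0 dP] := h0 _ e0.
(* The inner circle lies where [h] is within [e] of [L]; the minimum with [s2] keeps the sides of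
   the rectangle in order. *)
pose s2 := ln rho; pose s1 := Num.min s2 (ln (d / 2)).
have es2 : expR s2 = rho by rewrite lnK// posrE.
have es1 : expR s1 < d.
  have : expR s1 <= d / 2 by rewrite -[leRHS]lnK ?posrE ?divr_gt0// ler_expR ge_min lexx orbT.
  by move=> /le_lt_trans; apply; rewrite ltr_pdivrMr// ltr_pMr// ltr1n.
have s12 : s1 <= s2 by rewrite ge_min lexx.
pose P s t := complex.Re (h (cpolar s t)); pose Q s t := complex.Im (h (cpolar s t)).
have pi2 : 0 < 2 * pi :> R by rewrite mulr_gt0// pi_gt0.
have PQ s t : s1 <= s <= s2 -> 0 <= t <= 2 * pi -> closed_at P Q s t.
  move=> /andP[_ ss] _.
  suff [D] : exists D, has_cderiv h (cpolar s t) D by exact: closed_at_cpolar.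
  apply: dh.
  by rewrite rnorm_cpolar expR_gt0/= -es2 ler_expR.
have := goursat_rectangle s12 (ltW pi2) PQ.
(* The sides [t = 0] and [t = 2 * pi] cancel, since [cpolar] has period [2 * pi] in [t]. *)
rewrite (_ : (fun s => Q s _ - _) = cst 0 :> (R -> R)); last first.
  apply/funext => s; rewrite /Q /cpolar.
  by rewrite mulr_natl mulr2n sinDpi cosDpi sinpi cospi oppr0 opprK sin0 cos0 subrr.
rewrite Rintegral_cst// mul0r.
have cP s : s1 <= s <= s2 -> {in `[0, 2 * pi], continuous (P s)}.
  move=> ss t; rewrite in_itv/= => /(PQ _ _ ss)[A [B [C H]]].
  apply: (@linear_approx_continuous _ _ _ B) => e' e'0; have [d' d'0 dP'] := H _ e'0.
  exists d' => // y yt; have := dP' s y; rewrite subrr normr0 !mulr0 !add0r.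
  by move=> /(_ d'0 yt)[].
have s11 : s1 <= s1 <= s2 by rewrite lexx.
have s22 : s1 <= s2 <= s2 by rewrite lexx andbT.
rewrite RintegralB//; [|exact/continuous_segment_integrable/cP..].
move/eqP; rewrite subr_eq0 => /eqP E.
have H1 : `|\int[lebesgue_measure]_(t in `[0, (2 * pi)]) P s1 t
    - complex.Re L * (2 * pi - 0)| <= e * (2 * pi - 0).
  apply: Rintegral_segment_near; [exact: ltW|exact: cP|move=> t _].
  rewrite distrC /P -raddfB (le_trans (rnorm_Re _))//; apply/ltW/dP.
  by rewrite rnorm_cpolar expR_gt0.
have H2 : `|\int[lebesgue_measure]_(t in `[0, (2 * pi)]) P s2 t
    - 0 * (2 * pi - 0)| <= M * (2 * pi - 0).
  apply: Rintegral_segment_near; [exact: ltW|exact: cP|move=> t _].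
  by rewrite subr0 (le_trans (rnorm_Re _))// hM// rnorm_cpolar.
rewrite -(ler_pM2r pi2); move: H1 H2; rewrite E !subr0 mul0r !subr0.
rewrite distrC => /(le_trans (ler_norm _)) + /(le_trans (ler_norm _)).
lra.
Qed.

(** Multiplying [h] by the conjugate of [L] makes the limit at the centre real and nonnegative, so
    that the bound on the real part becomes one on the modulus. *)
Lemma rnorm_center_le (h : R[i]^o -> R[i]^o) (L : R[i]^o) (rho M : R) : 0 < rho ->
  (forall e : R, 0 < e -> exists2 d : R, 0 < d &
    forall z : R[i]^o, 0 < rnorm z < d -> rnorm (L - h z) < e) ->
  (forall z : R[i]^o, 0 < rnorm z <= rho -> exists D, has_cderiv h z D) ->
  (forall z : R[i]^o, rnorm z = rho -> rnorm (h z) <= M) ->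
  rnorm L <= M.
Proof.
move=> rho0 h0 dh hM; have [H0|H0] := eqVneq L 0.
  rewrite H0 rnorm0; apply: le_trans (rnorm_ge0 _) (hM (rho%:C) _).
  by rewrite rnorm_real gtr0_norm.
pose a : R[i]^o := L^*; pose g z : R[i]^o := a *: h z.
have na : rnorm a = rnorm L by rewrite /rnorm normcJ.
have : complex.Re (a *: L) <= rnorm L * M.
  apply: (Re_center_le (h := g) rho0) => [|z /dh zh|z /hM zM].
  - have a0 : 0 < rnorm a by rewrite na rnorm_gt0.
    move=> e e0; have [d d0 dP] := h0 _ (divr_gt0 e0 a0).
    by exists d => // y /dP; rewrite ltr_pdivlMr// mulrC -rnormM mulrBr.
  - have [D HD] := zh; exists (a * D) => e e0.
    have a0 : 0 < rnorm a by rewrite na rnorm_gt0.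
    have [d d0 dP] := HD _ (divr_gt0 e0 a0).
    exists d => // y /dP; rewrite mulrAC ler_pdivlMr// mulrC -rnormM.
    by congr (rnorm _ <= _); rewrite /g /GRing.scale/=; ring.
  - by rewrite rnormZ na ler_wpM2l// rnorm_ge0.
have -> : complex.Re (a *: L) = rnorm L * rnorm L.
  rewrite /a; case: L {H0 a na g h0} => x y.
  by rewrite rnormcE -expr2 sqr_sqrtr ?addr_ge0 ?sqr_ge0//=; ring.
by rewrite ler_pM2l// rnorm_gt0.
Qed.

End circle_mean.

(** * Strict differentiability *)

Lemma linear_remainder (K : comNzRingType) n m (t1 t2 t3 : 'rV[K]_m)
    (A B : {linear 'rV[K]_n -> 'rV[K]_m}) (y x b : 'rV[K]_n) (l l' : K) j :
  (t1 - t3 - B (y + l' *: b - x)) 0 j - (t2 - t3 - B (y + l *: b - x)) 0 j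
    - (A b - B b) 0 j * (l' - l) = (t1 - t2 - A ((l' - l) *: b)) 0 j.
Proof.
have EB k : B (y + k *: b - x) = B y + k *: B b - B x by rewrite linearB linearD linearZ.
have EA : A ((l' - l) *: b) = (l' - l) *: A b by rewrite linearZ.
rewrite !EB EA {EB EA}.
move: (A b) (B b) (B y) (B x) => v1 v2 v3 v4.
rewrite !mxE.
ring.
Qed.
Lemma linear_remainder1 (K : comNzRingType) n m (t1 t2 t3 : 'rV[K]_m)
    (B : {linear 'rV[K]_n -> 'rV[K]_m}) (y y' x : 'rV[K]_n) j :
  (t1 - t3 - B (y' - x)) 0 j - (t2 - t3 - B (y - x)) 0 j = (t1 - t2 - B (y' - y)) 0 j.
Proof.
rewrite !linearB; move: (B y) (B y') (B x) => ? ? ?.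
by rewrite !mxE; ring.
Qed.

Section strict_differentiability.
Context (R : realType).

Lemma approx_is_derive (f : R -> R) (x df : R) :
  (forall e : R, 0 < e -> exists2 d : R, 0 < d &
    forall y, `|y - x| < d -> `|f y - f x - df * (y - x)| <= e * `|y - x|) ->
  is_derive x 1 f df.
Proof.
move=> fx.
have H : h^-1 *: ((f \o shift x) (h *: 1) - f x) @[h --> (0 : R)^'] --> df.
  apply/cvgrPdist_le => e e0; have [d d0 dP] := fx _ e0.
  exists d => // h /=; rewrite sub0r normrN => hd h0.
  have := dP (h + x); rewrite addrK => /(_ hd).
  rewrite [h *: _](_ : _ = h); last by rewrite /GRing.scale/= mulr1.
  rewrite -ler_pdivrMr ?normr_gt0// -normfV -normrM; apply: le_trans.
  rewrite -[leLHS]normrN le_eqVlt; apply/orP; left; apply/eqP; congr (`|_|).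
  by rewrite /GRing.scale/=; field.
by split; [apply/cvg_ex; exists df|exact/cvg_lim].
Qed.

(* The quotient may be singular at [0], where [rnorm_center_le] asks only for a
   limit. *)
Lemma has_cderiv_quotient (G : R[i]^o -> R[i]^o) (z0 w0 D : R[i]^o) : w0 != 0 ->
  has_cderiv G (z0 + w0) D ->
  exists D', has_cderiv (fun w => (G (z0 + w) - G z0) / w) w0 D'.
Proof.
move=> w00 HD; pose q0 := (G (z0 + w0) - G z0) / w0.
exists ((D - q0) / w0) => e e0.
pose r := rnorm w0; have r0 : 0 < r by rewrite rnorm_gt0.
pose N := rnorm (D - q0); have N0 : 0 <= N by exact: rnorm_ge0.
have [d d0 dP] := HD (e * r / 4) ltac:(by rewrite divr_gt0// mulr_gt0).
pose d' := e * r ^+ 2 / (4 * (N + 1)).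
have d'0 : 0 < d' by rewrite divr_gt0// ?mulr_gt0// ?exprn_gt0// ltr_wpDl.
exists (Num.min d (Num.min (r / 2) d')); first by rewrite !lt_min d0 d'0 divr_gt0.
move=> y; rewrite !lt_min => /andP[yd /andP[yr yd']].
have ry : r / 2 <= rnorm y.
  have := rnormD (w0 - y) y; rewrite subrK -/r; lra.
have y0 : y != 0 by rewrite -rnorm_gt0 (lt_le_trans _ ry)// divr_gt0.
have yn0 : rnorm y != 0 by rewrite gt_eqF// rnorm_gt0.
have rn0 : r != 0 by rewrite gt_eqF.
set dl := y - w0; have dlE : rnorm (w0 - y) = rnorm dl by rewrite rnorm_dist.
rewrite dlE in yd yr yd'.
pose er := G (z0 + y) - G (z0 + w0) - D * dl.
have erN : rnorm er <= e * r / 4 * rnorm dl.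
  have E1 : z0 + w0 - (z0 + y) = w0 - y by ring.
  have E2 : z0 + y - (z0 + w0) = dl by rewrite /dl; ring.
  by have := dP (z0 + y); rewrite E1 E2 dlE => /(_ yd).
have -> : (G (z0 + y) - G z0) / y - (G (z0 + w0) - G z0) / w0 - (D - q0) / w0 * dl =
    er / y - (D - q0) * dl * dl / (y * w0).
  by rewrite /er /q0 /dl; field; rewrite y0 w00.
rewrite (le_trans (rnormB _ _))// !rnormM !rnormV rnormM -/N -/r.
have dl0 := rnorm_ge0 dl.
have yi : (rnorm y)^-1 <= 2 / r by rewrite -[leRHS]invf_div lef_pV2// posrE ?divr_gt0// rnorm_gt0.
have A1 : rnorm er * (rnorm y)^-1 <= e / 2 * rnorm dl.
  rewrite (le_trans (ler_pM (rnorm_ge0 _) _ erN yi))// ?invr_ge0 ?rnorm_ge0//.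
  by rewrite le_eqVlt; apply/orP; left; apply/eqP; field; rewrite gt_eqF.
have A2 : N * rnorm dl * rnorm dl / (rnorm y * r) <= e / 2 * rnorm dl.
  have -> : N * rnorm dl * rnorm dl / (rnorm y * r) = (N * rnorm dl / r * (rnorm y)^-1) * rnorm dl.
    by field; rewrite ?yn0 ?rn0.
  rewrite ler_wpM2r//.
  have B : N * rnorm dl / r <= e * r / 4.
    rewrite ler_pdivrMr//.
    have : N * rnorm dl <= (N + 1) * d'.
      by rewrite ler_pM// ?(ltW yd')// lerDl.
    move=> /le_trans; apply; rewrite le_eqVlt; apply/orP; left; apply/eqP.
    by rewrite /d'; field; rewrite gt_eqF// ltr_wpDl.
  rewrite (le_trans (ler_pM _ _ B yi))// ?invr_ge0 ?rnorm_ge0//.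
    by rewrite divr_ge0 ?mulr_ge0// ltW.
  by rewrite le_eqVlt; apply/orP; left; apply/eqP; field; rewrite gt_eqF.
by rewrite (le_trans (lerD A1 A2))// -mulrDl -splitr.
Qed.

(** Apply [rnorm_center_le] to the difference quotient at [z0], whose limit is [D]: on the circle of
    radius [rho / 2] it is at most [2 * M / (rho / 2)]. *)
Lemma cderiv_bound (G : R[i]^o -> R[i]^o) (z0 D : R[i]^o) (rho M : R) : 0 < rho ->
  (forall z, rnorm (z - z0) < rho -> exists D, has_cderiv G z D) ->
  (forall z, rnorm (z - z0) < rho -> rnorm (G z) <= M) ->
  has_cderiv G z0 D -> rnorm D <= 4 * M / rho.
Proof.
move=> rho0 dG GM HD.
apply: (rnorm_center_le (h := fun w => (G (z0 + w) - G z0) / w) (rho := rho / 2)).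
- by rewrite divr_gt0.
- move=> e e0; have [d d0 dP] := HD (e / 2) ltac:(by rewrite divr_gt0).
  exists d => // z /andP[z0' zd].
  have := dP (z0 + z); rewrite opprD addNKr rnormN => /(_ zd).
  have -> : z0 + z - z0 = z by ring.
  rewrite -ler_pdivrMr// -rnormV -rnormM => H.
  have zn0 : z != 0 by rewrite -rnorm_gt0.
  rewrite rnorm_dist; apply: (le_lt_trans _ (_ : e / 2 < e)); last by rewrite ltr_pdivrMr// ltr_pMr// ltr1n.
  by apply: le_trans H; rewrite le_eqVlt; apply/orP; left; apply/eqP; congr rnorm; field.
- move=> z /andP[z0' zr]; have [|D1 HD1] := dG (z0 + z).
    by rewrite addrC addKr (le_lt_trans zr)// ltr_pdivrMr// ltr_pMr// ltr1n.
  by apply: has_cderiv_quotient HD1; rewrite -rnorm_gt0.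
- move=> z zr; rewrite rnormM rnormV zr ler_pdivrMr ?divr_gt0//.
  rewrite (_ : _ / _ * _ = M + M); last by field; rewrite gt_eqF.
  rewrite (le_trans (rnormB _ _))// lerD// GM ?subrr ?rnorm0//.
  by rewrite addrC addKr zr ltr_pdivrMr// ltr_pMr// ltr1n.
Qed.

(** The real mean value theorem on the segment from [0] to [z], for the real part of [G] times the
    conjugate of [G z - G 0]. The derivative is bounded through discs of radius [rho / 2] centred on
    the segment, hence the 8. *)
Lemma cderiv_lipschitz (G : R[i]^o -> R[i]^o) (rho M : R) (z : R[i]^o) : 0 < rho ->
  (forall z, rnorm z < rho -> exists D, has_cderiv G z D) ->
  (forall z, rnorm z < rho -> rnorm (G z) <= M) ->
  rnorm z <= rho / 2 -> rnorm (G z - G 0) <= 8 * M / rho * rnorm z.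
Proof.
move=> rho0 dG GM zr; have [->|z0] := eqVneq z 0.
  by rewrite subrr rnorm0 mulr0.
have {}z0 : 0 < rnorm z by rewrite rnorm_gt0.
have [->|Gz] := eqVneq (G z - G 0) 0.
  rewrite rnorm0 mulr_ge0 ?rnorm_ge0// divr_ge0 ?(ltW rho0)// mulr_ge0//.
  by rewrite (le_trans (rnorm_ge0 (G 0)))// GM// rnorm0.
pose a : R[i]^o := (G z - G 0)^*.
have na : rnorm a = rnorm (G z - G 0) by rewrite /rnorm normcJ.
have xz (x : R) : 0 <= x <= 1 -> rnorm (x%:C * z : R[i]^o) <= rho / 2.
  move=> /andP[x0 x1]; rewrite rnormM rnorm_real ger0_norm//.
  by rewrite (le_trans _ zr)// ler_piMl ?rnorm_ge0.
have h2 : rho / 2 < rho by rewrite ltr_pdivrMr// ltr_pMr// ltr1n.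
have Dx (x : R) : 0 <= x <= 1 -> exists2 D, has_cderiv G (x%:C * z) D & rnorm D <= 8 * M / rho.
  move=> /xz x1; have [D HD] := dG _ (le_lt_trans x1 h2); exists D => //.
  have -> : 8 * M / rho = 4 * M / (rho / 2) by field; rewrite gt_eqF.
  have xzr (y : R[i]^o) : rnorm (y - x%:C * z : R[i]^o) < rho / 2 -> rnorm y < rho.
    move=> yx; rewrite -[y](subrK (x%:C * z)) (le_lt_trans (rnormD _ _))//.
    by rewrite (splitr rho) ltr_leD.
  apply: cderiv_bound HD => [|y /xzr /dG//|y /xzr /GM//].
  by rewrite divr_gt0.
pose phi x := complex.Re (a * G (x%:C * z)).
have dphi x D : has_cderiv G (x%:C * z) D -> is_derive x 1 phi (complex.Re (a * (D * z))).
  move=> HD; apply: approx_is_derive => e e0.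
  have K0 : 0 < rnorm a * rnorm z by rewrite mulr_gt0// na rnorm_gt0.
  have an0 : rnorm a != 0 by rewrite na gt_eqF// rnorm_gt0.
  have zn0 : rnorm z != 0 by rewrite gt_eqF.
  have [d d0 dP] := HD _ (divr_gt0 e0 K0).
  exists (d / rnorm z); first by rewrite divr_gt0.
  move=> y; rewrite ltr_pdivlMr// => yd.
  have E : rnorm (y%:C * z - x%:C * z : R[i]^o) = `|y - x| * rnorm z.
    by rewrite -mulrBl -rmorphB rnormM rnorm_real.
  have := dP (y%:C * z); rewrite rnorm_dist E => /(_ yd) H.
  have : rnorm a * rnorm (G (y%:C * z) - G (x%:C * z) - D * (y%:C * z - x%:C * z)) <= e * `|y - x|.
    rewrite (le_trans (ler_wpM2l (rnorm_ge0 _) H))// le_eqVlt; apply/orP; left; apply/eqP.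
    by field; rewrite ?an0 ?zn0.
  rewrite -rnormM; apply: le_trans; rewrite (le_trans _ (rnorm_Re _))// le_eqVlt.
  apply/orP; left; apply/eqP; congr (`|_|); rewrite /phi.
  have -> : a * (G (y%:C * z) - G (x%:C * z) - D * (y%:C * z - x%:C * z)) =
    a * G (y%:C * z) - a * G (x%:C * z) - (y - x)%:C * (a * (D * z)).
    by rewrite rmorphB; ring.
  case: (a * G (y%:C * z)) => ? ?; case: (a * G (x%:C * z)) => ? ?.
  by case: (a * (D * z)) => ? ? /=; ring.
have [D' D'P] : {D' : R -> R[i]^o & forall x, 0 <= x <= 1 ->
    has_cderiv G (x%:C * z) (D' x) /\ rnorm (D' x) <= 8 * M / rho}.
  apply: (choice (P := fun x D => 0 <= x <= 1 -> has_cderiv G (x%:C * z) D /\ rnorm D <= 8 * M / rho)) => x.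
  by have [/Dx[D ? ?]|?] := boolP (0 <= x <= 1); [exists D|exists 0].
have [x||c +] := @MVT R phi (fun x => complex.Re (a * (D' x * z))) 0 1 ltr01.
- rewrite in_itv/= => /andP[x0 x1]; apply: dphi; apply: (D'P x _).1.
  by rewrite !ltW.
- apply: continuous_in_subspaceT => x; rewrite inE/= in_itv/= => x01.
  have [HD _] := D'P x x01; have [/derivable1_diffP/differentiable_continuous + _] := dphi _ _ HD.
  exact.
rewrite in_itv/= => /andP[c0 c1]; have [|_ Hc] := D'P c; first by rewrite !ltW.
rewrite subr0 mulr1 /phi mul1r mul0r => E.
have {}E : rnorm (G z - G 0) * rnorm (G z - G 0) = complex.Re (a * (D' c * z)).
  rewrite -E /a; case: (G z) => x y; case: (G 0) => x' y'.
  by rewrite rnormcE -expr2 sqr_sqrtr ?addr_ge0 ?sqr_ge0//=; ring.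
rewrite -(@ler_pM2l _ (rnorm (G z - G 0))) ?rnorm_gt0// E.
rewrite (le_trans (ler_norm _))// (le_trans (rnorm_Re _))// rnormM na rnormM.
by rewrite ler_wpM2l ?rnorm_ge0// ler_wpM2r// rnorm_ge0.
Qed.

(* Schwarz lemma applied, on each complex line through two points close to [x0],
   to [T] minus its affine approximation at [x0]. *)
Lemma strictly_differentiable n m (T : Cvec R n -> Cvec R m) (x0 : Cvec R n) (r e : R) :
  0 < r -> (forall y : Cvec R n, rnorm (y - x0) < r -> differentiable T y) -> 0 < e ->
  exists2 d : R, 0 < d & forall y y' : Cvec R n, rnorm (y - x0) < d -> rnorm (y' - x0) < d ->
    rnorm (T y' - T y - 'd T x0 (y' - y)) <= e * rnorm (y' - y).
Proof.
move=> r0 dT e0; have dTx0 : differentiable T x0 by apply: dT; rewrite subrr rnorm0.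
(* The final constant is [8 * M / rho] with [M = e / 16 * d] and [rho = d / (2 * rnorm b)], that is
   [e * rnorm b]. Points within [d / 8] of [x0] satisfy [rnorm b < d / 4], which places the
   parameter 1 within [rho / 2]. *)
have [d1 d10 dP1] := littleo_rnorm dTx0 (divr_gt0 e0 (ltr0n R 16)).
pose d := Num.min d1 r; have d0 : 0 < d by rewrite lt_min d10.
exists (d / 8) => [|y y' yd yd']; first by rewrite divr_gt0.
have [->|yy] := eqVneq y' y.
  by rewrite !subrr linear0 subr0 !rnorm0 mulr0.
pose b : Cvec R n := y' - y; have b0 : 0 < rnorm b by rewrite rnorm_gt0 subr_eq0.
have bd : rnorm b < d / 4.
  have -> : b = (y' - x0) - (y - x0) by rewrite /b opprB addrA subrK.
  rewrite (le_lt_trans (rnormB _ _))//; lra.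
apply: rnorm_le => [|j]; first by rewrite mulr_ge0 ?rnorm_ge0// ltW.
pose F (v : Cvec R n) := T v - T x0 - 'd T x0 (v - x0).
pose G (l : R[i]^o) : R[i]^o := F (y + l *: b) 0 j.
pose rho := d / (2 * rnorm b).
have rho0 : 0 < rho by rewrite divr_gt0// mulr_gt0.
have near (l : R[i]^o) : rnorm l < rho -> rnorm (y + l *: b - x0) < d.
  rewrite ltr_pdivlMr ?mulr_gt0// => lr.
  rewrite addrAC (le_lt_trans (rnormD _ _))// rnormZ; lra.
have GM (l : R[i]^o) : rnorm l < rho -> rnorm (G l) <= e / 16 * d.
  move=> /near ld; have := ld; rewrite {1}/d lt_min => /andP[H1 _].
  rewrite (le_trans (coord_rnorm _ _))//.
  have := dP1 (y + l *: b); rewrite rnorm_dist => /(_ H1) /le_trans; apply.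
  by rewrite ler_wpM2l ?divr_ge0 ?(ltW e0)// ltW.
have dG (l : R[i]^o) : rnorm l < rho -> exists D, has_cderiv G l D.
  move=> /near; rewrite {1}/d lt_min => /andP[_ /dT H1].
  exists (('d T (y + l *: b) b - 'd T x0 b) 0 j) => e' e'0.
  have [d' d'0 dP'] := littleo_rnorm H1 (divr_gt0 e'0 b0).
  exists (d' / rnorm b) => [|l']; first by rewrite divr_gt0.
  rewrite ltr_pdivlMr// -rnormZ => ll'.
  have := dP' (y + l' *: b).
  have lbE : y + l *: b - (y + l' *: b) = (l - l') *: b.
    by rewrite opprD addrACA subrr add0r scalerBl.
  have lbE' : y + l' *: b - (y + l *: b) = (l' - l) *: b.
    by rewrite opprD addrACA subrr add0r scalerBl.
  rewrite lbE lbE' => /(_ ll'); rewrite rnormZ mulrA mulrAC divfK ?gt_eqF//.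
  move=> H; apply: le_trans H; apply: le_trans (coord_rnorm _ j).
  rewrite le_eqVlt; apply/orP; left; apply/eqP; congr rnorm.
  exact: linear_remainder.
have one_le : rnorm (1 : R[i]^o) <= rho / 2.
  by rewrite rnorm1 /rho -mulrA -invfM ler_pdivlMr ?mulr_gt0//; lra.
have := cderiv_lipschitz rho0 dG GM one_le.
rewrite /G scale0r addr0 scale1r addrCA subrr addr0 rnorm1 mulr1.
have -> : 8 * (e / 16 * d) / rho = e * rnorm b.
  by rewrite /rho; field; rewrite !gt_eqF.
apply: le_trans; rewrite le_eqVlt; apply/orP; left; apply/eqP; congr rnorm.
apply/esym; exact: linear_remainder1.
Qed.

End strict_differentiability.

(** * Jacobians *)

Lemma subr_both (V : zmodType) (t a b : V) : a - b = (t - b) - (t - a).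
Proof. by rewrite opprB [RHS]addrC subrKA. Qed.

Lemma lin1_mxB (K : nzRingType) n m (f g : 'rV[K]_n -> 'rV[K]_m) i j :
  lin1_mx f i j - lin1_mx g i j = (f 'e_i - g 'e_i) 0 j.
Proof. by rewrite !mxE. Qed.

Lemma delta_rVE (K : nzRingType) n (i k : 'I_n) : ('e_i : 'rV[K]_n) 0 k = (k == i)%:R.
Proof. by rewrite mxE. Qed.

Section jacobian_continuity.
Context (R : realType).

(* The square of the modulus of the complex Jacobian determinant is the real one. *)
Definition jac2 n (T : Cvec R n -> Cvec R n) (x : Cvec R n) : R :=
  rnorm (\det (jacobian T x) : R[i]^o) ^+ 2.

Lemma jac2_ge0 n (T : Cvec R n -> Cvec R n) x : 0 <= jac2 T x.
Proof. exact: sqr_ge0. Qed.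

Lemma jac2E n (T : Cvec R n -> Cvec R n) x : (jac2 T x)%:C = `|\det (jacobian T x)| ^+ 2.
Proof. by rewrite rmorphXn/= -rnormE. Qed.

(** For small [k > 0], compare the strict estimate for the pair [y], [y + k b] with
    differentiability at [y], and divide by [k]. *)
Lemma diff_near_strict (V W : normedModType R[i]) (T : V -> W) (x0 y : V) (d e : R) :
  (forall y y' : V, rnorm (y - x0) < d -> rnorm (y' - x0) < d ->
    rnorm (T y' - T y - 'd T x0 (y' - y)) <= e * rnorm (y' - y)) ->
  rnorm (y - x0) < d -> differentiable T y ->
  forall b, rnorm ('d T y b - 'd T x0 b) <= e * rnorm b.
Proof.
move=> dP yd dTy b.
have [->|b0] := eqVneq b 0; first by rewrite !linear0 addr0 !rnorm0 mulr0.
have {}b0 : 0 < rnorm b by rewrite rnorm_gt0.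
apply/ler_addgt0Pr => f f0.
have [d' d'0 dP'] := littleo_rnorm dTy (divr_gt0 f0 b0).
pose k := Num.min d' (d - rnorm (y - x0)) / (2 * rnorm b).
have m0 : 0 < Num.min d' (d - rnorm (y - x0)) by rewrite lt_min d'0 subr_gt0.
have k0 : 0 < k by rewrite divr_gt0// mulr_gt0.
have nkb : rnorm (k%:C *: b) = k * rnorm b by rewrite rnormZ rnorm_real gtr0_norm.
have kb : rnorm (k%:C *: b) < Num.min d' (d - rnorm (y - x0)).
  rewrite nkb /k invfM mulrA divfK ?gt_eqF//.
  by rewrite gtr_pMr// invf_lt1// ltr1n.
move: kb; rewrite lt_min => /andP[kb1 kb2].
have E1 : y - (y + k%:C *: b) = - (k%:C *: b) by rewrite opprD addNKr.
have E2 : y + k%:C *: b - y = k%:C *: b by rewrite addrAC subrr add0r.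
have := dP' (y + k%:C *: b); rewrite E1 E2 rnormN => /(_ kb1) H1.
have := dP y (y + k%:C *: b) yd; rewrite E2 => H2.
have {}H2 : rnorm (T (y + k%:C *: b) - T y - 'd T x0 (k%:C *: b)) <= e * rnorm (k%:C *: b).
  by apply: H2; rewrite addrAC (le_lt_trans (rnormD _ _))// -ltrBrDl.
rewrite -(ler_pM2l k0).
have -> : k * rnorm ('d T y b - 'd T x0 b) = rnorm ('d T y (k%:C *: b) - 'd T x0 (k%:C *: b)).
  have -> : 'd T y (k%:C *: b) = k%:C *: 'd T y b by exact: linearZ.
  have -> : 'd T x0 (k%:C *: b) = k%:C *: 'd T x0 b by exact: linearZ.
  by rewrite -scalerBr rnormZ rnorm_real gtr0_norm.
rewrite (subr_both (T (y + k%:C *: b) - T y)).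
rewrite (le_trans (rnormB _ _))// (le_trans (lerD H2 H1))// nkb.
by rewrite le_eqVlt; apply/orP; left; apply/eqP; field; rewrite gt_eqF.
Qed.

Lemma diff_near n m (T : Cvec R n -> Cvec R m) (x0 : Cvec R n) (r e : R) :
  0 < r -> (forall y : Cvec R n, rnorm (y - x0) < r -> differentiable T y) -> 0 < e ->
  exists2 d : R, 0 < d & forall y : Cvec R n, rnorm (y - x0) < d -> forall b,
    rnorm ('d T y b - 'd T x0 b) <= e * rnorm b.
Proof.
move=> r0 dT e0; have [d d0 dP] := strictly_differentiable r0 dT e0.
exists (Num.min d r) => [|y]; first by rewrite lt_min d0.
by rewrite lt_min => /andP[yd /dT dTy]; exact: diff_near_strict dP yd dTy.
Qed.

Lemma rnorm_continuousD (V : normedModType R[i]) (f g : V -> R[i]^o) (x : V) :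
  {for x, continuous f} -> {for x, continuous g} ->
  {for x, continuous (fun y => f y + g y : R[i]^o)}.
Proof.
move=> /rnorm_continuous cf /rnorm_continuous cg; apply/rnorm_continuous => e e0.
have e20 : 0 < e / 2 by rewrite divr_gt0.
have [d1 d10 dP1] := cf _ e20; have [d2 d20 dP2] := cg _ e20.
exists (Num.min d1 d2) => [|y]; first by rewrite lt_min d10.
rewrite lt_min => /andP[/dP1 H1 /dP2 H2].
by rewrite opprD addrACA (le_lt_trans (rnormD _ _))// [ltRHS]splitr ltrD.
Qed.

Lemma rnorm_continuousM (V : normedModType R[i]) (f g : V -> R[i]^o) (x : V) :
  {for x, continuous f} -> {for x, continuous g} ->
  {for x, continuous (fun y => f y * g y : R[i]^o)}.
Proof.
move=> /rnorm_continuous cf /rnorm_continuous cg; apply/rnorm_continuous => e e0.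
pose K := rnorm (f x) + (rnorm (g x) + 1) + 1.
have K0 : 0 < K by rewrite ltr_wpDl// ?addr_ge0 ?rnorm_ge0.
pose e1 := Num.min 1 (e / K); have e10 : 0 < e1 by rewrite lt_min ltr01 divr_gt0.
have [d1 d10 dP1] := cf _ e10; have [d2 d20 dP2] := cg _ e10.
exists (Num.min d1 d2) => [|y]; first by rewrite lt_min d10.
rewrite lt_min => /andP[/dP1 H1 /dP2 H2].
have gy : rnorm (g y) <= rnorm (g x) + 1.
  rewrite -[g y](subrK (g x)) addrC (le_trans (rnormD _ _))// lerD2l rnorm_dist.
  by rewrite ltW// (lt_le_trans H2)// ge_min lexx.
have -> : f x * g x - f y * g y = f x * (g x - g y) + (f x - f y) * g y by ring.
rewrite (le_lt_trans (rnormD _ _))// !rnormM.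
have e1K : e1 * K <= e by rewrite -ler_pdivlMr// ge_min lexx orbT.
apply: (@le_lt_trans _ _ (e1 * (rnorm (f x) + (rnorm (g x) + 1)))).
  rewrite mulrDr lerD//.
    by rewrite mulrC ler_wpM2r ?rnorm_ge0// ltW.
  by rewrite ler_pM ?rnorm_ge0// ltW.
by apply: lt_le_trans e1K; rewrite ltr_pM2l// ltrDl.
Qed.

Lemma big_continuous (V : normedModType R[i]) (x : V) (I : Type)
    (op : R[i] -> R[i] -> R[i]) (idx : R[i]) (s : seq I) (F : I -> V -> R[i]^o) :
  (forall f g : V -> R[i]^o, {for x, continuous f} -> {for x, continuous g} ->
    {for x, continuous (fun y => op (f y) (g y) : R[i]^o)}) ->
  (forall i, {for x, continuous (F i)}) ->
  {for x, continuous (fun y => \big[op/idx]_(i <- s) F i y : R[i]^o)}.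
Proof.
move=> cop cF; elim: s => [|i s IH].
  rewrite (_ : (fun y => _) = cst (idx : R[i]^o)); first exact: cst_continuous.
  by apply/funext => y; rewrite big_nil.
rewrite (_ : (fun y => _) = (fun y => op (F i y) (\big[op/idx]_(j <- s) F j y) : R[i]^o)).
  exact: (cop _ _ (cF i) IH).
by apply/funext => y; rewrite big_cons.
Qed.

(** Differentiability in a neighbourhood suffices: [diff_near] gives the continuity of every entry
    of the Jacobian matrix, and the determinant is a polynomial in them. *)
Lemma jac2_continuous n (T : Cvec R n -> Cvec R n) (x0 : Cvec R n) :
  (\forall y \near x0, differentiable T y) -> {for x0, continuous (jac2 T)}.
Proof.
move=> /nbhs_rnormP[r r0 dT].
have {}dT (y : Cvec R n) : rnorm (y - x0) < r -> differentiable T y.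
  by rewrite rnorm_dist; exact: dT.
have coord i j : jacobian T y i j @[y --> x0] --> (jacobian T x0 i j : R[i]^o).
  apply: (rnorm_continuous (fun y => jacobian T y i j : R[i]^o) x0).2 => e e0.
  have e20 : 0 < e / 2 by rewrite divr_gt0.
  have [d d0 dP] := diff_near r0 dT e20.
  exists d => // y; rewrite rnorm_dist => /dP /(_ 'e_i) H.
  rewrite rnorm_dist (le_lt_trans (le_trans _ H))//.
    have -> : jacobian T y i j - jacobian T x0 i j = ('d T y 'e_i - 'd T x0 'e_i) 0 j.
      exact: lin1_mxB.
    exact: coord_rnorm.
  rewrite (@le_lt_trans _ _ (e / 2 * 1))//; last by rewrite mulr1 ltr_pdivrMr// ltr_pMr// ltr1n.
  rewrite ler_wpM2l ?(ltW e20)//; apply: rnorm_le => // k.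
  by rewrite delta_rVE; case: (k == i); rewrite ?rnorm1 ?rnorm0.
have det : {for x0, continuous (fun y => \det (jacobian T y) : R[i]^o)}.
  rewrite /determinant; apply: big_continuous => [f g cf cg|s]; first exact: (rnorm_continuousD cf cg).
  have cP : {for x0, continuous (fun y => \prod_i jacobian T y i (s i) : R[i]^o)}.
    apply: big_continuous => [f g cf cg|i]; first exact: (rnorm_continuousM cf cg).
    exact: coord.
  have cS : {for x0, continuous (fun=> (-1) ^+ s : R[i]^o)} by exact: cst_continuous.
  exact: (rnorm_continuousM cS cP).
have N : {for x0, continuous (fun y => rnorm (\det (jacobian T y) : R[i]^o))}.
  apply/rnorm_continuousR => e e0.
  have [d d0 dP] := (rnorm_continuous (fun y => \det (jacobian T y) : R[i]^o) x0).1 det _ e0.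
  exists d => // y /dP; apply: le_lt_trans.
  exact: ler_rnorm_dist.
exact: (continuousM N N).
Qed.

End jacobian_continuity.

(** * Lebesgue measure and linear maps *)

Section partial_pushforward.
Context d1 d2 (T1 : measurableType d1) (T2 : measurableType d2) (R : realType).
Variables (mu : {measure set T1 -> \bar R}) (D : set T1) (f : T1 -> T2).
Hypotheses (mD : measurable D) (mf : measurable_fun D f).

(** The pushforward under a map that is measurable only on [D]. The two proofs are arguments so that
    a measure structure can be attached to the function. *)
Definition ppush of measurable D & measurable_fun D f :=
  fun A : set T2 => mu (D `&` f @^-1` A).

Local Notation nu := (ppush mD mf).

Let nu0 : nu set0 = 0%E.
Proof. by rewrite /ppush preimage_set0 setI0 measure0. Qed.

Let nu_ge0 A : (0 <= nu A)%E.
Proof. exact: measure_ge0. Qed.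

Let nu_sigma_additive : semi_sigma_additive nu.
Proof.
move=> F mF tF mUF; rewrite /ppush preimage_bigcup setI_bigcupr.
apply: measure_semi_sigma_additive.
- by move=> n; exact: mf.
- apply/trivIsetP => /= i j _ _ ij; rewrite setIACA -preimage_setI.
  by move/trivIsetP : tF => ->//; rewrite preimage_set0 setI0.
- by rewrite -setI_bigcupr -preimage_bigcup; exact: mf.
Qed.

HB.instance Definition _ := isMeasure.Build _ _ _ nu nu0 nu_ge0 nu_sigma_additive.

Definition ppush_measure : {measure set T2 -> \bar R} := nu.

End partial_pushforward.

Section scales.
Context {R : realType}.

(** The factor is that of preimages, so for an invertible linear map it is the inverse of the real
    Jacobian. *)
Definition scales d (T : measurableType d) (m : {measure set T -> \bar R})
    (f : T -> T) (c : R) := [/\ 0 <= c, measurable_fun setT f &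
  forall A, measurable A -> m (f @^-1` A) = (c%:E * m A)%E].

Lemma scales_integral d (T : measurableType d) (m : {measure set T -> \bar R})
    (f : T -> T) (c : R) (h : T -> \bar R) : scales m f c ->
  measurable_fun setT h -> (forall x, 0 <= h x)%E ->
  (\int[m]_x h (f x) = c%:E * \int[m]_x h x)%E.
Proof.
move=> [c0 mf mfA] mh h0.
have -> : (\int[m]_x h (f x) = \int[pushforward m f]_x h x)%E.
  by rewrite ge0_integral_pushforward// preimage_setT.
pose c' : {nonneg R} := NngNum c0.
rewrite -[c]/(c'%:num)%R -ge0_integral_mscale//.
by apply: eq_measure_integral => A mA _; exact: mfA.
Qed.

Lemma scales_prod d1 d2 (T1 : measurableType d1) (T2 : measurableType d2)
    (m1 : {sigma_finite_measure set T1 -> \bar R})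
    (m2 : {sigma_finite_measure set T2 -> \bar R}) f1 f2 c1 c2 :
  scales m1 f1 c1 -> scales m2 f2 c2 ->
  scales (prod_measure m1 m2) (fun z => (f1 z.1, f2 z.2)) (c1 * c2).
Proof.
move=> s1 s2; have [c10 mf1 H1] := s1; have [c20 mf2 H2] := s2.
have mff : measurable_fun setT (fun z : T1 * T2 => (f1 z.1, f2 z.2)).
  by apply/measurable_fun_pairP; split; [apply: (measurableT_comp mf1)|apply: (measurableT_comp mf2)].
split => [||A mA]; [exact: mulr_ge0|exact: mff|].
rewrite /prod_measure /product_measure1.
transitivity (\int[m1]_x (c2%:E * m2 (xsection A (f1 x))))%E.
  apply: eq_integral => x _ /=; rewrite -H2; last exact: measurable_xsection.
  by congr (m2 _); apply/seteqP; split => y; rewrite /xsection/= !inE.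
rewrite EFinM [(c1%:E * _)%E]muleC -muleA ge0_integralZl//; last first.
  exact: (measurableT_comp (measurable_fun_xsection m2 mA) mf1).
by rewrite (scales_integral s1 (measurable_fun_xsection m2 mA)).
Qed.

Lemma scales_tuple d (T : measurableType d) (m : {sigma_finite_measure set T -> \bar R})
    n (f : 'I_n -> T -> T) (c : 'I_n -> R) : (forall j, scales m (f j) (c j)) ->
  scales (tuple_measure m n) (fun t => [tuple f j (tnth t j) | j < n]) (\prod_j c j).
Proof.
elim: n f c => [|n IH] f c fc.
  split => [||A mA]; first by rewrite big_ord0.
    by apply/measurable_fun_tnthP => -[].
  rewrite big_ord0 mul1e (_ : (fun t => _) = id)//.
  by apply/funext => t; rewrite [LHS]tuple0 [RHS]tuple0.
have mf : measurable_fun setT (fun t : n.+1.-tuple T => [tuple f j (tnth t j) | j < n.+1]).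
  apply/measurable_fun_tnthP => i.
  rewrite (_ : _ \o _ = f i \o (@tnth _ _ ^~ i)).
    by apply: measurableT_comp; [by have [] := fc i|exact: measurable_tnth].
  by apply/funext => t /=; rewrite tnth_mktuple.
have [_ _ P] := scales_prod (fc ord0) (IH (fun j => f (lift ord0 j)) _ (fun j => fc (lift ord0 j))).
split => [||A mA]; [|exact: mf|].
  by apply: prodr_ge0 => i _; have [] := fc i.
rewrite /= /tcons_measure /pushforward big_ord_recl -P; last first.
  by rewrite -[X in measurable X]setTI; exact: measurable_tcons.
congr (_ _); apply/seteqP.
have E z : [tuple f j (tnth (tcons z) j) | j < n.+1] =
    tcons (f ord0 z.1, [tuple f (lift ord0 j) (tnth z.2 j) | j < n]).
  apply: eq_from_tnth => j; rewrite tnth_mktuple /tcons/=.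
  have [k|] := unliftP ord0 j; last by move=> ->; rewrite !tnth0.
  by move=> ->; rewrite !tnthS tnth_mktuple.
by split => z /=; rewrite E.
Qed.

Lemma tuple_measure_box d (T : measurableType d) (m : {sigma_finite_measure set T -> \bar R})
    n (Q : set T) (q : R) : measurable Q -> m Q = q%:E ->
  tuple_measure m n [set t | forall j, Q (tnth t j)] = (q ^+ n)%:E.
Proof.
move=> mQ mQq; elim: n => [|n IH].
  by rewrite /= diracE mem_set// => -[].
rewrite exprS EFinM -IH -mQq -product_measure1E//; last first.
  rewrite (_ : [set _ | _] = \bigcap_(j in [set: 'I_n]) ((@tnth _ _ ^~ j) @^-1` Q)).
    apply: fin_bigcap_measurable => [|j _]; first exact: finite_finset.
    by rewrite -[X in measurable X]setTI; exact: measurable_tnth.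
  by apply/seteqP; split => t /= H j; [move=> _; exact: H|exact: H].
rewrite /= /tcons_measure /pushforward/=; congr (_ _).
apply/seteqP; split=> -[x t] /=.
  move=> H; split; first by have := H ord0; rewrite tnth0.
  by move=> j; have := H (lift ord0 j); rewrite tnthS.
move=> [Qx Qt] j; have [k ->|->] := unliftP ord0 j; first by rewrite tnthS.
by rewrite tnth0.
Qed.

(** The measures are compared on half-open intervals, whose values determine Lebesgue measure. *)
Lemma scales_lebesgue (s a : R) : 0 < s ->
  scales (lebesgue_measure : {measure set (measurableTypeR R) -> \bar R})
    (fun x => s * x + a) s^-1.
Proof.
move=> s0.
have mf : measurable_fun [set: measurableTypeR R] (fun x : measurableTypeR R => s * x + a : measurableTypeR R).
  by apply: measurable_funD => //; exact: measurable_funM.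
split => [||A mA]; [by rewrite invr_ge0 ltW|exact: mf|].
pose s' : {nonneg R} := NngNum (ltW s0).
suff E : forall X, ocitv X -> lebesgue_measure X =
    mscale s' (ppush_measure lebesgue_measure measurableT mf) X.
  transitivity (s^-1%:E * (s%:E *
      lebesgue_measure (setT `&` (fun x => s * x + a)%R @^-1` A)))%E.
    by rewrite setTI muleA -EFinM mulVf ?gt_eqF// mul1e.
  by congr (_ * _)%E; apply/esym; exact: (lebesgue_measure_unique E mA).
move=> _ [[x y] _ <-]; rewrite /= /mscale/= /ppush setTI.
rewrite (_ : _ @^-1` _ = `](x - a) / s, (y - a) / s]%classic); last first.
  apply/seteqP; split => z /=; rewrite !in_itv/= ltr_pdivrMr// ler_pdivlMr//;
    by rewrite ltrBlDr lerBrDr mulrC.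
rewrite !lebesgue_measure_itv/= !lte_fin ltr_pM2r ?invr_gt0// ltrD2r.
case: ifPn => _; last by rewrite mule0.
by rewrite -!EFinB -EFinM; congr (_%:E); field; rewrite gt_eqF.
Qed.

End scales.

(** * Borel sets and Lebesgue measure of complex coordinate space *)

Section borel.

Lemma open_preimage_in (T U : topologicalType) (D : set T) (f : T -> U) V :
  open D -> {in D, continuous f} -> open V -> open (D `&` f @^-1` V).
Proof.
move=> oD cf oV; rewrite openE => x [Dx Vfx]; apply: filterI.
  exact: open_nbhs_nbhs.
by apply: cf; [rewrite inE|exact: open_nbhs_nbhs].
Qed.

Lemma open_continuous_borel (T U : ptopologicalType) (D : set T) (f : T -> U) :
  open D -> {in D, continuous f} ->
  measurable_fun (D : set (Borel T)) (f : Borel T -> Borel U).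
Proof.
move=> oD cf; apply: (@measurability _ _ _ (Borel U) _ _ (@open U)) => // _ [V oV <-].
by apply: sub_sigma_algebra; exact: open_preimage_in.
Qed.

Lemma open_continuous_borelR (R : realType) (T : ptopologicalType) (D : set T) (f : T -> R) :
  open D -> {in D, continuous f} ->
  measurable_fun (D : set (Borel T)) (f : Borel T -> measurableTypeR R).
Proof.
move=> oD cf; apply: (measurability _ (RGenOpens.measurableE R)).
move=> _ [_ [x [y ->]] <-].
by apply: sub_sigma_algebra; apply: open_preimage_in => //; exact: interval_open.
Qed.

End borel.

Section lebesgue_Cvec.
Context (R : realType).

Lemma continuous_Re : continuous (@complex.Re R : R[i]^o -> R).
Proof.
move=> z; apply/rnorm_continuousR => e e0; exists e => // y; apply: le_lt_trans.
by rewrite -raddfB rnorm_Re.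
Qed.

Lemma continuous_Im : continuous (@complex.Im R : R[i]^o -> R).
Proof.
move=> z; apply/rnorm_continuousR => e e0; exists e => // y; apply: le_lt_trans.
by rewrite -raddfB rnorm_Im.
Qed.

Variable n : nat.
Implicit Types (v w a : Cvec R n) (A : set (Borel (Cvec R n))).

Lemma continuous_coord j : continuous (fun v => v 0 j : R[i]^o).
Proof. exact: coord_continuous. Qed.

Lemma measurable_Re_coord j :
  measurable_fun setT (fun v : Borel (Cvec R n) => complex.Re (v 0 j) : measurableTypeR R).
Proof.
apply: open_continuous_borelR; first exact: openT.
move=> v _; apply: (@continuous_comp _ _ _ (fun v : Cvec R n => v 0 j : R[i]^o)).
  exact: continuous_coord.
exact: continuous_Re.
Qed.

Lemma measurable_Im_coord j :
  measurable_fun setT (fun v : Borel (Cvec R n) => complex.Im (v 0 j) : measurableTypeR R).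
Proof.
apply: open_continuous_borelR; first exact: openT.
move=> v _; apply: (@continuous_comp _ _ _ (fun v : Cvec R n => v 0 j : R[i]^o)).
  exact: continuous_coord.
exact: continuous_Im.
Qed.

Lemma tuple_of_CvecK v :
  Cvec_of_tuple [tuple (complex.Re (v 0 j), complex.Im (v 0 j)) | j < n] = v.
Proof. by apply/rowP => j; rewrite mxE tnth_mktuple/=; case: (v 0 j). Qed.

Lemma measurable_to_Cvec d (T : measurableType d) (f : T -> Borel (Cvec R n)) :
  (forall j, measurable_fun setT (fun x => complex.Re (f x 0 j) : measurableTypeR R)) ->
  (forall j, measurable_fun setT (fun x => complex.Im (f x 0 j) : measurableTypeR R)) ->
  measurable_fun setT f.
Proof.
move=> fRe fIm.
rewrite (_ : f = @Cvec_of_tuple R n \o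
  (fun x => [tuple (complex.Re (f x 0 j), complex.Im (f x 0 j)) | j < n])); last first.
  by apply/funext => x /=; rewrite tuple_of_CvecK.
apply: measurableT_comp; first exact: measurable_Cvec_of_tuple.
apply/measurable_fun_tnthP => j; rewrite (_ : _ \o _ =
  (fun x => (complex.Re (f x 0 j), complex.Im (f x 0 j)))).
  by apply/measurable_fun_pairP; split; [exact: fRe|exact: fIm].
by apply/funext => x; rewrite /= tnth_mktuple.
Qed.

Lemma ReD_coord v w j : complex.Re ((v + w) 0 j) = complex.Re (v 0 j) + complex.Re (w 0 j).
Proof. by rewrite mxE raddfD. Qed.

Lemma ImD_coord v w j : complex.Im ((v + w) 0 j) = complex.Im (v 0 j) + complex.Im (w 0 j).
Proof. by rewrite mxE raddfD. Qed.

Lemma measurable_CvecD d (T : measurableType d) (f g : T -> Borel (Cvec R n)) :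
  measurable_fun setT f -> measurable_fun setT g ->
  measurable_fun setT (fun x => (f x : Cvec R n) + g x : Borel (Cvec R n)).
Proof.
move=> mf mg; apply: measurable_to_Cvec => j.
- rewrite (_ : (fun x => _) = (fun x => complex.Re (f x 0 j) + complex.Re (g x 0 j))).
    by apply: measurable_funD; [exact: (measurableT_comp (measurable_Re_coord j) mf)|
      exact: (measurableT_comp (measurable_Re_coord j) mg)].
  by apply/funext => x; rewrite ReD_coord.
- rewrite (_ : (fun x => _) = (fun x => complex.Im (f x 0 j) + complex.Im (g x 0 j))).
    by apply: measurable_funD; [exact: (measurableT_comp (measurable_Im_coord j) mf)|
      exact: (measurableT_comp (measurable_Im_coord j) mg)].
  by apply/funext => x; rewrite ImD_coord.
Qed.

Lemma measurable_CvecZ d (T : measurableType d) (a b : T -> measurableTypeR R)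
    (f : T -> Borel (Cvec R n)) :
  measurable_fun setT a -> measurable_fun setT b -> measurable_fun setT f ->
  measurable_fun setT (fun x => (a x +i* b x) *: (f x : Cvec R n) : Borel (Cvec R n)).
Proof.
move=> ma mb mf.
have mRe j := measurableT_comp (measurable_Re_coord j) mf.
have mIm j := measurableT_comp (measurable_Im_coord j) mf.
apply: measurable_to_Cvec => j.
- rewrite (_ : (fun x => _) = (fun x => a x * complex.Re (f x 0 j) - b x * complex.Im (f x 0 j))).
    exact: (measurable_funB (measurable_funM ma (mRe j)) (measurable_funM mb (mIm j))).
  by apply/funext => x; rewrite mxE; case: (f x 0 j).
- rewrite (_ : (fun x => _) = (fun x => a x * complex.Im (f x 0 j) + b x * complex.Re (f x 0 j))).
    exact: (measurable_funD (measurable_funM ma (mIm j)) (measurable_funM mb (mRe j))).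
  by apply/funext => x; rewrite mxE; case: (f x 0 j).
Qed.

Definition lamb : {measure set (Borel (Cvec R n)) -> \bar R} := @lebesgue_Cvec R n.

Lemma scales_lebesgue2 (s a b : R) : 0 < s ->
  scales (lebesgue2 R) (fun z => (s * z.1 + a, s * z.2 + b)) (s^-1 * s^-1).
Proof.
by move=> s0; exact: (scales_prod (m1 := lebesgue_measure)
  (m2 := lebesgue_measure) (scales_lebesgue a s0) (scales_lebesgue b s0)).
Qed.

Lemma scales_lamb (s : 'I_n -> R) a : (forall j, 0 < s j) ->
  scales lamb (fun v : Borel (Cvec R n) => \row_j ((s j)%:C * v 0 j + a 0 j) : Borel (Cvec R n))
    (\prod_j ((s j)^-1 * (s j)^-1)).
Proof.
move=> s0.
have [c0 mf H] := scales_tuple (fun j =>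
  @scales_lebesgue2 (s j) (complex.Re (a 0 j)) (complex.Im (a 0 j)) (s0 j)).
have E t : \row_j ((s j)%:C * (Cvec_of_tuple t : Cvec R n) 0 j + a 0 j) = Cvec_of_tuple
  [tuple (s j * (tnth t j).1 + complex.Re (a 0 j), s j * (tnth t j).2 + complex.Im (a 0 j)) | j < n].
  apply/rowP => j; rewrite !mxE tnth_mktuple/=; case: (a 0 j) => x y; case: (tnth t j) => z w/=.
  by apply/eqP; rewrite eq_complex/=; apply/andP; split; apply/eqP; ring.
split => // [|A mA].
  apply: measurable_to_Cvec => j.
    rewrite (_ : (fun v => _) = (fun v : Borel (Cvec R n) => s j * complex.Re (v 0 j) + complex.Re (a 0 j))).
      by apply: measurable_funD => //; apply: measurable_funM => //; exact: measurable_Re_coord.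
    apply/funext => v; rewrite mxE; case: (v 0 j) => ? ?; case: (a 0 j) => ? ? /=; ring.
  rewrite (_ : (fun v => _) = (fun v : Borel (Cvec R n) => s j * complex.Im (v 0 j) + complex.Im (a 0 j))).
    by apply: measurable_funD => //; apply: measurable_funM => //; exact: measurable_Im_coord.
  apply/funext => v; rewrite mxE; case: (v 0 j) => ? ?; case: (a 0 j) => ? ? /=; ring.
rewrite /lamb /= /lebesgue_Cvec /pushforward -H; last first.
  by rewrite -[X in measurable X]setTI; exact: measurable_Cvec_of_tuple.
by congr (_ _); apply/seteqP; split => t /=; rewrite E.
Qed.

Lemma scales_lamb_shift a : scales lamb (fun v : Borel (Cvec R n) => (v : Cvec R n) + a : Borel (Cvec R n)) 1.
Proof.
have := @scales_lamb (fun=> 1) a (fun=> ltr01).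
rewrite big1 => [|j _]; last by rewrite invr1 mulr1.
rewrite (_ : (fun v => _) = (fun v : Borel (Cvec R n) => (v : Cvec R n) + a : Borel (Cvec R n)))//.
by apply/funext => v; apply/rowP => j; rewrite !mxE mul1r.
Qed.

Definition cdisc v (r : R) : set (Cvec R n) := [set w | rnorm (w - v) < r].

Lemma cdisc_open v r : open (cdisc v r).
Proof.
rewrite openE => w /= wr; apply/nbhs_rnormP; exists (r - rnorm (w - v)); first by rewrite subr_gt0.
move=> y; rewrite ltrBrDr => H; apply: le_lt_trans H; rewrite /cdisc/=.
by rewrite -[y - v](subrKA w) (le_trans (rnormD _ _))// rnorm_dist.
Qed.

Lemma measurable_cdisc v r : measurable (cdisc v r : set (Borel (Cvec R n))).
Proof. by apply: sub_sigma_algebra; exact: cdisc_open. Qed.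

Lemma lamb_cdisc v r : lamb (cdisc v r) = lamb (cdisc 0 r).
Proof.
have [_ _ H] := scales_lamb_shift (- v).
have := H _ (measurable_cdisc 0 r); rewrite mul1e => <-.
by congr (lamb _); apply/seteqP; split => w /=; rewrite /cdisc/= subr0.
Qed.

(** A product of real intervals, so that its measure is explicit. Discs lie between two such boxes,
    which shows that their measure is finite and positive. *)
Definition cbox (r : R) : set (Borel (Cvec R n)) :=
  [set v | forall j, `|complex.Re (v 0 j)| < r /\ `|complex.Im (v 0 j)| < r].

Lemma lamb_cbox r : 0 < r -> lamb (cbox r) = (((2 * r) * (2 * r)) ^+ n)%:E.
Proof.
move=> r0; pose Q : set (measurableTypeR R * measurableTypeR R) := `]-r, r[%classic `*` `]-r, r[%classic.
have mQ : measurable Q by apply: measurableX; exact: measurable_itv.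
have Qm : lebesgue2 R Q = ((2 * r) * (2 * r))%:E.
  have L : lebesgue_measure (`]-r, r[%classic : set (measurableTypeR R)) = (2 * r)%:E.
    by rewrite lebesgue_measure_itv/= lte_fin gtrN// -EFinB; congr (_%:E); ring.
  rewrite EFinM -{1}L -L; apply: (product_measure1E lebesgue_measure lebesgue_measure);
    exact: measurable_itv.
rewrite -(tuple_measure_box n mQ Qm) /lamb/= /lebesgue_Cvec /pushforward; congr (_ _).
apply/seteqP; split => t /= H j; have := H j; rewrite /Q/= !in_itv/= !ltr_norml mxE;
  by case: (tnth t j) => x y /= [].
Qed.

Lemma cdisc_sub_cbox r : cdisc 0 r `<=` cbox r.
Proof.
move=> v; rewrite /cdisc/= subr0 => vr j.
have H := le_lt_trans (coord_rnorm v j) vr.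
by split; [exact: le_lt_trans (rnorm_Re _) H|exact: le_lt_trans (rnorm_Im _) H].
Qed.

Lemma cbox_sub_cdisc r : 0 < r -> cbox (r / 2) `<=` cdisc 0 r.
Proof.
move=> r0 v vr; rewrite /cdisc/= subr0; apply: rnorm_lt => // j.
have [] := vr j; case: (v 0 j) => x y /= xr yr.
by rewrite (le_lt_trans (rnorm_le_ReIm _ _))// [ltRHS]splitr ltrD.
Qed.

Lemma measurable_cbox r : measurable (cbox r).
Proof.
rewrite (_ : cbox r = \bigcap_(j in [set: 'I_n])
  (((fun v : Borel (Cvec R n) => complex.Re (v 0 j) : measurableTypeR R) @^-1` `]-r, r[) `&`
   ((fun v : Borel (Cvec R n) => complex.Im (v 0 j) : measurableTypeR R) @^-1` `]-r, r[))).
  apply: fin_bigcap_measurable => [|j _]; first exact: finite_finset.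
  apply: measurableI; rewrite -[X in measurable X]setTI.
    by apply: measurable_Re_coord => //; exact: measurable_itv.
  by apply: measurable_Im_coord => //; exact: measurable_itv.
apply/seteqP; split => v /= H j; first by move=> _; rewrite /setI/= !in_itv/= -!ltr_norml; exact: H.
by have := H j I; rewrite /setI/= !in_itv/= -!ltr_norml.
Qed.

Lemma lamb_cdisc_fin v r : (lamb (cdisc v r) < +oo)%E.
Proof.
rewrite lamb_cdisc; have [r0|r0] := ltP 0 r; last first.
  rewrite (_ : cdisc 0 r = set0) ?measure0//; apply/seteqP; split => // w.
  by rewrite /cdisc/= => /lt_le_trans/(_ r0); rewrite ltNge rnorm_ge0.
apply: (@le_lt_trans _ _ (lamb (cbox r))); last by rewrite lamb_cbox// ltry.
apply: le_measure; rewrite ?inE; [exact: measurable_cdisc|exact: measurable_cbox|].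
exact: cdisc_sub_cbox.
Qed.

Lemma lamb_cdisc_gt0 v r : 0 < r -> (0 < lamb (cdisc v r))%E.
Proof.
move=> r0; rewrite lamb_cdisc.
apply: (@lt_le_trans _ _ (lamb (cbox (r / 2)))).
  rewrite lamb_cbox ?divr_gt0// lte_fin exprn_gt0// mulr_gt0// mulr_gt0// divr_gt0//.
apply: le_measure; rewrite ?inE; [exact: measurable_cbox|exact: measurable_cdisc|].
exact: cbox_sub_cdisc.
Qed.

End lebesgue_Cvec.

Section scales_theory.
Context {R : realType} d (T : measurableType d) (m : {measure set T -> \bar R}).
Implicit Types (f g : T -> T) (A : set T).

Lemma scales_comp f g (a b : R) : scales m f a -> scales m g b ->
  scales m (g \o f) (a * b).
Proof.
move=> [a0 mf H1] [b0 mg H2]; split => [||A mA].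
- exact: mulr_ge0.
- exact: (measurableT_comp mg mf).
- rewrite comp_preimage H1; last by rewrite -[X in measurable X]setTI; exact: mg.
  by rewrite H2// muleA -EFinM.
Qed.

Lemma scales_indic f (a : R) A : scales m f a -> measurable A ->
  (\int[m]_x (\1_A (f x))%:E = a%:E * m A)%E.
Proof.
move=> [_ mf H] mA; rewrite -H// -(setIT (f @^-1` A)) -integral_indic//.
by rewrite -[X in measurable X]setTI; exact: mf.
Qed.

Lemma scales_uniq f (a b : R) A : measurable A -> (0 < m A < +oo)%E ->
  scales m f a -> scales m f b -> a = b.
Proof.
move=> mA /andP[A0 Aoo] [_ _ H1] [_ _ H2].
have := H1 _ mA; rewrite H2// => E; apply/EFin_inj/esym.
have fA : m A \is a fin_num by rewrite ge0_fin_numE// ltW.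
move: E; rewrite -(fineK fA) -!EFinM => -[].
by move/mulIf => -> //; rewrite gt_eqF// fine_gt0// A0.
Qed.

End scales_theory.

Section sigma_finite_of.
Context d (T : measurableType d) (R : realType) (nu : {measure set T -> \bar R}).
Hypothesis H : sigma_finite setT nu.

(** A copy of [nu] indexed by the proof, to which the sigma-finite structure demanded by Tonelli's
    theorem is attached. *)
Definition with_sigma_finite of sigma_finite setT nu : set T -> \bar R := nu.

HB.instance Definition _ := Measure.on (with_sigma_finite H).
HB.instance Definition _ := Measure_isSigmaFinite.Build _ _ _ (with_sigma_finite H) H.

Definition sigma_finite_of : {sigma_finite_measure set T -> \bar R} := with_sigma_finite H.

End sigma_finite_of.

(** * Uniqueness of translation-invariant measures *)

Section uniqueness.
Context (R : realType) (n : nat).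
Local Notation C := (Borel (Cvec R n)).
Local Notation lam := (@lamb R n).

Lemma sigma_finite_cdisc (nu : {measure set C -> \bar R}) :
  (forall k : nat, nu (cdisc 0 k%:R) < +oo)%E -> sigma_finite setT nu.
Proof.
move=> H; exists (fun k => cdisc 0 k%:R) => [|k]; last by split; [exact: measurable_cdisc|exact: H].
apply/seteqP; split => // v _; exists (Num.truncn (rnorm v)).+1 => //.
by rewrite /cdisc/= subr0 truncnS_gt.
Qed.

Lemma lamb_sigma_finite : sigma_finite setT lam.
Proof. by apply: sigma_finite_cdisc => k; exact: lamb_cdisc_fin. Qed.

Definition lambs := sigma_finite_of lamb_sigma_finite.

Lemma measurable_shift (a : Cvec R n) :
  measurable_fun setT (fun v : C => (v : Cvec R n) + a : C).
Proof. by have [_ ? _] := scales_lamb_shift a. Qed.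

Definition cvopp (v : C) : C := - (v : Cvec R n).

Lemma measurable_CvecN : measurable_fun setT cvopp.
Proof.
have mc (k : R) : measurable_fun [set: C] (fun=> k : measurableTypeR R) by exact: measurable_cst.
have := measurable_CvecZ (mc (- 1)) (mc 0) (@measurable_id _ C setT).
congr measurable_fun; apply/funext => v.
by rewrite (_ : (-1 +i* 0) = - 1) ?scaleN1r//; apply/eqP; rewrite eq_complex/= oppr0 !eqxx.
Qed.

(* Both sides are the integral of [1_A x * 1_B (x + y)] against [nu (dx) lam (dy)],
   before and after the substitution of [x - y] for [x]. *)
Lemma shift_invariant_swap (nu : {measure set C -> \bar R}) (A B : set C) :
  (forall k : nat, nu (cdisc 0 k%:R) < +oo)%E ->
  (forall a, scales nu (fun v : C => (v : Cvec R n) + a : C) 1) ->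
  measurable A -> measurable B ->
  (nu A * lam B = nu B * lam (cvopp @^-1` A))%E.
Proof.
move=> nufin nus mA mB; pose nus' := sigma_finite_of (sigma_finite_cdisc nufin).
have m1 : measurable_fun setT (fst : C * C -> C) by exact: measurable_fst.
have m2 : measurable_fun setT (snd : C * C -> C) by exact: measurable_snd.
have mD : measurable_fun setT (fun z : C * C => (z.1 : Cvec R n) + z.2 : C).
  exact: measurable_CvecD.
have mB' : measurable_fun setT (fun z : C * C => (z.1 : Cvec R n) - z.2 : C).
  by apply: measurable_CvecD => //; exact: (measurableT_comp measurable_CvecN m2).
have mind (E : set C) (f : C * C -> C) : measurable E -> measurable_fun setT f ->
    measurable_fun setT (fun z => (\1_E (f z))%:E : \bar R).
  move=> mE mf; apply/measurable_EFinP.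
  exact: (measurableT_comp (measurable_indic mE) mf).
have mind1 (E : set C) (f : C -> C) : measurable E -> measurable_fun setT f ->
    measurable_fun setT (fun z => (\1_E (f z))%:E : \bar R).
  move=> mE mf; apply/measurable_EFinP.
  exact: (measurableT_comp (measurable_indic mE) mf).
pose F (z : C * C) : \bar R := ((\1_A z.1)%:E * (\1_B ((z.1 : Cvec R n) + z.2))%:E)%E.
pose G (z : C * C) : \bar R := ((\1_B z.1)%:E * (\1_A ((z.1 : Cvec R n) - z.2))%:E)%E.
have mF : measurable_fun setT F by apply: emeasurable_funM; exact: mind.
have mG : measurable_fun setT G by apply: emeasurable_funM; exact: mind.
have F0 z : (0 <= F z)%E by rewrite mule_ge0// lee_fin.
have G0 z : (0 <= G z)%E by rewrite mule_ge0// lee_fin.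
have EF : (\int[nus']_x \int[lambs]_y F (x, y) = nu A * lam B)%E.
  transitivity (\int[nus']_x ((\1_A x)%:E * lam B))%E.
    apply: eq_integral => x _; rewrite /F/=.
    have msx := measurable_shift x.
    under eq_integral do rewrite addrC.
    rewrite ge0_integralZl//; last exact: mind1 mB msx.
    by rewrite (scales_indic (scales_lamb_shift x) mB) mul1e.
  rewrite ge0_integralZr//; last by apply/measurable_EFinP; exact: measurable_indic.
  by rewrite integral_indic// setIT.
have EG : (\int[nus']_x \int[lambs]_y G (x, y) =
    nu B * lam (cvopp @^-1` A))%E.
  have mNA : measurable (cvopp @^-1` A).
    by rewrite -[X in measurable X]setTI; exact: measurable_CvecN.
  transitivity (\int[nus']_x ((\1_B x)%:E *
      lam (cvopp @^-1` A)))%E.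
    apply: eq_integral => x _; rewrite /G/=.
    have msx := measurable_shift (- x).
    rewrite [LHS](_ : _ = \int[lambs]_y ((\1_B x)%:E * (\1_(cvopp @^-1` A) ((y : Cvec R n) - x)%R)%:E))%E; last first.
      apply: eq_integral => y _; congr (_ * _%:E)%E; rewrite !indicE.
      suff -> : ((y : Cvec R n) - x \in cvopp @^-1` A) = ((x : Cvec R n) - y \in A) by [].
      by apply/idP/idP; rewrite !inE /preimage/= /cvopp opprB.
    rewrite ge0_integralZl//; last exact: mind1 mNA msx.
    by rewrite (scales_indic (scales_lamb_shift (- x)) mNA) mul1e.
  rewrite ge0_integralZr//; last by apply/measurable_EFinP; exact: measurable_indic.
  by rewrite integral_indic// setIT.
rewrite -EF -EG (fubini_tonelli F mF F0) (fubini_tonelli G mG G0).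
apply: eq_integral => y _.
have mGy : measurable_fun setT (fun x : C => G (x, y)).
  apply: emeasurable_funM; first by apply/measurable_EFinP; exact: measurable_indic.
  exact: mind1 mA (measurable_shift (- y)).
have := scales_integral (nus y) mGy (fun x => G0 (x, y)); rewrite mul1e => <-.
by apply: eq_integral => x _; rewrite /F /G/= addrK muleC.
Qed.

(** Exchanging [A] with the unit disc [B] gives [nu A * lam B = nu B * lam (- A)]; the same exchange
    for [nu = lam] shows that [lam (- A) = lam A]. *)
Lemma shift_invariant_unique (nu : {measure set C -> \bar R}) :
  (forall k : nat, nu (cdisc 0 k%:R) < +oo)%E ->
  (forall a, scales nu (fun v : C => (v : Cvec R n) + a : C) 1) ->
  exists2 c : R, 0 <= c & forall A, measurable A -> nu A = (c%:E * lam A)%E.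
Proof.
move=> nufin nus; pose B : set C := cdisc 0 1.
have mB : measurable B by exact: measurable_cdisc.
have lB0 : (0 < lam B)%E by exact: lamb_cdisc_gt0.
have lBf : lam B \is a fin_num by rewrite ge0_fin_numE ?ltW//; exact: lamb_cdisc_fin.
have nBf : nu B \is a fin_num by rewrite ge0_fin_numE//; exact: (nufin 1%N).
have lB0' : 0 < fine (lam B) by rewrite fine_gt0// lB0 lamb_cdisc_fin.
have cancel x : (x * lam B * ((fine (lam B))^-1)%:E = x)%E.
  by rewrite -{1}(fineK lBf) -muleA -EFinM mulfV ?mule1// gt_eqF.
have sym A : measurable A -> lam (cvopp @^-1` A) = lam A.
  move=> mA; rewrite -[RHS]cancel -[LHS]cancel; congr (_ * _)%E; rewrite [LHS]muleC.
  apply/esym/shift_invariant_swap => // [k|a]; first exact: lamb_cdisc_fin.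
  exact: scales_lamb_shift.
exists (fine (nu B) / fine (lam B)) => [|A mA]; first by rewrite divr_ge0// fine_ge0.
rewrite -[LHS]cancel (shift_invariant_swap nufin nus mA mB) sym//.
by rewrite muleAC EFinM fineK.
Qed.

End uniqueness.

Section matrix_facts.

Lemma rV_mulmxE (K : pzSemiRingType) n m (v : 'rV[K]_n) (L : 'M[K]_(n, m)) j :
  (v *m L) 0 j = \sum_i v 0 i * L i j.
Proof. by rewrite mxE. Qed.

Lemma rV_mul_diagE (K : pzSemiRingType) n (v d : 'rV[K]_n) j :
  (v *m diag_mx d) 0 j = v 0 j * d 0 j.
Proof. by rewrite mul_mx_diag mxE. Qed.

Lemma diag_conjE (K : fieldType) n (d : 'rV[K]_n) (L : 'M[K]_n) i j :
  (forall i, d 0 i != 0) ->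
  (diag_mx d *m L *m diag_mx (\row_k (d 0 k)^-1)) i j = d 0 i * L i j / d 0 j.
Proof. by move=> d0; rewrite mul_mx_diag mul_diag_mx !mxE. Qed.

Lemma diag_mxV (K : fieldType) n (d : 'rV[K]_n) : (forall i, d 0 i != 0) ->
  diag_mx d *m diag_mx (\row_k (d 0 k)^-1) = 1%:M.
Proof.
move=> d0; rewrite mulmx_diag; apply/matrixP => i j; rewrite !mxE.
by case: eqP => // ->; rewrite mulfV.
Qed.

Lemma rV_mul_permE (K : pzSemiRingType) n (v : 'rV[K]_n) (s : 'S_n) j :
  (v *m perm_mx s) 0 j = v 0 ((s^-1)%g j).
Proof. by rewrite -[s in LHS]invgK -col_permE mxE. Qed.

End matrix_facts.

Lemma measurable_preimageT d1 d2 (T1 : measurableType d1) (T2 : measurableType d2)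
    (f : T1 -> T2) A : measurable_fun setT f -> measurable A -> measurable (f @^-1` A).
Proof. by move=> mf mA; rewrite -[X in measurable X]setTI; exact: mf. Qed.

Lemma measure_leS d (T : measurableType d) (R : realType)
    (mu : {measure set T -> \bar R}) (A B : set T) :
  measurable A -> measurable B -> A `<=` B -> (mu A <= mu B)%E.
Proof. by move=> mA mB; apply: le_measure; apply/mem_set. Qed.

(** * Scaling factors and norm bounds of linear maps *)

Section linear_scaling.
Context (R : realType).

Lemma rnorm_sum (I : finType) (F : I -> R[i]^o) :
  rnorm (\sum_i F i : R[i]^o) <= \sum_i rnorm (F i).
Proof.
elim/big_ind2 : _ => [|a x b y ax bY|//]; first by rewrite rnorm0.
exact: le_trans (rnormD _ _) (lerD ax bY).
Qed.

Variable n : nat.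
Local Notation C := (Borel (Cvec R n)).
Local Notation lam := (@lamb R n).
Implicit Types (L M : 'M[R[i]]_n).

Definition mulR L (v : C) : C := (v : 'rV[R[i]]_n) *m L.

Local Notation nrm := (fun v : C => rnorm (v : Cvec R n)).

Lemma mulmx_bound L (K : R) : 0 <= K ->
  (forall j, \sum_i rnorm (L i j : R[i]^o) <= K) -> forall v, nrm (mulR L v) <= K * nrm v.
Proof.
move=> K0 LK v; apply: rnorm_le => [|j]; first by rewrite mulr_ge0// rnorm_ge0.
have -> : (mulR L v : Cvec R n) 0 j = \sum_i ((v : 'rV[R[i]]_n) 0 i * L i j) :> R[i].
  exact: rV_mulmxE.
apply: (le_trans (rnorm_sum _)).
apply: (@le_trans _ _ (\sum_i rnorm (L i j : R[i]^o) * nrm v)).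
  apply: ler_sum => i _; rewrite rnormM mulrC ler_wpM2l ?rnorm_ge0//.
  exact: (coord_rnorm (v : Cvec R n)).
by rewrite -mulr_suml ler_wpM2r ?rnorm_ge0.
Qed.

Lemma mulmx_bounded L : exists2 K : R, 0 < K & forall v, nrm (mulR L v) <= K * nrm v.
Proof.
pose K := 1 + \sum_j \sum_i rnorm (L i j : R[i]^o).
have S0 j : 0 <= \sum_i rnorm (L i j : R[i]^o) by apply: sumr_ge0 => i _; exact: rnorm_ge0.
have K0 : 0 < K by rewrite ltr_pwDl// sumr_ge0.
exists K => //; apply: mulmx_bound => [|j]; first exact: ltW.
by rewrite /K [in leRHS](bigD1 j)//= addrCA lerDl addr_ge0// sumr_ge0.
Qed.

Lemma mulRD L (v w : Cvec R n) : mulR L (v + w : Cvec R n) = (mulR L v : Cvec R n) + mulR L w.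
Proof. exact: mulmxDl. Qed.

Lemma mulRB L (v w : Cvec R n) : mulR L (v - w : Cvec R n) = (mulR L v : Cvec R n) - mulR L w.
Proof. exact: mulmxBl. Qed.

Lemma mulR_comp L M : mulR (L *m M) = mulR M \o mulR L.
Proof. by apply/funext => v; exact: mulmxA. Qed.

Lemma mulR1 : mulR 1%:M = id.
Proof. by apply/funext => v; exact: mulmx1. Qed.

Lemma measurable_mulR L : measurable_fun setT (mulR L).
Proof.
apply: (@open_continuous_borel (Cvec R n) (Cvec R n) setT (mulR L)); first exact: openT.
have [K K0 LK] := mulmx_bounded L.
move=> v _; apply/rnorm_continuous => e e0; exists (e / K) => [|w]; first by rewrite divr_gt0.
by rewrite ltr_pdivlMr// mulrC => H; rewrite -mulRB (le_lt_trans (LK _)).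
Qed.

(** The pushforward of Lebesgue measure under [L] is translation invariant and, [M] being bounded,
    finite on discs, so it is a multiple of Lebesgue measure. Only the value of the multiple remains
    to be found. *)
Lemma lin_scales_ex L M : L *m M = 1%:M -> M *m L = 1%:M -> exists c, scales lam (mulR L) c.
Proof.
move=> LM ML; have mL := measurable_mulR L.
have LK : cancel (mulR L) (mulR M).
  by move=> v; rewrite -[LHS]/((mulR M \o mulR L) v) -mulR_comp LM mulR1.
have MK : cancel (mulR M) (mulR L).
  by move=> v; rewrite -[LHS]/((mulR L \o mulR M) v) -mulR_comp ML mulR1.
have nuE A : ppush_measure lam measurableT mL A = lam (mulR L @^-1` A).
  by rewrite /ppush_measure/= /ppush setTI.
have [|a|c c0 cP] := @shift_invariant_unique R n (ppush_measure lam measurableT mL).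
- move=> k; rewrite nuE; have [K K0 MP] := mulmx_bounded M.
  apply: (@le_lt_trans _ _ (lam (cdisc 0 (K * k%:R)))); last exact: lamb_cdisc_fin.
  apply: measure_leS; [|exact: (@measurable_cdisc R n)|].
    exact: (measurable_preimageT mL (@measurable_cdisc R n _ _)).
  move=> v; rewrite /cdisc/= !subr0 => H.
  by rewrite -[v]LK (le_lt_trans (MP _))// ltr_pM2l.
- have [_ ms H] := scales_lamb_shift (mulR M a); split => // [|A mA].
    exact: (measurable_shift a).
  rewrite !nuE -H; last exact: (measurable_preimageT mL mA).
  congr (lam _); apply/seteqP.
  have E v : mulR L ((v : Cvec R n) + mulR M a) = (mulR L v : Cvec R n) + a :> Cvec R n.
    by rewrite mulRD MK.
  by split => v /=; rewrite E.
by exists c; split => // A mA; rewrite -cP// nuE.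
Qed.

Lemma scales_id : scales lam id 1.
Proof. by split => // A _; rewrite preimage_id mul1e. Qed.

Lemma lamb_scales_uniq f (a b : R) : scales lam f a -> scales lam f b -> a = b.
Proof.
apply: (@scales_uniq R _ C lam f a b (cdisc 0 1)); first exact: measurable_cdisc.
by rewrite lamb_cdisc_gt0// lamb_cdisc_fin.
Qed.

Lemma scalesV L M (c c' : R) : L *m M = 1%:M ->
  scales lam (mulR L) c -> scales lam (mulR M) c' -> c * c' = 1.
Proof.
move=> LM sL sM; apply: (lamb_scales_uniq (f := mulR (L *m M))).
  by rewrite mulR_comp; exact: scales_comp.
by rewrite LM mulR1; exact: scales_id.
Qed.

Lemma scales_diag (d : 'I_n -> R) : (forall j, 0 < d j) ->
  scales lam (mulR (diag_mx (\row_j (d j)%:C))) (\prod_j ((d j)^-1 * (d j)^-1)).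
Proof.
move=> d0; have := scales_lamb 0 d0; congr (scales lam _ _); apply/funext => v.
apply/rowP => j; rewrite mxE.
rewrite (_ : (mulR _ v : Cvec R n) 0 j = (v : Cvec R n) 0 j * (\row_j (d j)%:C) 0 j).
  by rewrite !mxE addr0 mulrC.
exact: rV_mul_diagE.
Qed.

Lemma lamb_cdisc_scale (r : R) : 0 < r ->
  lam (cdisc 0 r) = (((r ^+ n) ^+ 2)%:E * lam (cdisc 0 1))%E.
Proof.
move=> r0; have ri0 : 0 < r^-1 by rewrite invr_gt0.
have [_ _ H] := scales_lamb 0 (fun _ : 'I_n => ri0).
have {H} := H _ (measurable_cdisc 0 1).
rewrite prodr_const card_ord invrK exprMn -expr2 => <-.
congr (lam _); apply/seteqP.
have E (v : Cvec R n) : \row_j (r^-1%:C * v 0 j + (0 : Cvec R n) 0 j) = r^-1%:C *: v.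
  by apply/rowP => j; rewrite !mxE addr0.
by split => v; rewrite /cdisc/= !subr0 E rnormZ rnorm_real gtr0_norm// mulrC ltr_pdivrMr// mul1r.
Qed.

Lemma scales_bound L (c K : R) : 0 < K -> (forall v, nrm (mulR L v) <= K * nrm v) ->
  scales lam (mulR L) c -> 1 <= c * (K ^+ n) ^+ 2.
Proof.
move=> K0 LK [c0 mL H].
have : (lam (cdisc 0 1) <= lam (mulR L @^-1` cdisc 0 K))%E.
  apply: measure_leS; first exact: (@measurable_cdisc R n).
    exact: (measurable_preimageT mL (@measurable_cdisc R n _ _)).
  move=> v; rewrite /cdisc/= !subr0 => v1.
  by rewrite (le_lt_trans (LK v))// gtr_pMr.
move=> H1; have E := H _ (@measurable_cdisc R n 0 K).
have {H1 E} := eq_ind _ (fun x => lam (cdisc 0 1) <= x)%E H1 _ E.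
rewrite (lamb_cdisc_scale K0).
have fin : lam (cdisc 0 1) \is a fin_num.
  by rewrite ge0_fin_numE; [exact: lamb_cdisc_fin|exact: measure_ge0].
rewrite -(fineK fin) muleA -!EFinM lee_fin -[leLHS]mul1r ler_pM2r//.
by rewrite fine_gt0// lamb_cdisc_gt0//= lamb_cdisc_fin.
Qed.

(** By [scales_bound] the factors of [L] and of its inverse are both at least 1, and their product
    is 1. *)
Lemma scales_isometry L M (c : R) : L *m M = 1%:M -> M *m L = 1%:M ->
  (forall v, nrm (mulR L v) <= nrm v) -> (forall v, nrm (mulR M v) <= nrm v) ->
  scales lam (mulR L) c -> c = 1.
Proof.
move=> LM ML L1 M1 sL; have [c' sM] := lin_scales_ex ML LM.
have := scalesV LM sL sM.
have : 1 <= c * (1 ^+ n) ^+ 2.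
  by apply: scales_bound sL => // v; rewrite mul1r.
have : 1 <= c' * (1 ^+ n) ^+ 2.
  by apply: scales_bound sM => // v; rewrite mul1r.
rewrite !expr1n !mulr1; nra.
Qed.

Lemma bernoulli_le (x : R) m : 0 <= x <= 1 -> 1 - m%:R * x <= (1 - x) ^+ m.
Proof.
move=> /andP[x0 x1]; elim: m => [|m IH]; first by rewrite mul0r subr0.
rewrite exprS; have [H|H] := leP 0 (1 - m%:R * x).
  apply: le_trans (ler_wpM2l _ IH); last lra.
  have := mulr_ge0 (ler0n R m) (sqr_ge0 x); rewrite -natr1; nra.
apply: (@le_trans _ _ 0); last by rewrite mulr_ge0 ?exprn_ge0; lra.
rewrite -natr1; lra.
Qed.

(** [L] enlarges norms at most by [1 + e] and its inverse at most by [1 / (1 - e)], which confines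
    [c] through powers with exponent [2 n], the real dimension. Bernoulli's inequality makes the
    bounds linear in [e]. *)
Lemma scales_near1 L (c e : R) : 0 < e < 1 ->
  (forall v, nrm ((mulR L v : Cvec R n) - v : Cvec R n) <= e * nrm v) ->
  forall M, L *m M = 1%:M -> M *m L = 1%:M ->
  scales lam (mulR L) c -> 1 - (n * 2)%:R * e <= c /\ c * (1 - (n * 2)%:R * e) <= 1.
Proof.
move=> /andP[e0 e1] Le M LM ML sL; have [c' sM] := lin_scales_ex ML LM.
have cc' := scalesV LM sL sM; have [c0 _ _] := sL; have [c'0 _ _] := sM.
have B : 1 - (n * 2)%:R * e <= (1 - e) ^+ (n * 2) by apply: bernoulli_le; lra.
have e10 : 0 < 1 - e by lra.
have H1 : 1 <= c * ((1 + e) ^+ n) ^+ 2.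
  apply: scales_bound sL => [|v]; first lra.
  by rewrite mulrDl mul1r -[X in nrm X](subrK (v : Cvec R n)) addrC (le_trans (rnormD _ _))// lerD2l.
have H2 : 1 <= c' * ((1 - e)^-1 ^+ n) ^+ 2.
  apply: scales_bound sM => [|w]; first by rewrite invr_gt0.
  rewrite mulrC ler_pdivlMr// mulrBr mulr1 lerBlDr.
  have MwK : mulR L (mulR M w) = w.
    by rewrite -[LHS]/((mulR L \o mulR M) w) -mulR_comp ML mulR1.
  have := Le (mulR M w); rewrite MwK mulrC => H.
  rewrite -lerBlDl; apply: le_trans H.
  rewrite rnorm_dist; apply: le_trans (ler_norm _) (ler_rnorm_dist _ _).
have X0 : 0 < (1 - e) ^+ (n * 2) by rewrite exprn_gt0.
split; apply: (le_trans B) || idtac.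
  apply: (@le_trans _ _ (c * ((1 + e) ^+ n) ^+ 2 * (1 - e) ^+ (n * 2))).
    by rewrite -[leLHS]mul1r ler_wpM2r// ltW.
  rewrite -exprM -mulrA -exprMn ler_piMr// exprn_ile1//; nra.
apply: (@le_trans _ _ (c * (1 - e) ^+ (n * 2))); first by rewrite ler_wpM2l.
move: H2; rewrite -exprM exprVn ler_pdivlMr// mul1r => H2.
by rewrite -[leRHS]cc' ler_wpM2l.
Qed.

End linear_scaling.

Section matrix_facts.
Variable K : fieldType.

Lemma diag_conj_subE n (d : 'rV[K]_n) (L : 'M[K]_n) i j : (forall i, d 0 i != 0) ->
  (forall i, L i i = 1) ->
  (diag_mx d *m L *m diag_mx (\row_k (d 0 k)^-1) - 1%:M) i j =
  if i == j then 0 else d 0 i * L i j / d 0 j.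
Proof.
move=> d0 L1; rewrite [LHS]mxE diag_conjE// !mxE; case: eqP => [->|_].
  by rewrite L1 mulr1 mulfV// subrr.
by rewrite subr0.
Qed.

Lemma conj_inv n (d d' L M : 'M[K]_n) : d *m d' = 1%:M -> d' *m d = 1%:M -> L *m M = 1%:M ->
  (d *m L *m d') *m (d *m M *m d') = 1%:M.
Proof. by move=> dd' d'd LM; rewrite !mulmxA -(mulmxA _ d') d'd mulmx1 -(mulmxA d) LM mulmx1. Qed.

Lemma upper_det n (U : 'M[K]_n) : (forall i j : 'I_n, (j < i)%N -> U i j = 0) ->
  \det U = \prod_i U i i.
Proof.
move=> U0; rewrite -det_tr det_trig; first by apply: eq_bigr => i _; rewrite mxE.
by apply/is_trig_mxP => i j ij; rewrite mxE U0.
Qed.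

Lemma diag_mulE n (d e : 'rV[K]_n) : diag_mx d *m diag_mx e = diag_mx (\row_j (d 0 j * e 0 j)).
Proof. exact: mulmx_diag. Qed.

Lemma diag_leftE n (d : 'rV[K]_n) (A : 'M[K]_n) i j : (diag_mx d *m A) i j = d 0 i * A i j.
Proof. by rewrite mul_diag_mx mxE. Qed.

End matrix_facts.

(** * Scaling factors and determinants *)

Section det_scaling.
Context (R : realType) (n : nat).
Local Notation C := (Borel (Cvec R n)).
Local Notation lam := (@lamb R n).
Implicit Types (L M : 'M[R[i]]_n).

Lemma scales_mul L M (a b : R) : scales lam (mulR L) a -> scales lam (mulR M) b ->
  scales lam (mulR (L *m M)) (a * b).
Proof. by move=> sL sM; rewrite mulR_comp; exact: scales_comp. Qed.

(* Conjugating by a diagonal matrix does not change the scaling factor, and brings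
   [L] as close to the identity as one wishes. *)
Lemma scales_unipotent L M (c : R) : L *m M = 1%:M -> M *m L = 1%:M ->
  (forall i, L i i = 1) ->
  (forall e : R, 0 < e -> exists2 d : 'I_n -> R, (forall i, 0 < d i) &
    forall i j, i != j -> d i * rnorm (L i j : R[i]^o) / d j <= e) ->
  scales lam (mulR L) c -> c = 1.
Proof.
move=> LM ML L1 Ld sL; have [c0 _ _] := sL.
have key e : 0 < e < 1 -> 1 - (n * 2)%:R * e <= c /\ c * (1 - (n * 2)%:R * e) <= 1.
  (* A column of the conjugate minus the identity has [n] entries, each at most [e / (n + 1)], so
     its sum is at most [e]. *)
  move=> /andP[e0 e1]; have e'0 : 0 < e / n.+1%:R by rewrite divr_gt0.
  have [d d0 dP] := Ld _ e'0.
  pose D : 'rV[R[i]]_n := \row_j (d j)%:C.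
  pose D' : 'rV[R[i]]_n := \row_j ((d j)^-1)%:C.
  have D0 i : D 0 i != 0 by rewrite mxE fmorph_eq0 gt_eqF.
  have D'E : D' = \row_k (D 0 k)^-1 by apply/rowP => j; rewrite !mxE fmorphV.
  have D'0 i : D' 0 i != 0 by rewrite D'E mxE invr_eq0.
  have DD' : diag_mx D *m diag_mx D' = 1%:M by rewrite D'E; exact: diag_mxV.
  have D'D : diag_mx D' *m diag_mx D = 1%:M.
    have := diag_mxV D'0; congr (_ *m diag_mx _ = _).
    by apply/rowP => j; rewrite D'E !mxE invrK.
  have d'0 j : 0 < (d j)^-1 by rewrite invr_gt0.
  have sD := scales_diag d0; have sD' := scales_diag d'0.
  have s1 := scales_mul (scales_mul sD sL) sD'.
  have cE : (\prod_j ((d j)^-1 * (d j)^-1)) * c * (\prod_j ((d j)^-1^-1 * (d j)^-1^-1)) = c.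
    rewrite mulrAC -big_split/= big1 ?mul1r// => j _.
    by rewrite invrK; field; rewrite gt_eqF.
  rewrite cE in s1.
  apply: (scales_near1 _ _ (conj_inv DD' D'D LM) (conj_inv DD' D'D ML) s1).
    by rewrite e0.
  move=> v; rewrite (_ : (mulR _ v : Cvec R n) - v = mulR (diag_mx D *m L *m diag_mx D' - 1%:M) v); last first.
    by rewrite -[X in _ - X](mulmx1 (v : 'rV[R[i]]_n)); exact: (esym (mulmxBr _ _ _)).
  apply: mulmx_bound => [|j]; first exact: ltW.
  apply: (@le_trans _ _ (\sum_(i < n) (e / n.+1%:R))); last first.
    by rewrite sumr_const card_ord -[leLHS]mulr_natr mulrAC ler_pdivrMr// ler_pM2l// ler_nat.
  apply: ler_sum => i _; rewrite D'E (diag_conj_subE _ _ D0 L1).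
  have [_|ij] := eqVneq i j; first by rewrite rnorm0 ltW.
  by rewrite !mxE !rnormM rnormV !rnorm_real !gtr0_norm// dP.
apply/eqP; rewrite eq_le; apply/andP; split; apply/ler_addgt0Pr => f f0.
- pose e := Num.min (1/2) (f / ((n * 2).+1%:R * (c + 1))).
  have cf : 0 < (n * 2).+1%:R * (c + 1) by rewrite mulr_gt0// ltr_wpDl.
  have e0 : 0 < e by rewrite lt_min divr_gt0//= divr_gt0.
  have e1 : e < 1 by rewrite gt_min; apply/orP; left; rewrite ltr_pdivrMr// mul1r ltr1n.
  have [|_ H] := key e; first by rewrite e0.
  have : (n * 2).+1%:R * (c + 1) * e <= f by rewrite mulrC -ler_pdivlMr// ge_min lexx orbT.
  have := mulr_ge0 (ler0n R (n * 2)) c0; rewrite -natr1 in cf *.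
  by move: H e0 (ler0n R (n * 2)); move: (_%:R : R) => N; nra.
- pose e := Num.min (1/2) (f / (n * 2).+1%:R).
  have cf : 0 < (n * 2).+1%:R :> R by [].
  have e0 : 0 < e by rewrite lt_min divr_gt0//= divr_gt0.
  have e1 : e < 1 by rewrite gt_min; apply/orP; left; rewrite ltr_pdivrMr// mul1r ltr1n.
  have [|H _] := key e; first by rewrite e0.
  have : (n * 2).+1%:R * e <= f by rewrite mulrC -ler_pdivlMr// ge_min lexx orbT.
  by rewrite -natr1; move: H e0; move: (_%:R : R) => N; nra.
Qed.

(** Powers of a small [s] serve as [d], with exponent [i] for lower and [- i] for upper triangular
    matrices: an off-diagonal entry that may be nonzero is multiplied by [s] to the power [|i - j|],
    which is at least 1. *)
Lemma triangular_conj L (e : R) : 0 < e ->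
  (forall i j : 'I_n, (i < j)%N -> L i j = 0) \/ (forall i j : 'I_n, (j < i)%N -> L i j = 0) ->
  exists2 d : 'I_n -> R, (forall i, 0 < d i) &
    forall i j, i != j -> d i * rnorm (L i j : R[i]^o) / d j <= e.
Proof.
move=> e0 tL; pose B := 1 + \sum_i \sum_j rnorm (L i j : R[i]^o).
have S0 i : 0 <= \sum_j rnorm (L i j : R[i]^o) by apply: sumr_ge0 => j _; exact: rnorm_ge0.
have B0 : 0 < B by rewrite ltr_pwDl// sumr_ge0.
have LB i j : rnorm (L i j : R[i]^o) <= B.
  rewrite /B (bigD1 i)//= (bigD1 j)//= !addrA -!addrA addrCA lerDl.
  by rewrite !addr_ge0// sumr_ge0// => k _; rewrite rnorm_ge0.
pose s := Num.min 1 (e / B).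
have s0 : 0 < s by rewrite lt_min ltr01 divr_gt0.
have s1 : s <= 1 by rewrite ge_min lexx.
have sB : s * B <= e by rewrite -ler_pdivlMr// ge_min lexx orbT.
have bound k x : (0 < k)%N -> 0 <= x <= B -> s ^+ k * x <= e.
  move=> k0 /andP[x0 xB]; apply: le_trans sB; rewrite ler_pM ?exprn_ge0 ?(ltW s0)//.
  by case: k k0 => // k _; rewrite exprS ler_piMr ?exprn_ile1// ltW.
case: tL => tL.
- exists (fun i => s ^+ i) => [i|i j ij]; first exact: exprn_gt0.
  have [iltj|jlti|/val_inj E] := ltngtP i j; last by rewrite E eqxx in ij.
    by rewrite tL// rnorm0 mulr0 mul0r ltW.
  have -> : s ^+ i * rnorm (L i j : R[i]^o) / s ^+ j = s ^+ (i - j) * rnorm (L i j : R[i]^o).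
    by rewrite -{1}(subnK (ltnW jlti)) exprD; field; rewrite expf_neq0// gt_eqF.
  by apply: bound; rewrite ?subn_gt0// rnorm_ge0 LB.
- exists (fun i => s ^- i) => [i|i j ij]; first by rewrite invr_gt0 exprn_gt0.
  have [iltj|jlti|/val_inj E] := ltngtP i j; last by rewrite E eqxx in ij.
    have -> : s ^- i * rnorm (L i j : R[i]^o) / s ^- j = s ^+ (j - i) * rnorm (L i j : R[i]^o).
      by rewrite -{1}(subnK (ltnW iltj)) exprD; field; rewrite !expf_neq0// gt_eqF.
    by apply: bound; rewrite ?subn_gt0// rnorm_ge0 LB.
  by rewrite tL// rnorm0 mulr0 mul0r ltW.
Qed.

(** Polar decomposition of the entries: the moduli scale real and imaginary parts separately, and
    the remaining diagonal matrix of complex units is an isometry of the maximum norm. *)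
Lemma scales_cdiag (d : 'rV[R[i]]_n) : (forall i, d 0 i != 0) ->
  scales lam (mulR (diag_mx d)) (\prod_j ((rnorm (d 0 j : R[i]^o))^-1 * (rnorm (d 0 j : R[i]^o))^-1)).
Proof.
move=> d0; have nd0 j : 0 < rnorm (d 0 j : R[i]^o) by rewrite rnorm_gt0.
have iso (u : 'rV[R[i]]_n) : (forall j, rnorm (u 0 j : R[i]^o) = 1) ->
    forall v : Cvec R n, rnorm (mulR (diag_mx u) v : Cvec R n) <= rnorm v.
  move=> u1 v; apply: rnorm_le => [|j]; first exact: rnorm_ge0.
  have -> : (mulR (diag_mx u) v : Cvec R n) 0 j = (v : Cvec R n) 0 j * u 0 j :> R[i].
    exact: rV_mul_diagE.
  by rewrite rnormM u1 mulr1; exact: coord_rnorm.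
pose u : 'rV[R[i]]_n := \row_j (d 0 j / (rnorm (d 0 j : R[i]^o))%:C).
have u1 j : rnorm (u 0 j : R[i]^o) = 1.
  by rewrite mxE rnormM rnormV rnorm_real gtr0_norm// mulfV// gt_eqF.
have u0 j : u 0 j != 0 by rewrite -(@rnorm_gt0 R R[i]^o) u1.
pose u' : 'rV[R[i]]_n := \row_j (u 0 j)^-1.
have u'1 j : rnorm (u' 0 j : R[i]^o) = 1 by rewrite mxE rnormV u1 invr1.
have uu' : diag_mx u *m diag_mx u' = 1%:M := diag_mxV u0.
have u'u : diag_mx u' *m diag_mx u = 1%:M by rewrite diag_mxC.
have [c sc] := lin_scales_ex uu' u'u.
have c1 := scales_isometry uu' u'u (iso u u1) (iso u' u'1) sc.
have := scales_mul (scales_diag nd0) sc; rewrite c1 mulr1; congr (scales _ (mulR _) _).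
rewrite diag_mulE; congr diag_mx; apply/rowP => j; rewrite !mxE mulrC divfK//.
by rewrite fmorph_eq0 gt_eqF.
Qed.

End det_scaling.

Lemma scales_perm (R : realType) n (s : 'S_n) (c : R) :
  scales (@lamb R n) (mulR (perm_mx s)) c -> c = 1.
Proof.
have iso (t : 'S_n) (v : Cvec R n) : rnorm (mulR (perm_mx t) v : Cvec R n) <= rnorm v.
  apply: rnorm_le => [|j]; first exact: rnorm_ge0.
  have -> : (mulR (perm_mx t) v : Cvec R n) 0 j = (v : Cvec R n) 0 ((t^-1)%g j) :> R[i].
    exact: rV_mul_permE.
  exact: coord_rnorm.
apply: (@scales_isometry R n _ (perm_mx s^-1)) (iso s) (iso (s^-1)%g).
  by rewrite -perm_mxM mulgV perm_mx1.
by rewrite -perm_mxM mulVg perm_mx1.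
Qed.

Lemma rnorm_prod (R : realType) (I : finType) (F : I -> R[i]^o) :
  rnorm (\prod_i F i : R[i]^o) = \prod_i rnorm (F i).
Proof. by elim/big_ind2 : _ => [|a x b y <- <-|//]; [exact: rnorm1|rewrite rnormM]. Qed.

(** In the LUP decomposition the permutation is an isometry of the maximum norm and the lower factor
    is unipotent, so both have factor 1. The upper factor is a diagonal matrix times a unipotent
    one, and only its diagonal counts. *)
Theorem scales_det (R : realType) n (A : 'M[R[i]]_n) : A \in unitmx ->
  scales (@lamb R n) (mulR A) ((rnorm (\det A : R[i]^o))^-1 ^+ 2).
Proof.
case: n A => [|n] A uA.
  have -> : A = 1%:M by apply/matrixP => -[].
  by rewrite det1 rnorm1 invr1 expr1n mulR1; exact: scales_id.
have := cormen_lup_correct A; have := cormen_lup_perm A; have := @cormen_lup_lower _ _ A.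
have := @cormen_lup_upper _ _ A; have := cormen_lup_detL A.
case: (cormen_lup A) => -[P L] U /= detL upU lowL /existsP[s /eqP ->] PA'.
have {PA'} PA : perm_mx s *m A = L *m U by exact: PA'.
have uL : L \in unitmx by rewrite unitmxE detL unitr1.
have uP : (perm_mx s : 'M[R[i]]_n.+1) \in unitmx := unitmx_perm _ s.
have uU : U \in unitmx.
  have : L *m U \in unitmx by rewrite -PA unitmx_mul uP.
  by rewrite unitmx_mul => /andP[].
have detU := upper_det upU.
have U0 i : U i i != 0.
  move: uU; rewrite unitmxE unitfE detU; apply: contraNN => /eqP Ui0.
  by rewrite (bigD1 i)//= Ui0 mul0r.
pose d : 'rV[R[i]]_n.+1 := \row_i U i i.
have d0 i : d 0 i != 0 by rewrite mxE.
pose d' : 'rV[R[i]]_n.+1 := \row_i (d 0 i)^-1.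
have dd' : diag_mx d *m diag_mx d' = 1%:M := diag_mxV d0.
have d'd : diag_mx d' *m diag_mx d = 1%:M by rewrite diag_mxC.
pose U1 := diag_mx d' *m U.
have U1E i j : U1 i j = d' 0 i * U i j by exact: diag_leftE.
have UE : U = diag_mx d *m U1 by rewrite /U1 mulmxA dd' mul1mx.
have uU1 : U1 \in unitmx by move: uU; rewrite UE unitmx_mul => /andP[].
have [aA sA] := lin_scales_ex (mulmxV uA) (mulVmx uA).
have [aP sP] := lin_scales_ex (mulmxV uP) (mulVmx uP).
have [aL sL] := lin_scales_ex (mulmxV uL) (mulVmx uL).
have [aU1 sU1] := lin_scales_ex (mulmxV uU1) (mulVmx uU1).
have aP1 := scales_perm sP.
have aL1 : aL = 1.
  apply: (scales_unipotent (mulmxV uL) (mulVmx uL) _ _ sL) => [i|e e0].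
    by rewrite lowL// eqxx.
  apply: triangular_conj => //; left => i j ij; rewrite lowL ?(ltnW ij)//.
  by case: eqP ij => // ->; rewrite ltnn.
have aU11 : aU1 = 1.
  apply: (scales_unipotent (mulmxV uU1) (mulVmx uU1) _ _ sU1) => [i|e e0].
    by rewrite U1E !mxE mulVf.
  by apply: triangular_conj => //; right => i j ij; rewrite U1E upU// mulr0.
have sU := scales_mul (scales_cdiag d0) sU1; rewrite -UE in sU.
have E : aA = \prod_j ((rnorm (d 0 j : R[i]^o))^-1 * (rnorm (d 0 j : R[i]^o))^-1).
  have := lamb_scales_uniq (scales_mul sP sA) _; rewrite aP1 mul1r; apply.
  have := scales_mul sL sU; rewrite aL1 aU11 mul1r mulr1; congr (scales _ (mulR _) _).
  exact: esym PA.
move: sA; rewrite E; congr (scales _ _ _).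
have detA : rnorm (\det A : R[i]^o) = \prod_j rnorm (d 0 j : R[i]^o).
  have := congr1 (fun B => rnorm (\det B : R[i]^o)) PA; rewrite !det_mulmx !rnormM detL detU rnorm1 mul1r.
  rewrite det_perm; case: (odd_perm s); rewrite ?expr0 ?expr1 ?rnormN rnorm1 mul1r => ->;
  rewrite rnorm_prod; apply: eq_bigr => i _; by rewrite mxE.
rewrite detA -prodfV expr2 -big_split/=; apply: eq_bigr => j _.
by [].
Qed.

(** * Change of variables *)

Lemma integral_indicM d (T : measurableType d) (R : realType) (mu : {measure set T -> \bar R})
    (D : set T) (h : T -> \bar R) :
  (\int[mu]_x ((\1_D x)%:E * h x) = \int[mu]_(x in D) h x)%E.
Proof.
rewrite [RHS]integral_mkcond; apply: eq_integral => x _.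
by rewrite patchE indicE; case: ifP; rewrite (mul1e, mul0e).
Qed.

Lemma indic_eq (T T' : Type) (R : realType) (A : set T) (B : set T') x y :
  A x = B y -> \1_A x = \1_B y :> R.
Proof.
move=> AB; rewrite !indicE; congr (_%:R); congr nat_of_bool.
by apply/idP/idP => /set_mem H; apply/mem_set; [rewrite -AB|rewrite AB].
Qed.

Section comparison.
Context (R : realType) (n : nat).
Local Notation C := (Borel (Cvec R n)).
Local Notation lam := (@lamb R n).

(** The part of [W] on which averaging over discs of radius [r] does not leave [W]. It is closed,
    hence Borel, whatever [W] is. *)
Definition core (W : set (Cvec R n)) (r : R) : set (Cvec R n) :=
  [set y | cdisc y r `<=` W].

Lemma core_closed W r : closed (core W r).
Proof.
rewrite -[core W r]setCK; apply: open_closedC.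
rewrite openE => y /= /existsNP[w /not_implyP[yw nW]].
apply/nbhs_rnormP; exists (r - rnorm (w - y)); first by rewrite subr_gt0.
move=> z; rewrite ltrBrDl => H /= zW; apply/nW/zW; rewrite /cdisc/=.
by apply: le_lt_trans H; rewrite -[w - z](subrKA y) rnormD.
Qed.

Lemma measurable_core W r : measurable (core W r : set C).
Proof.
rewrite -[core W r]setCK; apply: measurableC; apply: sub_sigma_algebra.
exact: (closed_openC (@core_closed W r)).
Qed.

Lemma measurable_near_pairs (B : set C) : measurable B ->
  measurable_fun setT (fun z : C * C => (\1_B ((z.2 : Cvec R n) - z.1))%:E : \bar R).
Proof.
move=> mB; apply/measurable_EFinP; apply: (measurableT_comp (measurable_indic mB)).
apply: measurable_CvecD; first exact: measurable_snd.
exact: (measurableT_comp (@measurable_CvecN R n) measurable_fst).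
Qed.

Variable nu : {measure set C -> \bar R}.
Hypothesis nufin : (nu setT < +oo)%E.

Let nu_sf : sigma_finite setT nu.
Proof. by exists (fun=> setT) => [|_]; rewrite ?bigcup_const. Qed.

(* Averaging over a ball of radius [r]: both sides are, up to the factor
   [lam (cdisc 0 r)], the integral of the indicator of [|x - y| < r, x \in W]
   against [nu (dy) lam (dx)]. *)
Lemma core_le (W : set (Cvec R n)) (h : Cvec R n -> R) (r : R) : 0 < r -> open W ->
  measurable_fun (W : set C) (h : C -> R) -> (forall x, W x -> 0 <= h x) ->
  (forall x, W x -> nu (cdisc x r) <= (h x)%:E * lam (cdisc 0 r))%E ->
  (nu (core W r) <= \int[lam]_(x in W) (h x)%:E)%E.
Proof.
move=> r0 oW mh h0 H.
have mW : measurable (W : set C) by exact: sub_sigma_algebra.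
pose B : set C := cdisc 0 r; have mB : measurable B by exact: measurable_cdisc.
have B0 : (0 < lam B)%E by exact: lamb_cdisc_gt0.
have Bf : lam B \is a fin_num by rewrite ge0_fin_numE ?ltW//; exact: lamb_cdisc_fin.
have B0' : 0 < fine (lam B) by rewrite fine_gt0// B0/= lamb_cdisc_fin.
pose nus := sigma_finite_of nu_sf.
pose F (z : C * C) : \bar R := ((\1_W z.2)%:E * (\1_B ((z.2 : Cvec R n) - z.1))%:E)%E.
have mF : measurable_fun setT F.
  apply: emeasurable_funM; last exact: measurable_near_pairs.
  by apply/measurable_EFinP; exact: (measurableT_comp (measurable_indic mW) measurable_snd).
have F0 z : (0 <= F z)%E by rewrite mule_ge0// lee_fin.
have indB (x y : Cvec R n) : \1_B (x - y) = \1_(cdisc y r : set C) x :> R.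
  by apply: indic_eq; rewrite /B /cdisc/= subr0.
have indB' (x y : Cvec R n) : \1_B (x - y) = \1_(cdisc x r : set C) y :> R.
  by apply: indic_eq; rewrite /B /cdisc/= subr0 rnorm_dist.
have lower : (lam B * nu (core W r) <= \int[nus]_y \int[lambs R n]_x F (y, x))%E.
  have -> : (nu (core W r) = \int[nus]_y (\1_(core W r : set C) y)%:E)%E.
    by rewrite (integral_indic nus measurableT (measurable_core W r)) setIT.
  rewrite -ge0_integralZl//; last by apply/measurable_EFinP; exact: measurable_indic (measurable_core W r).
  apply: ge0_le_integral => //.
  - apply: emeasurable_funM => //; apply/measurable_EFinP.
    exact: measurable_indic (measurable_core W r).
  - exact: (measurable_fun_fubini_tonelli_F F mF F0).
  - move=> y _; rewrite indicE; case: (boolP (y \in core W r)) => [|_]; last first.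
      by rewrite mule0; apply: integral_ge0 => x _; exact: F0.
    move=> /set_mem yW; rewrite mule1 /F/=.
    rewrite (integral_indicM (lambs R n)).
    rewrite (eq_integral (fun x : C => (\1_(cdisc y r : set C) x)%:E)); last first.
      by move=> x _; rewrite indB.
    rewrite integral_indic//; last exact: measurable_cdisc.
    rewrite setIidl// le_eqVlt; apply/orP; left; apply/eqP.
    exact: (esym (@lamb_cdisc R n y r)).
have upper : (\int[lambs R n]_x \int[nus]_y F (y, x) <= lam B * \int[lam]_(x in W) (h x)%:E)%E.
  have mhE : measurable_fun (W : set C) (fun x => (h x)%:E) by apply/measurable_EFinP.
  rewrite -ge0_integralZl//.
  rewrite -integral_indicM; apply: ge0_le_integral => //.
  - by move=> x _; apply: integral_ge0 => y _; exact: F0.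
  - exact: (measurable_fun_fubini_tonelli_G F mF F0).
  - rewrite (_ : (fun x => _) = (fun x => lam B * (h x)%:E)%E \_ W).
      by apply/(measurable_restrictT _ _).1 => //; exact: measurable_funeM.
    by apply/funext => x; rewrite patchE indicE; case: ifP; rewrite (mul1e, mul0e).
  - move=> x _; rewrite /F/=; rewrite indicE; case: (boolP (x \in (W : set C))) => [|_]; last first.
      by rewrite mul0e integral0_eq// => y _; rewrite mul0e.
    move=> /set_mem Wx; under eq_integral do rewrite mul1e indB'.
    rewrite integral_indic//; last exact: measurable_cdisc.
    by rewrite setIT mul1e muleC; exact: H.
have := le_trans lower (le_trans _ upper).
rewrite (fubini_tonelli F mF F0) => /(_ (lexx _)).
rewrite -(fineK Bf) lee_pmul2l//.
Qed.

Lemma core_homo (W : set (Cvec R n)) : {homo core W : r s / s <= r >-> r `<=` s}.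
Proof. by move=> r s sr y /= yr z ys; apply: yr; exact: lt_le_trans ys sr. Qed.

(** Compactness of [K] makes the local density bound uniform, so [core_le] holds for all small
    radii. The cores increase to [W] as the radius decreases, and the error [e] is harmless because
    [lam W] is finite. *)
Lemma compare_le (W K : set (Cvec R n)) (g : Cvec R n -> R) :
  open W -> W `<=` K -> compact K -> (lam W < +oo)%E ->
  (forall x, K x -> {for x, continuous g}) -> (forall x, K x -> 0 <= g x) ->
  (forall x, K x -> forall e : R, 0 < e -> exists2 d : R, 0 < d &
     forall c, rnorm (x - c) < d -> forall r, 0 < r < d ->
       (nu (cdisc c r) <= (g x + e)%:E * lam (cdisc 0 r))%E) ->
  (nu W <= \int[lam]_(x in W) (g x)%:E)%E.
Proof.
move=> oW WK cK Wfin gc g0 loc.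
have mW : measurable (W : set C) by exact: sub_sigma_algebra.
have mg : measurable_fun (W : set C) (fun x => (g x)%:E).
  by apply/measurable_EFinP; apply: (open_continuous_borelR oW) => x /set_mem/WK; exact: gc.
(* One [e] is the slack of the local bound at [x]; the other pays for replacing [g x] by the value
   of [g] at a nearby centre. *)
have main (e : R) : 0 < e -> (nu W <= \int[lam]_(x in W) (g x + (e + e))%:E)%E.
  move=> e0; pose r (k : nat) : R := k.+1%:R^-1.
  have r0 k : 0 < r k by rewrite invr_gt0.
  have mh : measurable_fun (W : set C) ((fun x => g x + (e + e)) : C -> R).
    by apply: measurable_funD => //; apply/measurable_EFinP.
  have [N _ HN] : \forall k \near \oo, forall x, K x ->
      (nu (cdisc x (r k)) <= (g x + (e + e))%:E * lam (cdisc 0 (r k)))%E.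
    apply: (compact_near_coveringP K).1 cK _ _ _ _ _ => x Kx.
    have [d d0 xd] := loc x Kx e e0.
    have [d' d'0 xd'] := (rnorm_continuousR g x).1 (gc x Kx) e e0.
    exists ([set y | rnorm (x - y) < Num.min d d'], [set k | r k < d]).
      split=> /=; last exact: (near_infty_natSinv_lt (PosNum d0)).
      by apply/nbhs_rnormP; exists (Num.min d d'); rewrite ?lt_min ?d0.
    move=> [y k]/= [+ rd]; rewrite lt_min => /andP[yd yd'].
    apply: le_trans (xd y yd (r k) _) _; first by rewrite r0.
    rewrite lee_wpmul2r// lee_fin addrA lerD2r.
    by have := xd' y yd'; rewrite ltr_distl => /andP[_ /ltW].
  have WE : W = \bigcup_k core W (r (N + k)%N).
    apply/seteqP; split=> [x Wx|x [k _]]; last by apply; rewrite /cdisc/= subrr rnorm0.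
    have /nbhs_rnormP[d d0 xd] : nbhs x W by exact: open_nbhs_nbhs.
    have [m _ /(_ m (leqnn _)) rm] := near_infty_natSinv_lt (PosNum d0).
    exists m => // y; rewrite /cdisc/= => yx; apply: xd; rewrite rnorm_dist.
    apply: lt_trans yx _; apply: le_lt_trans rm.
    by rewrite lef_pV2 ?posrE// ler_nat ltnS leq_addl.
  have cv : (nu \o (fun k => core W (r (N + k)%N))) k @[k --> \oo] --> nu W.
    rewrite [X in nu X]WE; apply: nondecreasing_cvg_mu.
    - by move=> k; exact: measurable_core.
    - by apply: bigcupT_measurable => k; exact: measurable_core.
    - move=> i j ij; apply/subsetPset; apply: core_homo.
      by rewrite lef_pV2 ?posrE// ler_nat ltnS leq_add2l.
  rewrite -(cvg_lim (@ereal_hausdorff R) cv); apply: lime_le; first exact: cvgP cv.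
  near=> k; apply: core_le => //.
  - by move=> x /WK Kx; apply: addr_ge0; [exact: g0|rewrite ltW// addr_gt0].
  - by move=> x /WK Kx; apply: HN => //=; exact: leq_addr.
apply/lee_addgt0Pr => e e0.
have Wf : lam W \is a fin_num by rewrite ge0_fin_numE.
pose w := fine (lam W); have w0 : 0 <= w by exact: fine_ge0.
pose e' := e / (w + 1) / 2.
have e'0 : 0 < e' by rewrite !divr_gt0// ltr_wpDl.
apply: le_trans (main e' e'0) _.
under eq_integral do rewrite EFinD.
rewrite ge0_integralD//; last first.
- by move=> x _; rewrite lee_fin addr_ge0 ?ltW.
- by move=> x /WK Kx; rewrite lee_fin g0.
rewrite leeD2l// integral_cst// -(fineK Wf) -EFinM lee_fin -/w.
rewrite /e' -splitr mulrAC ler_pdivrMr ?ltr_wpDl//.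
by rewrite ler_pM2l// lerDl.
Unshelve. all: by end_near. Qed.

End comparison.

(** * Jacobians of compositions and inverses *)

Section calculus.
Context (R : realType).

Lemma lin1_mx_comp (K : pzRingType) n m p (f : {linear 'rV[K]_n -> 'rV[K]_m})
    (g : {linear 'rV[K]_m -> 'rV[K]_p}) (h : 'rV[K]_n -> 'rV[K]_p) :
  h =1 g \o f -> lin1_mx h = lin1_mx f *m lin1_mx g.
Proof.
move=> hE; apply/row_matrixP => i; rewrite row_mul rowE.
have -> : row i (lin1_mx f) = f 'e_i by rewrite rowE mul_rV_lin1.
by rewrite mul_rV_lin1/=; apply/rowP => j; rewrite -rowE !mxE hE.
Qed.

Lemma lin1_mx_eq (K : pzRingType) n m (f g : 'rV[K]_n -> 'rV[K]_m) :
  f =1 g -> lin1_mx f = lin1_mx g.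
Proof. by move=> fE; apply/matrixP => i j; rewrite !mxE fE. Qed.

Lemma lin1_mx_id (K : pzRingType) n (f : 'rV[K]_n -> 'rV[K]_n) :
  f =1 id -> lin1_mx f = 1%:M.
Proof.
by move=> fE; apply/matrixP => i j; rewrite !mxE fE mxE eq_sym.
Qed.

Lemma diff_near_eq (K : numFieldType) (V W : normedModType K) (f g : V -> W) (x : V) :
  differentiable f x -> differentiable g x -> (\forall y \near x, f y = g y) ->
  forall v, 'd f x v = 'd g x v.
Proof.
move=> df dg fg v.
transitivity ('D_v f x); first by rewrite deriveE.
by rewrite (near_eq_derive v fg) deriveE.
Qed.

Lemma jacobian_near_eq (K : numFieldType) n m (T S : 'rV[K]_n -> 'rV[K]_m) x :
  differentiable T x -> differentiable S x ->
  (\forall y \near x, T y = S y) -> jacobian T x = jacobian S x.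
Proof. by move=> dT dS /(diff_near_eq dT dS); exact: lin1_mx_eq. Qed.

Lemma jacobian_comp (K : numFieldType) n m p (T : 'rV[K]_n -> 'rV[K]_m)
    (S : 'rV[K]_m -> 'rV[K]_p) x :
  differentiable T x -> differentiable S (T x) ->
  jacobian (S \o T) x = jacobian T x *m jacobian S (T x).
Proof. by move=> dT dS; apply: lin1_mx_comp => v; rewrite diff_comp. Qed.

Lemma jacobian_id (K : numFieldType) n (T : 'rV[K]_n -> 'rV[K]_n) x :
  differentiable T x -> (\forall y \near x, T y = y) -> jacobian T x = 1%:M.
Proof.
move=> dT Tid; have did : differentiable (id : 'rV[K]_n -> 'rV[K]_n) x by [].
by rewrite (jacobian_near_eq dT did Tid); apply: lin1_mx_id => v; rewrite diff_val.
Qed.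

Lemma jacobian_inv (K : numFieldType) n (T S : 'rV[K]_n -> 'rV[K]_n) x :
  differentiable T x -> differentiable S (T x) -> (\forall y \near x, S (T y) = y) ->
  jacobian T x *m jacobian S (T x) = 1%:M.
Proof.
move=> dT dS ST; rewrite -jacobian_comp//; apply: jacobian_id => //.
exact: differentiable_comp.
Qed.

(** [U] has to agree with the composition only near [x], which is how transition maps compose. *)
Lemma jac2_comp n (T S U : Cvec R n -> Cvec R n) x :
  differentiable T x -> differentiable S (T x) ->
  differentiable U x -> (\forall y \near x, U y = S (T y)) ->
  jac2 U x = jac2 S (T x) * jac2 T x.
Proof.
move=> dT dS dU UE.
have J := etrans (jacobian_near_eq dU (differentiable_comp dT dS) UE) (jacobian_comp dT dS).
have D : \det (jacobian U x) = \det (jacobian T x) * \det (jacobian S (T x)) :> R[i]^o.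
  exact: etrans (congr1 (@determinant _ n) J) (det_mulmx _ _).
transitivity (rnorm (\det (jacobian T x) * \det (jacobian S (T x)) : R[i]^o) ^+ 2).
  refine (congr1 (fun z : R[i]^o => rnorm z ^+ 2) D).
by rewrite rnormM exprMn; exact: mulrC.
Qed.

Lemma jac2_inv n (T S : Cvec R n -> Cvec R n) x :
  differentiable T x -> differentiable S (T x) -> (\forall y \near x, S (T y) = y) ->
  jac2 S (T x) * jac2 T x = 1.
Proof.
move=> dT dS ST.
have D : \det (jacobian T x) * \det (jacobian S (T x)) = 1 :> R[i]^o.
  exact: etrans (esym (det_mulmx _ _))
    (etrans (congr1 (@determinant _ n) (jacobian_inv dT dS ST)) (det1 _ n)).
transitivity (rnorm (\det (jacobian T x) * \det (jacobian S (T x)) : R[i]^o) ^+ 2).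
  by rewrite rnormM exprMn; exact: mulrC.
transitivity (rnorm (1 : R[i]^o) ^+ 2); last by rewrite rnorm1 expr1n.
refine (congr1 (fun z : R[i]^o => rnorm z ^+ 2) D).
Qed.

End calculus.

Section compactness.
Context (R : realType) (n : nat).
Implicit Types (v w : Cvec R n) (r : R).

Definition ccdisc v r : set (Cvec R n) := [set w | rnorm (w - v) <= r].

Lemma ccdisc_closed v r : closed (ccdisc v r).
Proof.
rewrite -[ccdisc v r]setCK; apply: open_closedC.
rewrite openE => w /= /negP; rewrite -ltNge => rw.
apply/nbhs_rnormP; exists (rnorm (w - v) - r); first by rewrite subr_gt0.
move=> z; rewrite ltrBrDl -ltrBrDr => H /=; apply/negP; rewrite -ltNge.
apply: lt_le_trans H _; rewrite lerBlDr [leRHS]addrC.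
by rewrite -[w - v](subrKA z) rnormD.
Qed.

Lemma compact_ccdisc v r : compact (ccdisc v r).
Proof.
pose s := r + rnorm v.
pose sq : set R[i]^o := (fun p : R * R => p.1 +i* p.2 : R[i]^o) @` (`[- s, s] `*` `[- s, s]).
have csq : compact sq.
  apply: continuous_compact; last by apply: compact_setX; exact: segment_compact.
  apply: continuous_subspaceT => -[a b] A /nbhs_rnormP[e e0 eA].
  apply/nbhs_ballP; exists (e / 2); first by rewrite /= divr_gt0.
  move=> [c d] [/= ac bd]; apply: eA.
  have : rnorm (a +i* b - c +i* d : R[i]^o) <= `|a - c| + `|b - d| by exact: rnorm_le_ReIm.
  by move/le_lt_trans; apply; rewrite (splitr e) ltrD.
apply: (subclosed_compact (@ccdisc_closed v r)
  (@rV_compact R[i]^o n (fun=> sq) (fun=> csq))) => w /= wv j.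
exists (complex.Re (w 0 j), complex.Im (w 0 j)); last by case: (w _ _).
have ws : rnorm (w 0 j : R[i]^o) <= s.
  apply: le_trans (coord_rnorm _ _) _; rewrite -[w](subrK v).
  by apply: le_trans (rnormD _ _) _; rewrite lerD2r.
by split; rewrite /= in_itv/= -ler_norml; apply: le_trans ws; [exact: rnorm_Re|exact: rnorm_Im].
Qed.

Lemma compact_in_cdisc (K : set (Cvec R n)) : compact K -> exists r, K `<=` cdisc 0 r.
Proof.
move=> cK; have [N _ NK] : \forall k \near \oo, forall x, K x -> rnorm x < k%:R.
  apply: (compact_near_coveringP K).1 cK _ _ _ _ _ => x Kx.
  have [m xm] : exists m : nat, rnorm x + 1 < m%:R.
    by exists (Num.truncn (rnorm x + 1)).+1; exact: truncnS_gt.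
  exists ([set y | rnorm (x - y) < 1], [set k | (m <= k)%N]).
    by split=> /=; [apply/nbhs_rnormP; exists 1|exists m].
  move=> [y k]/= [xy mk]; apply: lt_le_trans (_ : m%:R <= _); last by rewrite ler_nat.
  apply: le_lt_trans xm; have -> : y = x + (y - x) by rewrite addrC subrK.
  by apply: le_trans (rnormD _ _) _; rewrite lerD2l rnorm_dist ltW.
by exists N%:R => x Kx; rewrite /cdisc/= subr0; exact: (NK N (leqnn N) x Kx).
Qed.

End compactness.

Section density_measure.
Context d (T : measurableType d) (R : realType) (mu : {measure set T -> \bar R}).
Variables (f : T -> \bar R).
Hypotheses (mf : measurable_fun setT f) (f0 : forall x, (0 <= f x)%E).

Definition density_measure_def of measurable_fun setT f & (forall x, (0 <= f x)%E) :=
  fun A : set T => (\int[mu]_(x in A) f x)%E.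

Local Notation nu := (density_measure_def mf f0).

Let nu0 : nu set0 = 0%E.
Proof. exact: integral_set0. Qed.

Let nu_ge0 A : (0 <= nu A)%E.
Proof. exact: integral_ge0. Qed.

Let nu_sigma_additive : semi_sigma_additive nu.
Proof. exact: semi_sigma_additive_nng_induced. Qed.

HB.instance Definition _ := isMeasure.Build _ _ _ nu nu0 nu_ge0 nu_sigma_additive.

Definition density_measure : {measure set T -> \bar R} := nu.

End density_measure.

(** By Bernoulli, [(1 + u) ^+ m * (1 - m u)] is at most [(1 - u ^+ 2) ^+ m <= 1], and [u] is chosen
    such that [1 - m u >= 1 / (1 + s)]. *)
Lemma expr_near1 (R : realType) m (s : R) : 0 < s -> exists2 u : R, 0 < u & (1 + u) ^+ m <= 1 + s.
Proof.
move=> s0; have s1 : 0 < 1 + s by rewrite addr_gt0.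
pose u := s / (1 + s) / m.+1%:R.
have u0 : 0 < u by rewrite !divr_gt0.
have mu : m%:R * u <= s / (1 + s).
  by rewrite mulrC /u mulrAC ler_pdivrMr//; apply: ler_wpM2l; rewrite ?ler_nat// divr_ge0// ltW.
have u1 : u <= 1.
  rewrite /u ler_pdivrMr// mul1r (@le_trans _ _ 1)//; last by rewrite ler1n.
  by rewrite ler_pdivrMr// mul1r lerDr.
exists u => //; have P0 : 0 <= (1 + u) ^+ m by rewrite exprn_ge0// addr_ge0// ltW.
have H : (1 + u) ^+ m * (1 - m%:R * u) <= 1.
  apply: (@le_trans _ _ ((1 + u) ^+ m * (1 - u) ^+ m)).
    by apply: ler_wpM2l => //; apply: bernoulli_le; rewrite (ltW u0).
  by rewrite -exprMn exprn_ile1//; nra.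
rewrite -[leLHS]mulr1 -[X in _ * X <= _](@mulVf _ (1 + s)) ?gt_eqF// mulrA.
rewrite -[leRHS]mul1r; apply: ler_wpM2r; [exact: ltW|apply: le_trans H].
apply: ler_wpM2l => //; apply: (@le_trans _ _ (1 - s / (1 + s))); last by rewrite lerD2l lerN2.
by rewrite -[X in _ <= X - _](@mulfV _ (1 + s)) ?gt_eqF// -mulrBl addrK mul1r.
Qed.

Lemma compact_ub (T : topologicalType) (R : realType) (K : set T) (f : T -> R) :
  compact K -> (forall x, K x -> {for x, continuous f}) ->
  exists2 b : R, 0 < b & forall x, K x -> f x <= b.
Proof.
move=> cK cf; have [N _ NK] : \forall k \near \oo, forall x, K x -> f x < k%:R.
  apply: (compact_near_coveringP K).1 cK _ _ _ _ _ => x Kx.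
  have [m xm] : exists m : nat, f x + 1 < m%:R.
    by exists (Num.truncn (f x + 1)).+1; exact: truncnS_gt.
  exists ([set y | `|f x - f y| < 1], [set k | (m <= k)%N]).
    by split=> /=; [exact: (cf x Kx _ (nbhsx_ballx (f x) 1 ltr01))|exists m].
  move=> [y k]/= [xy mk]; apply: lt_le_trans (_ : m%:R <= _); last by rewrite ler_nat.
  apply: le_lt_trans xm; move: xy; rewrite ltr_norml => /andP[+ _].
  by rewrite ltrBrDl => /ltW; lra.
exists N.+1%:R => // x Kx; apply: le_trans (ltW (NK N (leqnn N) x Kx)) _.
by rewrite ler_nat.
Qed.

Lemma diffEjacobian (K : numFieldType) n m (f : 'rV[K]_n -> 'rV[K]_m) a v :
  'd f a v = v *m jacobian f a.
Proof. by rewrite /jacobian mul_rV_lin1. Qed.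

(** * The local inequality for biholomorphic maps *)

Section change_of_variables.
Context (R : realType) (n : nat).
Local Notation C := (Borel (Cvec R n)).
Local Notation lam := (@lamb R n).

Lemma mulR_disc (L M : 'M[R[i]]_n) (v : Cvec R n) (r : R) : M *m L = 1%:M -> 0 < r ->
  lam [set w : C | rnorm (mulR M ((w : Cvec R n) - v) : Cvec R n) < r] =
  (((rnorm (\det M : R[i]^o))^-1 ^+ 2 * (r ^+ n) ^+ 2)%:E * lam (cdisc 0 1))%E.
Proof.
move=> ML r0; have uM : M \in unitmx by case/mulmx1_unit: ML.
have [_ _ H] := scales_comp (scales_lamb_shift (- v)) (scales_det uM).
have := H _ (measurable_cdisc 0 r).
rewrite mul1r (@lamb_cdisc_scale _ n _ r0) muleA -EFinM => <-.
by congr (lam _); apply/seteqP; split => w /=; rewrite /cdisc/= subr0.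
Qed.

Lemma mulR_err (L M : 'M[R[i]]_n) (q b : Cvec R n) : L *m M = 1%:M ->
  mulR M (q + mulR L b : Cvec R n) = (mulR M q : Cvec R n) + b.
Proof.
move=> LM; have E : mulR M (mulR L b) = b by exact: (etrans (esym (mulmxA _ _ _)) (etrans (congr1 _ LM) (mulmx1 _))).
exact: (etrans (mulRD M q (mulR L b)) (congr1 (fun v : Cvec R n => (mulR M q : Cvec R n) + v) E)).
Qed.

Definition biholomorphic (O O' : set (Cvec R n)) (T S : Cvec R n -> Cvec R n) :=
  [/\ open O, open O',
    forall x, O x -> [/\ O' (T x), S (T x) = x & differentiable T x] &
    forall y, O' y -> [/\ O (S y), T (S y) = y & differentiable S y]].

Lemma biholomorphic_sym O O' T S : biholomorphic O O' T S -> biholomorphic O' O S T.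
Proof. by case. Qed.

Lemma biholomorphic_continuous O O' T S : biholomorphic O O' T S -> {in O, continuous T}.
Proof.
by move=> [_ _ OO _] x /set_mem/OO[_ _]; exact: differentiable_continuous.
Qed.

Lemma biholomorphic_jacobian O O' T S x : biholomorphic O O' T S -> O x ->
  jacobian T x *m jacobian S (T x) = 1%:M /\ jac2 S (T x) * jac2 T x = 1.
Proof.
move=> [oO oO' OO' O'O] Ox; have [TO ST dT] := OO' _ Ox; have [_ _ dS] := O'O _ TO.
have id_near : \forall y \near x, S (T y) = y.
  near=> y; have Oy : O y by near: y; exact: open_nbhs_nbhs.
  by have [_ + _] := OO' y Oy.
split; first exact: jacobian_inv dT dS id_near.
exact: jac2_inv dT dS id_near.
Unshelve. all: by end_near. Qed.

Lemma diff_mulR (T : Cvec R n -> Cvec R n) x v :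
  'd T x v = mulR (jacobian T x) v.
Proof. exact: diffEjacobian. Qed.

(* By strict differentiability the image of [cdisc c r] lies in a translate of the
   image of a slightly larger disc under the differential at [x]. *)
Lemma cov_local_le O O' T S (g' : Cvec R n -> R) x (e : R) : biholomorphic O O' T S ->
  {in O', continuous g'} -> (forall y, O' y -> 0 <= g' y) -> O x -> 0 < e ->
  exists2 d : R, 0 < d & forall c, rnorm (x - c) < d -> forall r, 0 < r < d ->
    (\int[lam]_(y in (O' `&` S @^-1` (cdisc c r))) (g' y)%:E <=
       (g' (T x) * jac2 T x + e)%:E * lam (cdisc 0 r))%E.
Proof.
move=> bT g'c g'0 Ox e0; have [oO oO' OO' O'O] := bT; have [TO ST dT] := OO' _ Ox.
have [LM JJ] := biholomorphic_jacobian bT Ox.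
set L := jacobian T x in LM; set M := jacobian S (T x) in LM; set J := jac2 T x in JJ *.
have J0 : 0 < J.
  by rewrite lt_neqAle jac2_ge0 andbT; apply/eqP => J0; move: JJ; rewrite -J0 mulr0 => /eqP; rewrite eq_sym oner_eq0.
have ML : M *m L = 1%:M by exact: mulmx1C.
have [k k0 Mk] := mulmx_bounded (M : 'M[R[i]]_n).
set G := g' (T x); have G0 : 0 <= G by exact: g'0.
(* The density varies by at most [e / (2 * J)], which turns [G * J] into [G * J + e / 2]. Enlarging
   the radius by the factor [1 + u] then costs at most the factor [1 + a], which leads to
   [G * J + e]. *)
pose a := (G * J + e) / (G * J + e / 2) - 1.
have B0 : 0 < G * J + e / 2 by rewrite ltr_wpDl ?divr_gt0// mulr_ge0// ltW.
have a0 : 0 < a by rewrite subr_gt0 ltr_pdivlMr// mul1r ltrD2l gtr_pMr// invf_lt1// ltr1n.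
have [u u0 ua] := expr_near1 (n * 2) a0.
have /nbhs_rnormP[r0 r00 Or0] : nbhs x O by exact: open_nbhs_nbhs.
have dTr0 (y : Cvec R n) : rnorm (y - x) < r0 -> differentiable T y.
  by rewrite rnorm_dist => /Or0/OO'[].
(* [M] enlarges norms at most by [k], so the tolerance [u / k] becomes [u] once [M] is applied. *)
have [d1 d10 sT] := strictly_differentiable r00 dTr0 (divr_gt0 u0 k0).
have gTc : {for x, continuous (g' \o T)}.
  apply: continuous_comp; first exact: differentiable_continuous.
  by apply: g'c; exact/mem_set.
have [d2 d20 gT] := (rnorm_continuousR _ _).1 gTc _ (divr_gt0 e0 (mulr_gt0 (ltr0n R 2) J0)).
pose d := Num.min r0 (Num.min d1 d2) / 2.
have d0 : 0 < d by rewrite divr_gt0// !lt_min r00 d10.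
exists d => // c xc r /andP[rpos rd].
have near_x z : cdisc c r z -> [/\ rnorm (x - z) < r0, rnorm (z - x) < d1 & rnorm (x - z) < d2].
  rewrite /cdisc/= => zc; have : rnorm (x - z) < Num.min r0 (Num.min d1 d2).
    have -> : x - z = (x - c) + (c - z) by rewrite addrA subrK.
    apply: le_lt_trans (rnormD _ _) _; rewrite [ltRHS]splitr ltrD//.
    by rewrite rnorm_dist; exact: lt_trans zc rd.
  by rewrite !lt_min => /and3P[? ? ?]; split=> //; rewrite rnorm_dist.
have cc : cdisc c r c by rewrite /cdisc/= subrr rnorm0.
pose A : set C := O' `&` S @^-1` (cdisc c r).
have oA : open (A : set (Cvec R n)).
  have Sc := biholomorphic_continuous (biholomorphic_sym bT).
  exact: (open_preimage_in oO' Sc (@cdisc_open _ _ c r)).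
have mA : measurable A by exact: sub_sigma_algebra.
pose r' := (1 + u) * r; have r'0 : 0 < r' by rewrite mulr_gt0// addr_gt0.
pose D : set C := [set w : C | rnorm (mulR (M : 'M[R[i]]_n) ((w : Cvec R n) - T c) : Cvec R n) < r'].
have mD : measurable D.
  have mf : measurable_fun setT (fun w : C => mulR (M : 'M[R[i]]_n) ((w : Cvec R n) - T c)).
    exact: (measurableT_comp (measurable_mulR M) (measurable_shift (- T c))).
  have := measurable_preimageT mf (measurable_cdisc 0 r').
  by congr (measurable _); apply/seteqP; split => w /=; rewrite /cdisc/= subr0.
have AD : A `<=` D.
  move=> w [wO Sw]; have [_ TSw _] := O'O _ wO.
  have [_ zd _] := near_x _ Sw; have [_ cd _] := near_x _ cc.
  have := sT _ _ cd zd; rewrite TSw diff_mulR -/L.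
  set z := S w in Sw zd *; set q := _ - mulR L _ => qle.
  change (rnorm (mulR (M : 'M[R[i]]_n) ((w : Cvec R n) - T c) : Cvec R n) < r').
  have -> : ((w : Cvec R n) - T c : Cvec R n) = q + mulR (L : 'M[R[i]]_n) (z - c) by rewrite subrK.
  rewrite (mulR_err q (z - c) LM).
  apply: le_lt_trans (rnormD _ _) _; rewrite /r' mulrDl mul1r addrC.
  apply: ltr_leD => //; apply: le_trans (Mk q) _.
  rewrite -ler_pdivlMl//; apply: le_trans qle _.
  by rewrite mulrA [k^-1 * _]mulrC ler_wpM2l// ?divr_ge0 ?ltW.
have gA w : A w -> g' w <= G + e / (2 * J).
  move=> [wO Sw]; have [_ TSw _] := O'O _ wO; have [_ _ zd] := near_x _ Sw.
  by have := gT _ zd; rewrite /= TSw ltr_distl -/G => /andP[/ltW]; rewrite lerBlDr.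
have mg' : measurable_fun A (fun y => (g' y)%:E).
  apply/measurable_EFinP; apply: (open_continuous_borelR oA) => y /set_mem[yO _].
  by apply: g'c; exact/mem_set.
have b0 : 0 <= G + e / (2 * J) by rewrite addr_ge0// divr_ge0 ?ltW// mulr_gt0.
apply: (@le_trans _ _ (\int[lam]_(y in A) (G + e / (2 * J))%:E)%E).
  by apply: ge0_le_integral => // y [yO _]; rewrite lee_fin g'0.
rewrite integral_cst//.
apply: (@le_trans _ _ ((G + e / (2 * J))%:E * lam D)%E).
  by rewrite lee_wpmul2l// ?lee_fin//; exact: measure_leS.
rewrite (mulR_disc (T c) ML r'0) (@lamb_cdisc_scale _ n _ rpos) !muleA -!EFinM.
rewrite lee_wpmul2r// lee_fin.
have -> : (rnorm (\det (M : 'M[R[i]]_n) : R[i]^o))^-1 ^+ 2 = J.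
  rewrite exprVn -[X in X^-1]/(jac2 S (T x)).
  by apply: (@mulrI _ (jac2 S (T x))); rewrite ?JJ ?mulfV ?unitfE//;
    apply/eqP => J'0; move: JJ; rewrite J'0 mul0r => /eqP; rewrite eq_sym oner_eq0.
rewrite /r' -!exprM exprMn.
have -> : (G + e / (2 * J)) * (J * ((1 + u) ^+ (n * 2) * r ^+ (n * 2))) =
    ((G * J + e / 2) * (1 + u) ^+ (n * 2)) * r ^+ (n * 2).
  by field; rewrite gt_eqF.
apply: ler_wpM2r; first by rewrite exprn_ge0// ltW.
apply: le_trans (ler_wpM2l (ltW B0) ua) _.
by rewrite /a [1 + _]addrC subrK mulrC divfK// gt_eqF.
Qed.

End change_of_variables.

Lemma continuous_inS (T U : topologicalType) (A B : set T) (f : T -> U) :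
  A `<=` B -> {in B, continuous f} -> {in A, continuous f}.
Proof. by move=> AB fc x /set_mem Ax; exact: (fc x (mem_set (AB x Ax))). Qed.

Lemma compact_image_in (T U : topologicalType) (O K : set T) (f : T -> U) :
  {in O, continuous f} -> K `<=` O -> compact K -> compact (f @` K).
Proof.
move=> fc KO cK; apply: continuous_compact cK; apply: continuous_in_subspaceT.
exact: continuous_inS fc.
Qed.

(** * From the local inequality to an equality of measures *)

Section cov_measure.
Context (R : realType) (n : nat).
Local Notation C := (Borel (Cvec R n)).
Local Notation lam := (@lamb R n).

Lemma measurable_cont_on (D : set (Cvec R n)) (g : Cvec R n -> R) : open D ->
  {in D, continuous g} -> measurable_fun (D : set C) (fun x : C => (g x)%:E).
Proof. by move=> oD gc; apply/measurable_EFinP; exact: (open_continuous_borelR oD gc). Qed.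

Lemma cov_continuous O O' T S (g' : Cvec R n -> R) : biholomorphic O O' T S ->
  {in O', continuous g'} -> {in O, continuous (fun x => g' (T x) * jac2 T x)}.
Proof.
move=> [oO oO' OO' OO] g'c x /set_mem Ox; have [TO _ dT] := OO' _ Ox.
apply: continuousM.
  apply: continuous_comp; first exact: differentiable_continuous.
  by apply: g'c; exact/mem_set.
apply: jac2_continuous; near=> y; have Oy : O y by near: y; exact: open_nbhs_nbhs.
by have [] := OO' y Oy.
Unshelve. all: by end_near. Qed.

Lemma cov_le O O' T S (g' : Cvec R n -> R) (W K : set (Cvec R n)) :
  biholomorphic O O' T S -> {in O', continuous g'} -> (forall y, O' y -> 0 <= g' y) ->
  open W -> W `<=` K -> K `<=` O -> compact K -> (lam W < +oo)%E ->
  (\int[lam]_(y in (O' `&` S @^-1` W)) (g' y)%:E <=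
    \int[lam]_(x in W) (g' (T x) * jac2 T x)%:E)%E.
Proof.
move=> bT g'c g'0 oW WK KO cK Wfin; have [oO oO' OO' OO] := bT.
have gc := cov_continuous bT g'c.
have Sc := biholomorphic_continuous (biholomorphic_sym bT).
pose W' : set C := O' `&` S @^-1` W.
have oW' : open (W' : set (Cvec R n)) by exact: (open_preimage_in oO' Sc oW).
have mW' : measurable W' by exact: sub_sigma_algebra.
have W'O : W' `<=` O' by move=> y [].
have mS : measurable_fun W' (S : C -> C).
  exact: (open_continuous_borel oW' (continuous_inS W'O Sc)).
pose f : C -> \bar R := (fun y => (g' y)%:E) \_ W'.
have mg' (A : set C) : open (A : set (Cvec R n)) -> A `<=` O' -> measurable_fun A (fun y : C => (g' y)%:E).
  by move=> oA AO; exact: (measurable_cont_on oA (continuous_inS AO g'c)).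
have mf : measurable_fun setT f.
  exact: ((measurable_restrictT _ mW').1 (mg' W' oW' W'O)).
have f0 y : (0 <= f y)%E.
  by rewrite /f patchE; case: ifPn => // /set_mem/W'O; rewrite lee_fin; exact: g'0.
pose nu := ppush_measure (density_measure lam mf f0) mW' mS.
have nuE A : nu A = (\int[lam]_(y in W' `&` S @^-1` A) (g' y)%:E)%E.
  rewrite /nu/= /ppush/= /density_measure_def /f -integral_mkcondr.
  by rewrite setIAC setIid.
have nuW : nu W = (\int[lam]_(y in W') (g' y)%:E)%E.
  by rewrite nuE; congr (integral _ _ _); rewrite /W' -setIA setIid.
rewrite -/W' -nuW.
have Tc := biholomorphic_continuous bT.
have cTK := compact_image_in Tc KO cK.
have [b b0 gb] : exists2 b, 0 < b & forall y, (T @` K) y -> g' y <= b.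
  by apply: (compact_ub cTK) => _ [x /KO/OO'[/mem_set/g'c + _ _] <-].
have [rho TKrho] := compact_in_cdisc cTK.
have W'TK : W' `<=` T @` K.
  by move=> y [Oy Wy]; exists (S y); [exact: WK|have [] := OO y Oy].
have nufin : (nu setT < +oo)%E.
  rewrite nuE preimage_setT setIT.
  apply: (@le_lt_trans _ _ (\int[lam]_(y in W') b%:E)%E).
    apply: ge0_le_integral => //; first by move=> y /W'O ?; rewrite lee_fin g'0.
    - exact: mg'.
    - by move=> y /W'TK; rewrite lee_fin; exact: gb.
  rewrite integral_cst//; apply: lte_mul_pinfty => //; first by rewrite lee_fin ltW.
  apply: (@le_lt_trans _ _ (lam (cdisc 0 rho))); last exact: lamb_cdisc_fin.
  by apply: measure_leS => //; [exact: measurable_cdisc|move=> y /W'TK; exact: TKrho].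
apply: (compare_le nufin oW WK cK Wfin).
- by move=> x /KO/mem_set/gc.
- by move=> x /KO Ox; rewrite mulr_ge0 ?jac2_ge0// g'0//; have [] := OO' x Ox.
- move=> x /KO Ox e e0.
  have [d d0 H] := cov_local_le bT g'c g'0 Ox e0.
  exists d => // c xc r rd; apply: le_trans (H c xc r rd); rewrite nuE.
  have oA := open_preimage_in oO' Sc (@cdisc_open _ _ c r).
  apply: ge0_subset_integral => //.
  - apply: sub_sigma_algebra.
    exact: (open_preimage_in oW' (continuous_inS W'O Sc) (@cdisc_open _ _ c r)).
  - exact: sub_sigma_algebra.
  - by apply: mg' => // y [].
  - by move=> y [Oy _]; rewrite lee_fin g'0.
  - by move=> y [[]].
Qed.

(* The reverse of [cov_le] is [cov_le] for the inverse map, the density on [O] being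
   the one transported from [O']. *)
Lemma cov_open O O' T S (g' : Cvec R n -> R) (W K : set (Cvec R n)) :
  biholomorphic O O' T S -> {in O', continuous g'} -> (forall y, O' y -> 0 <= g' y) ->
  open W -> W `<=` K -> K `<=` O -> compact K -> (lam W < +oo)%E ->
  (\int[lam]_(y in (O' `&` S @^-1` W)) (g' y)%:E =
    \int[lam]_(x in W) (g' (T x) * jac2 T x)%:E)%E.
Proof.
move=> bT g'c g'0 oW WK KO cK Wfin; have [oO oO' OO' OO] := bT.
apply/eqP; rewrite eq_le (cov_le bT g'c g'0 oW WK KO cK Wfin)/=.
have Sc := biholomorphic_continuous (biholomorphic_sym bT).
have Tc := biholomorphic_continuous bT.
pose W' := O' `&` S @^-1` W.
have oW' : open W' by exact: (open_preimage_in oO' Sc oW).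
have cTK := compact_image_in Tc KO cK.
have W'TK : W' `<=` T @` K.
  by move=> y [Oy Wy]; exists (S y); [exact: WK|have [] := OO y Oy].
have [rho TKrho] := compact_in_cdisc cTK.
have W'fin : (lam W' < +oo)%E.
  apply: (@le_lt_trans _ _ (lam (cdisc 0 rho))); last exact: lamb_cdisc_fin.
  apply: measure_leS; [exact: sub_sigma_algebra|exact: measurable_cdisc|move=> y /W'TK; exact: TKrho].
have TKO : T @` K `<=` O' by move=> _ [x /KO/OO'[? _ _] <-].
have := cov_le (biholomorphic_sym bT) (cov_continuous bT g'c) _ oW' W'TK TKO cTK W'fin.
have -> : O `&` T @^-1` W' = W.
  apply/seteqP; split => [x [Ox [TO]]|x Wx] /=; first by have [_ ->] := OO' x Ox.
  by have Ox := KO x (WK x Wx); have [? Sx ?] := OO' x Ox; rewrite /W'/= Sx.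
move=> H; apply: le_trans (H _) _.
  by move=> x Ox; rewrite mulr_ge0 ?jac2_ge0// g'0//; have [] := OO' x Ox.
rewrite le_eqVlt; apply/orP; left; apply/eqP; apply: eq_integral => y /set_mem[Oy _].
have [OS TSy dS] := OO y Oy; have := (biholomorphic_jacobian bT OS).2.
rewrite TSy; move: (jac2 T _) (jac2 S y) (g' y) => a b c ba.
by congr (_%:E); rewrite -mulrA [a * b]mulrC ba mulr1.
Qed.

(** Bounded pieces of [O], each inside a compact subset of [O]. The margin [s] is strictly larger
    than [1 / (i + 1)], which makes the pieces open, in contrast to [core]. *)
Definition inner (O : set (Cvec R n)) (i : nat) : set (Cvec R n) :=
  cdisc 0 i%:R `&` [set x | exists2 s : R, i.+1%:R^-1 < s & cdisc x s `<=` O].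

Lemma inner_open O i : open (inner O i).
Proof.
apply: openI; first exact: cdisc_open.
rewrite openE; move: (i.+1%:R^-1 : R) => q x [s si sO]; apply/nbhs_rnormP.
exists ((s - q) / 2) => [|y xy]; first by rewrite divr_gt0// subr_gt0.
exists ((s + q) / 2); first by lra.
move=> z; rewrite /cdisc/= => yz; apply: sO; rewrite /cdisc/= rnorm_dist.
have -> : x - z = (x - y) + (y - z) by rewrite addrA subrK.
apply: le_lt_trans (rnormD _ _) _; move: yz; rewrite rnorm_dist; lra.
Qed.

Lemma inner_homo O : {homo inner O : i j / (i <= j)%N >-> i `<=` j}.
Proof.
move=> i j ij x [xi [s si sO]]; split.
  by apply: lt_le_trans xi _; rewrite ler_nat.
exists s => //; apply: le_lt_trans si; by rewrite lef_pV2 ?posrE// ler_nat.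
Qed.

Lemma inner_compact O i : exists K, [/\ compact K, inner O i `<=` K & K `<=` O].
Proof.
exists (ccdisc 0 i%:R `&` core O i.+1%:R^-1); split.
- apply: (subclosed_compact _ (@compact_ccdisc _ _ 0 i%:R)); last by move=> x [].
  apply: closedI; first exact: ccdisc_closed.
  exact: core_closed.
- move=> x [xi [s si sO]]; split; first exact: ltW.
  by move=> y xy; apply: sO; exact: lt_trans xy si.
- by move=> x [_]; apply; rewrite /cdisc/= subrr rnorm0.
Qed.

Lemma inner_cover O : open O -> \bigcup_i inner O i = O.
Proof.
move=> oO; apply/seteqP; split => [x [i _ [_ [s si]]]|x Ox].
  by apply; rewrite /cdisc/= subrr rnorm0; apply: lt_trans si.
have /nbhs_rnormP[d d0 xd] : nbhs x O by exact: open_nbhs_nbhs.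
have [m _ /(_ m (leqnn _)) rm] := near_infty_natSinv_lt (PosNum d0).
pose k := (Num.truncn (rnorm x)).+1.
exists (maxn m k) => //; split.
  rewrite /cdisc/= subr0; apply: lt_le_trans (truncnS_gt _) _.
  by rewrite ler_nat leq_maxr.
exists d; last by move=> y; rewrite /cdisc/= rnorm_dist => /xd.
by apply: le_lt_trans rm; rewrite lef_pV2 ?posrE// ler_nat ltnS leq_maxl.
Qed.

(** Both sides are measures in [B]. Restricted to a set [inner O i] they are finite and agree on
    open sets, hence on Borel sets; then [i] tends to infinity. *)
Theorem change_of_variables O O' T S (g' : Cvec R n -> R) (B : set C) :
  biholomorphic O O' T S -> {in O', continuous g'} -> (forall y, O' y -> 0 <= g' y) ->
  measurable B ->
  (\int[lam]_(y in (O' `&` S @^-1` B)) (g' y)%:E =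
    \int[lam]_(x in (B `&` O)) (g' (T x) * jac2 T x)%:E)%E.
Proof.
move=> bT g'c g'0 mB; have [oO oO' OO' OO] := bT.
have gc := cov_continuous bT g'c.
have Sc := biholomorphic_continuous (biholomorphic_sym bT).
have mO : measurable (O : set C) by exact: sub_sigma_algebra.
have mO' : measurable (O' : set C) by exact: sub_sigma_algebra.
have mS : measurable_fun (O' : set C) (S : C -> C) by exact: (open_continuous_borel oO' Sc).
pose f1 : C -> \bar R := (fun y => (g' y)%:E) \_ O'.
pose f2 : C -> \bar R := (fun x => (g' (T x) * jac2 T x)%:E) \_ O.
have mf1 : measurable_fun setT f1.
  exact: ((measurable_restrictT _ mO').1 (measurable_cont_on oO' g'c)).
have mf2 : measurable_fun setT f2.
  exact: ((measurable_restrictT _ mO).1 (measurable_cont_on oO gc)).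
have f10 y : (0 <= f1 y)%E.
  by rewrite /f1 patchE; case: ifPn => // /set_mem; rewrite lee_fin; exact: g'0.
have f20 y : (0 <= f2 y)%E.
  rewrite /f2 patchE; case: ifPn => // /set_mem Ox; rewrite lee_fin.
  by rewrite mulr_ge0 ?jac2_ge0// g'0//; have [] := OO' y Ox.
pose m1 := ppush_measure (density_measure lam mf1 f10) mO' mS.
pose m2 := density_measure lam mf2 f20.
have m1E A : m1 A = (\int[lam]_(y in O' `&` S @^-1` A) (g' y)%:E)%E.
  rewrite /m1/= /ppush/= /density_measure_def /f1 -integral_mkcondr.
  by rewrite setIAC setIid.
have m2E A : m2 A = (\int[lam]_(x in A `&` O) (g' (T x) * jac2 T x)%:E)%E.
  by rewrite /m2/= /density_measure_def /f2 -integral_mkcondr.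
have mW i : measurable (inner O i : set C) by apply: sub_sigma_algebra; exact: inner_open.
have WO i : inner O i `<=` O by rewrite -{2}(inner_cover oO); exact: bigcup_sup.
have Wfin i U : open U -> U `<=` inner O i -> (lam U < +oo)%E.
  move=> oU UW; apply: (@le_lt_trans _ _ (lam (cdisc 0 i%:R))); last exact: lamb_cdisc_fin.
  by apply: measure_leS; [exact: sub_sigma_algebra|exact: measurable_cdisc|move=> x /UW []].
have eqW i (A : set C) : measurable A -> m1 (A `&` inner O i) = m2 (A `&` inner O i).
  have [K [cK WK KO]] := inner_compact O i.
  pose r1 : {measure set C -> \bar R} := mrestr m1 (mW i).
  pose r2 : {measure set C -> \bar R} := mrestr m2 (mW i).
  apply: (@measure_unique _ R C (@open (Cvec R n)) (fun=> setT) _ _ _ _ r1 r2) => //.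
  - exact: openI.
  - by move=> _; exact: openT.
  - by rewrite bigcup_const.
  - move=> U oU; change (m1 (U `&` inner O i) = m2 (U `&` inner O i)).
    have UW : U `&` inner O i `<=` inner O i by move=> x [].
    have oUW : open (U `&` inner O i) by apply: openI => //; exact: inner_open.
    rewrite m1E m2E (setIidl (subset_trans UW (@WO i))).
    apply: (cov_open bT g'c g'0 oUW (subset_trans UW WK) KO cK).
    exact: (Wfin i _ oUW UW).
  - move=> _; change (m1 (setT `&` inner O i) < +oo)%E; rewrite setTI.
    rewrite m1E (cov_open bT g'c g'0 (@inner_open O i) WK KO cK); last exact: (Wfin i _ (@inner_open O i) _).
    have [b b0 gb] := compact_ub cK (fun x Kx => gc x (mem_set (KO x Kx))).
    apply: (@le_lt_trans _ _ (\int[lam]_(y in inner O i) b%:E)%E).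
      apply: ge0_le_integral => //.
      - move=> x /WO Ox; rewrite lee_fin.
        by rewrite mulr_ge0 ?jac2_ge0// g'0//; have [] := OO' x Ox.
      - exact: (measurable_cont_on (@inner_open O i) (continuous_inS (@WO i) gc)).
      - by move=> x /WK; rewrite lee_fin; exact: gb.
    rewrite integral_cst//; apply: lte_mul_pinfty => //; first by rewrite lee_fin ltW.
    exact: (Wfin i _ (@inner_open O i) _).
have BO : \bigcup_i (B `&` inner O i) = B `&` O by rewrite -setI_bigcupr inner_cover.
have lim (m : {measure set C -> \bar R}) :
    ((m \o (fun i => B `&` inner O i : set C)) i @[i --> \oo] --> m (B `&` (O : set C)))%E.
  rewrite -[X in m X]BO; apply: nondecreasing_cvg_mu.
  - by move=> i; exact: measurableI.
  - by apply: bigcupT_measurable => i; exact: measurableI.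
  - by move=> i j ij; apply/subsetPset; apply: setIS; exact: inner_homo.
have <- : m1 B = (\int[lam]_(y in O' `&` S @^-1` B) (g' y)%:E)%E by exact: m1E.
have -> : m1 B = m1 (B `&` (O : set C)).
  rewrite !m1E; congr (integral _ _ _); apply/seteqP; split=> [y [Oy By]|y [Oy [By _]]] //.
  by split=> //; split=> //; have [] := OO y Oy.
rewrite -m2E -[RHS]/(m2 B).
have -> : m2 B = m2 (B `&` (O : set C)) by rewrite !m2E -setIA setIid.
apply: (cvg_unique (@ereal_hausdorff R) (lim m1)).
rewrite [X in X @ _](_ : _ = m2 \o (fun i => B `&` inner O i : set C)); first exact: lim.
by apply/funext => i; exact: eqW.
Qed.

End cov_measure.

(** * The sub-mean value inequality over a ball *)

Lemma usc_measurable (R : realType) (T : ptopologicalType) (U : set T) (f : T -> \bar R) :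
  open U -> usc_on U f -> measurable_fun (U : set (Borel T)) (f : Borel T -> \bar R).
Proof.
move=> oU uf; apply: (measurability _ (ErealGenInftyO.measurableE R)).
move=> _ [_ [r ->] <-]; apply: sub_sigma_algebra; rewrite openE => x [Ux].
rewrite /= in_itv/= => fx; apply: filterI; first exact: open_nbhs_nbhs.
by have := uf x Ux r fx; apply: filterS => y /=; rewrite in_itv.
Qed.

Section submean.
Context (R : realType) (n : nat).
Local Notation C := (Borel (Cvec R n)).
Local Notation lam := (@lamb R n).

Lemma scalemx_diagE (K : comNzRingType) (v : 'rV[K]_n) (a : K) :
  v *m diag_mx (const_mx a) = a *: v.
Proof. by rewrite diag_const_mx mul_mx_scalar. Qed.

Lemma rotation_scales (w : R[i]) : rnorm (w : R[i]^o) = 1 ->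
  scales lam (fun b : C => w *: (b : Cvec R n) : C) 1.
Proof.
move=> w1; have w0 : w != 0 by rewrite -(rnorm_gt0 (w : R[i]^o)) w1.
have := @scales_cdiag R n (const_mx w).
rewrite big1; last by move=> j _; rewrite mxE w1 invr1 mulr1.
have -> : mulR (diag_mx (const_mx w)) = (fun b : C => w *: (b : Cvec R n) : C).
  by apply/funext => b; exact: scalemx_diagE.
by apply=> j; rewrite mxE.
Qed.

(* The inequality on the unit circle of the line through [z] directed by [b] is
   averaged over [b] in the ball, which is invariant under rotations. *)
Lemma submean (U : set (Cvec R n)) (f : Cvec R n -> \bar R) z r :
  open U -> psh_on U f -> (forall y, U y -> f y <= 0)%E -> 0 < r -> cdisc z r `<=` U ->
  (\int[lam]_(y in cdisc z r) (- f y) <= lam (cdisc 0 r) * - f z)%E.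
Proof.
move=> oU [uscf _ shf] f0 r0 zU.
have mU : measurable (U : set C) by exact: sub_sigma_algebra.
pose h : C -> \bar R := (fun y => - f y)%E \_ U.
have mh : measurable_fun setT h.
  apply: ((measurable_restrictT _ mU).1); apply: measurableT_comp; first exact: oppe_measurable.
  exact: usc_measurable.
have h0 y : (0 <= h y)%E.
  by rewrite /h patchE; case: ifPn => // /set_mem/f0; rewrite oppe_ge0.
pose B : set C := cdisc 0 r.
have mB : measurable B by exact: measurable_cdisc.
pose H (b : C) : \bar R := ((\1_B b)%:E * h ((b : Cvec R n) + z)%R)%E.
have mH : measurable_fun setT H.
  apply: emeasurable_funM; first by apply/measurable_EFinP; exact: measurable_indic.
  exact: (measurableT_comp mh (measurable_shift z)).
have H0 b : (0 <= H b)%E by rewrite mule_ge0// lee_fin.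
have HE : (\int[lam]_(y in cdisc z r) - f y = \int[lam]_b H b)%E.
  pose H' (y : C) : \bar R := ((\1_(cdisc z r : set C) y)%:E * h y)%E.
  have mH' : measurable_fun setT H'.
    apply: emeasurable_funM => //; apply/measurable_EFinP; apply: measurable_indic.
    exact: measurable_cdisc.
  have H'0 y : (0 <= H' y)%E by rewrite mule_ge0// lee_fin.
  transitivity (\int[lam]_y H' y)%E.
    rewrite /H' integral_indicM; apply: eq_integral => y /set_mem/zU Uy.
    by rewrite /h patchE mem_set.
  have -> : H = (fun b : C => H' ((b : Cvec R n) + z)).
    apply/funext => b; rewrite /H.
    have -> : \1_B b = \1_(cdisc z r : set C) ((b : Cvec R n) + z : C) :> R.
      by apply: indic_eq; rewrite /B /cdisc/= subr0 addrK.
    by [].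
  by have := scales_integral (scales_lamb_shift z) mH' H'0; rewrite mul1e => ->.
pose I : set (measurableTypeR R) := `[0%R, (2 * pi)%R]%classic.
have p0 : 0 < 2 * pi :> R by rewrite mulr_gt0// pi_gt0.
have lI : lebesgue_measure I = (2 * pi)%:E.
  by rewrite /I lebesgue_measure_itv/= lte_fin p0 sube0.
have mI : measurable I by exact: measurable_itv.
(* The indicator of [I] lets the angle range over the whole line, so that Tonelli's theorem applies
   to the full product. *)
pose F (p : measurableTypeR R * C) : \bar R :=
  ((\1_I p.1)%:E * H ((cos p.1 +i* sin p.1) *: (p.2 : Cvec R n))%R)%E.
have mF : measurable_fun setT F.
  apply: emeasurable_funM.
    apply/measurable_EFinP; exact: (measurableT_comp (measurable_indic mI) measurable_fst).
  apply: (measurableT_comp mH); apply: measurable_CvecZ => //.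
  - apply: (measurableT_comp _ measurable_fst).
    by apply: continuous_measurable_fun; exact: continuous_cos.
  - apply: (measurableT_comp _ measurable_fst).
    by apply: continuous_measurable_fun; exact: continuous_sin.
have F0 p : (0 <= F p)%E by rewrite mule_ge0// lee_fin.
have HI : (0 <= \int[lam]_b H b)%E by exact: integral_ge0.
have inner_t : (\int[lebesgue_measure]_t \int[lambs R n]_b F (t, b) =
    (2 * pi)%:E * \int[lam]_b H b)%E.
  rewrite (eq_integral (fun t => (\int[lam]_b H b) * (\1_I t)%:E)%E); last first.
    move=> t _; rewrite /F/= ge0_integralZl//; last first.
      have [_ mw _] := rotation_scales (rnorm_unit t).
      exact: (measurableT_comp mH mw).
    have := scales_integral (rotation_scales (rnorm_unit t)) mH H0.
    by rewrite mul1e muleC => <-.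
  rewrite ge0_integralZl//; last by apply/measurable_EFinP; exact: measurable_indic.
  by rewrite integral_indic// setIT muleC; congr (_ * _)%E; exact: lI.
have outer : (\int[lambs R n]_b \int[lebesgue_measure]_t F (t, b) <=
    \int[lam]_b (((2 * pi)%:E * - f z) * (\1_B b)%:E))%E.
  apply: ge0_le_integral => //.
  - by move=> b _; exact: integral_ge0.
  - exact: (measurable_fun_fubini_tonelli_G F mF F0).
  - by apply: measurable_funeM; apply/measurable_EFinP; exact: measurable_indic.
  move=> b _; case: (asboolP (B b)) => Bb; last first.
    rewrite integral0_eq; first by rewrite indicE memNset// mule0.
    move=> t _; rewrite /F /H /=.
    have -> : \1_B ((cos t +i* sin t) *: (b : Cvec R n)) = 0 :> R.
      rewrite indicE memNset// /B /cdisc/= subr0 rnormZ rnorm_unit mul1r => bB.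
      by apply: Bb; rewrite /B /cdisc/= subr0.
    by rewrite mul0e mule0.
  rewrite indicE mem_set// mule1.
  (* Stability under scalars of modulus at most 1 puts the whole closed disc of the line, not merely
     its boundary circle, inside [U], as the definition of [subharmonic] demands. *)
  have zB (w : R[i]) : rnorm (w : R[i]^o) <= 1 -> B (w *: (b : Cvec R n)).
    move=> w1; move: Bb; rewrite /B/cdisc/= !subr0 rnormZ; apply: le_lt_trans.
    by rewrite ler_piMl// rnorm_ge0.
  have UB (w : R[i]) : rnorm (w : R[i]^o) <= 1 -> U (w *: (b : Cvec R n) + z).
    by move=> /zB wB; apply: zU; move: wB; rewrite /B /cdisc/= addrK subr0.
  have [_ _ sm] := shf z b.
  have := sm 0 1 ltr01; rewrite scale0r addr0.
  have D1 : [set w : R[i]^o | `|w - 0| <= 1%:C] `<=` [set l : R[i]^o | U (z + l *: b)].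
    by move=> w /=; rewrite subr0 rnormE lecR addrC; exact: UB.
  move=> /(_ D1); rewrite lee_pdivlMl// => mean.
  rewrite muleN leeNr; apply: le_trans mean _.
  pose g (t : measurableTypeR R) : \bar R := (- f (z + (0 + 1%:C * (cos t +i* sin t)) *: b)%R)%E.
  have Uq t : U (z + (0 + 1%:C * (cos t +i* sin t)) *: b).
    by rewrite add0r mul1r addrC; apply: UB; rewrite rnorm_unit.
  have -> : (\int[lebesgue_measure]_(t in `[0%R, (2 * pi)%R])
      f (z + (0 + 1%:C * (cos t +i* sin t)) *: b)%R = - \int[lebesgue_measure]_(t in I) g t)%E.
    rewrite -integral_ge0N; last by move=> t _; rewrite /g oppe_ge0 f0.
    by apply: eq_integral => t _; rewrite /g oppeK.
  rewrite leeN2 /F/= integral_indicM.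
  rewrite le_eqVlt; apply/orP; left; apply/eqP; apply: eq_integral => t _.
  have tB : B ((cos t +i* sin t) *: (b : Cvec R n)) by apply: zB; rewrite rnorm_unit.
  have := Uq t; rewrite /H /g add0r mul1r [z + _]addrC => Ut.
  by rewrite indicE mem_set// mul1e /h patchE mem_set.
have := fubini_tonelli F mF F0 => FT.
rewrite HE -(@lee_pmul2l _ (2 * pi)%:E)// -inner_t FT.
apply: le_trans outer _.
have fz : (0 <= - f z)%E by rewrite oppe_ge0 f0//; apply: zU; rewrite /cdisc/= subrr rnorm0.
rewrite ge0_integralZl//; last 2 first.
- by apply/measurable_EFinP; exact: measurable_indic.
- by rewrite mule_ge0// lee_fin ltW.
by rewrite integral_indic// setIT -muleA [(- f z * _)%E]muleC.
Qed.

End submean.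

(** * Coordinate discs and Harnack's inequality *)

Section good_discs.
Context (R : realType) (n : nat) (M : ptopologicalType) (X : complex_manifold R n M).
Local Notation C := (Borel (Cvec R n)).
Local Notation lam := (@lamb R n).

(* The larger disc of radius [3 * dradius] leaves room for the sub-mean value
   property on discs of radius [2 * dradius] centred in the small disc. *)
Record disc := Disc {
  dchart : chart R n M ;
  dcenter : Cvec R n ;
  dradius : R ;
  disc_atlas : atlas X dchart ;
  dradius_gt0 : 0 < dradius ;
  disc_sub : cdisc dcenter (3 * dradius) `<=` rng dchart }.

Definition dset (D : disc) : set M :=
  dom (dchart D) `&` cmap (dchart D) @^-1` (cdisc (dcenter D) (dradius D)).

Lemma dset_open D : open (dset D).
Proof. exact: (open_preimage_in (dom_open _) (@cmap_continuous _ _ _ _) (@cdisc_open _ _ _ _)). Qed.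

Lemma cmap_rng (c : chart R n M) x : dom c x -> rng c (cmap c x).
Proof. by exists x. Qed.

Lemma cmapKx (c : chart R n M) x : dom c x -> cinv c (cmap c x) = x.
Proof. by move=> /mem_set/(@cmapK _ _ _ c). Qed.

Lemma cinv_dom (c : chart R n M) z : rng c z -> dom c (cinv c z).
Proof. by move=> [x Dx <-]; rewrite cmapKx. Qed.

Lemma cinvK (c : chart R n M) z : rng c z -> cmap c (cinv c z) = z.
Proof. by move=> [x Dx <-]; rewrite cmapKx. Qed.

Lemma disc_ex x : exists D, dset D x.
Proof.
have [c cX cx] : (\bigcup_(c in atlas X) dom c) x by rewrite atlas_cover.
have /nbhs_rnormP[e e0 xe] : nbhs (cmap c x) (rng c).
  by apply: open_nbhs_nbhs; split; [exact: rng_open|exact: cmap_rng].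
have e3 : 0 < e / 3 by rewrite divr_gt0.
have sub : cdisc (cmap c x) (3 * (e / 3)) `<=` rng c.
  by move=> z; rewrite /cdisc/= mulrC divfK ?pnatr_eq0// rnorm_dist; exact: xe.
by exists (Disc cX e3 sub); split=> //; rewrite /cdisc/= subrr rnorm0.
Qed.

Lemma ccdisc_rng D : ccdisc (dcenter D) (dradius D) `<=` rng (dchart D).
Proof.
move=> y yD; apply: (@disc_sub D); apply: le_lt_trans yD _.
by rewrite ltr_pMl ?dradius_gt0// ltr1n.
Qed.

Lemma disc_rng D : cdisc (dcenter D) (dradius D) `<=` rng (dchart D).
Proof. by move=> z /ltW zD; exact: ccdisc_rng. Qed.

Lemma closed_disc_compact D :
  compact (cinv (dchart D) @` ccdisc (dcenter D) (dradius D)).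
Proof.
exact: (compact_image_in (@cinv_continuous _ _ _ _) (@ccdisc_rng D) (@compact_ccdisc _ _ _ _)).
Qed.

Lemma cinv_dset D z : cdisc (dcenter D) (dradius D) z -> dset D (cinv (dchart D) z).
Proof.
move=> zD; have zr := disc_rng zD; split; first exact: cinv_dom.
by rewrite /preimage/= cinvK.
Qed.

Definition mass (u : M -> \bar R) (D : disc) : \bar R :=
  (\int[lam]_(z in cdisc (dcenter D) (dradius D)) - u (cinv (dchart D) z))%E.

Lemma mass_ge0 u D : negative_psh X u -> (0 <= mass u D)%E.
Proof. by move=> [_ u0 _]; apply: integral_ge0 => z _; rewrite oppe_ge0. Qed.

Lemma psh_chart u c : negative_psh X u -> atlas X c -> psh_on (rng c) (u \o cinv c).
Proof. by move=> [+ _ _] cX; apply. Qed.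

Lemma measurable_potential u c : negative_psh X u -> atlas X c ->
  measurable_fun (rng c : set C) (fun z : C => - u (cinv c z))%E.
Proof.
move=> nu cX; have [uc _ _] := psh_chart nu cX.
apply: (measurableT_comp (@oppe_measurable R setT)).
exact: (usc_measurable (@rng_open _ _ _ c) uc).
Qed.

Definition harnack_cst (D : disc) : R := fine (lam (cdisc 0 (2 * dradius D))).

Lemma lamb_fineK v r : (fine (lam (cdisc v r)))%:E = lam (cdisc v r).
Proof. by rewrite fineK// ge0_fin_numE//; exact: lamb_cdisc_fin. Qed.

Lemma lamb_fine_gt0 v r : 0 < r -> 0 < fine (lam (cdisc v r)).
Proof. by move=> r0; rewrite fine_gt0// lamb_cdisc_gt0//=; exact: lamb_cdisc_fin. Qed.

Lemma harnack_cst_gt0 D : 0 < harnack_cst D.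
Proof. by apply: lamb_fine_gt0; rewrite mulr_gt0// dradius_gt0. Qed.

(** The disc of radius [2 * dradius D] about a point of [D] contains [D]. As [- u] is nonnegative,
    the mass of [D] is at most the integral over the larger disc, to which [submean] applies. *)
Lemma harnack u D x : negative_psh X u -> dset D x ->
  (mass u D <= (harnack_cst D)%:E * - u x)%E.
Proof.
move=> nu [Dx xD]; have r0 := dradius_gt0 D.
pose z := cmap (dchart D) x; have [_ u0 _] := nu.
have zsub : cdisc z (2 * dradius D) `<=` rng (dchart D).
  move=> y yz; apply: (@disc_sub D); rewrite /cdisc/=.
  have -> : y - dcenter D = (y - z) + (z - dcenter D) by rewrite addrA subrK.
  apply: le_lt_trans (rnormD _ _) _; have -> : 3 * dradius D = 2 * dradius D + dradius D by ring.
  exact: ltrD.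
have := submean (@rng_open _ _ _ (dchart D)) (psh_chart nu (disc_atlas D)) (fun y _ => u0 _) (mulr_gt0 (ltr0n R 2) r0) zsub.
rewrite /= cmapKx// -lamb_fineK; apply: le_trans.
apply: ge0_subset_integral; [exact: measurable_cdisc|exact: measurable_cdisc| | |].
- apply: measurable_funS (measurable_potential nu (disc_atlas D)) => //.
  by apply: sub_sigma_algebra; exact: rng_open.
- by move=> y _; rewrite oppe_ge0.
- move=> y yD; rewrite /cdisc/=.
  have -> : y - z = (y - dcenter D) + (dcenter D - z) by rewrite addrA subrK.
  apply: le_lt_trans (rnormD _ _) _.
  have -> : 2 * dradius D = dradius D + dradius D by ring.
  by rewrite ltrD// rnorm_dist.
Qed.

Lemma lamb_open_gt0 (V : set (Cvec R n)) z : open V -> V z -> (0 < lam V)%E.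
Proof.
move=> oV Vz; have /nbhs_rnormP[e e0 xe] : nbhs z V by exact: open_nbhs_nbhs.
apply: lt_le_trans (lamb_cdisc_gt0 z e0) _; apply: measure_leS.
- exact: measurable_cdisc.
- exact: sub_sigma_algebra.
- by move=> y; rewrite /cdisc/= rnorm_dist; exact: xe.
Qed.

(** The overlap is measured in the chart of [D'] only. Harnack's inequality for [D] is a pointwise
    statement on [M], so no change of coordinates enters. *)
Lemma mass_compare D D' x : dset D x -> dset D' x ->
  exists2 A : R, 0 < A & forall u, negative_psh X u -> (mass u D <= A%:E * mass u D')%E.
Proof.
move=> Dx D'x; pose c := dchart D'.
pose V := rng c `&` cinv c @^-1` (dset D `&` dset D').
have oV : open V.
  apply: (open_preimage_in (@rng_open _ _ _ c) (@cinv_continuous _ _ _ c)).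
  by apply: openI; exact: dset_open.
have mV : measurable (V : set C) by exact: sub_sigma_algebra.
have VD' : V `<=` cdisc (dcenter D') (dradius D').
  by move=> z [zr [_ [_]]]; rewrite /preimage/= cinvK.
have Vgt0 : (0 < lam V)%E.
  apply: (@lamb_open_gt0 _ (cmap c x)) => //; have [cx _] := D'x.
  by split; [exact: cmap_rng|rewrite /= cmapKx].
have Vfin : (lam V < +oo)%E.
  apply: le_lt_trans (lamb_cdisc_fin (dcenter D') (dradius D')).
  by apply: measure_leS => //; exact: measurable_cdisc.
have V0 : 0 < fine (lam V) by rewrite fine_gt0// Vgt0.
exists (harnack_cst D / fine (lam V)) => [|u nu]; first by rewrite divr_gt0// harnack_cst_gt0.
have [_ u0 _] := nu.
have mw (S : set C) : measurable S -> S `<=` rng c -> measurable_fun S (fun z : C => - u (cinv c z))%E.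
  move=> mS Sr; apply: measurable_funS (measurable_potential nu (disc_atlas D')) => //.
  by apply: sub_sigma_algebra; exact: rng_open.
have H : (mass u D * lam V <= (harnack_cst D)%:E * mass u D')%E.
  rewrite -integral_cst//.
  apply: (@le_trans _ _ (\int[lam]_(z in V) ((harnack_cst D)%:E * - u (cinv c z)))%E).
    apply: ge0_le_integral => //.
    - by move=> z _; exact: mass_ge0.
    - by apply: measurable_funeM; apply: mw => // z [].
    - by move=> z [_ [zD _]]; exact: harnack.
  rewrite ge0_integralZl//; last 3 first.
  - by apply: mw => // z [].
  - by move=> z _; rewrite oppe_ge0.
  - by rewrite lee_fin ltW// harnack_cst_gt0.
  apply: lee_wpmul2l; first by rewrite lee_fin ltW// harnack_cst_gt0.
  apply: ge0_subset_integral => //; first exact: measurable_cdisc.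
  - by apply: mw; [exact: measurable_cdisc|exact: disc_rng].
  - by move=> z _; rewrite oppe_ge0.
rewrite mulrC EFinM -muleA lee_pdivlMl// muleC.
by rewrite fineK// ge0_fin_numE.
Qed.

(* The union of the discs comparable to [D0] is both open and closed. *)
Lemma mass_equiv (D0 D : disc) : connected [set: M] ->
  exists2 A : R, 0 < A & forall u, negative_psh X u ->
    (mass u D <= A%:E * mass u D0)%E /\ (mass u D0 <= A%:E * mass u D)%E.
Proof.
move=> cM; pose eqv D := exists2 A : R, 0 < A & forall u, negative_psh X u ->
    (mass u D <= A%:E * mass u D0)%E /\ (mass u D0 <= A%:E * mass u D)%E.
have step D1 D2 x : dset D1 x -> dset D2 x -> eqv D1 -> eqv D2.
  move=> x1 x2 [A A0 HA]; have [a a0 ha] := mass_compare x1 x2.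
  have [b b0 hb] := mass_compare x2 x1.
  have p0 := mulr_gt0 A0 (addr_gt0 a0 b0).
  exists (A * (a + b)) => // u nu; have [h1 h2] := HA u nu.
  have m0 D' := mass_ge0 D' nu.
  split.
  - apply: le_trans (hb u nu) _; apply: le_trans (lee_wpmul2l _ h1) _; first by rewrite lee_fin ltW.
    by rewrite muleA -EFinM lee_wpmul2r// lee_fin mulrC ler_pM2l// lerDr ltW.
  - apply: le_trans h2 _; apply: le_trans (lee_wpmul2l _ (ha u nu)) _; first by rewrite lee_fin ltW.
    by rewrite muleA -EFinM lee_wpmul2r// lee_fin ler_pM2l// lerDl ltW.
have eqv0 : eqv D0.
  by exists 1 => // u nu; rewrite mul1e.
pose G := \bigcup_(D' in eqv) dset D'; pose G' := \bigcup_(D' in ~` eqv) dset D'.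
have oG : open G by apply: bigcup_open => D' _; exact: dset_open.
have oG' : open G' by apply: bigcup_open => D' _; exact: dset_open.
have GE : G = ~` G'.
  apply/seteqP; split => [x [D1 e1 x1] [D2 e2 x2]|x nG'].
    exact: e2 (step _ _ _ x1 x2 e1).
  have [D1 x1] := disc_ex x; exists D1 => //.
  by apply: contrapT => e1; apply: nG'; exists D1.
have pD (D' : disc) : dset D' (cinv (dchart D') (dcenter D')).
  by apply: cinv_dset; rewrite /cdisc/= subrr rnorm0 dradius_gt0.
have GT : G = setT.
  apply: cM; first by exists (cinv (dchart D0) (dcenter D0)); exists D0.
    by exists G; rewrite ?setTI.
  by exists (~` G'); [exact: open_closedC|rewrite setTI].
have : G (cinv (dchart D) (dcenter D)) by rewrite GT.
by move=> [D1 e1 x1]; exact: step x1 (pD D) e1.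
Qed.

(** Lindelof's argument: each member of a countable base that fits into some disc selects one, and
    an injection of the base into [nat] numbers the selection. *)
Lemma disc_cover : exists D : nat -> disc, forall x, exists k, dset (D k) x.
Proof.
have [B cB [oB basisB]] := manifold_second_countable X.
have [g gi] : exists g : set M -> nat, {in B &, injective g}.
  by have /countable_injP[g] := cB; exists g.
have [Dpt _] := disc_ex point.
(* [Dpt] serves for sets contained in no disc; below, [set0] stands in for numbers that code no
   member of the base. *)
have /choice[Db DbP] (b : set M) : exists D, (exists D', b `<=` dset D') -> b `<=` dset D.
  by case: (pselect (exists D', b `<=` dset D')) => [[D' bD']|nb]; [exists D'|exists Dpt].
exists (fun k => Db (xget set0 [set b | B b /\ g b = k])) => x.
have [D Dx] := disc_ex x.
have [b [Bb xb] bD] : filter_from [set U | B U /\ U x] id (dset D).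
  apply: (basisB x); apply: open_nbhs_nbhs; split=> //; exact: dset_open.
exists (g b); have [Bb' gb'] := @xgetPex _ set0 [set b' | B b' /\ g b' = g b] (ex_intro _ b (conj Bb erefl)).
have -> : xget set0 [set b' | B b' /\ g b' = g b] = b.
  by apply: gi => //; apply/mem_set.
by apply: (DbP b) xb; exists D.
Qed.

End good_discs.

(** * Densities *)

Section geometric_domination.
Context (R : realType).
Local Notation h := (2^-1 : R).

Lemma geom_tail (b : nat -> \bar R) m : (forall k, 0 <= b k)%E ->
  (forall k, (m <= k)%N -> b k <= (h ^+ k)%:E)%E ->
  (\sum_(m <= k <oo) b k <= (2 * h ^+ m)%:E)%E.
Proof.
move=> b0 bh; apply: lime_le; first by apply: is_cvg_nneseries => k _ _.
near=> j; apply: (@le_trans _ _ (\sum_(m <= k < j) (h ^+ k)%:E)%E).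
  by rewrite big_nat_cond [leRHS]big_nat_cond; apply: lee_sum => k /andP[/andP[mk _] _]; exact: bh.
rewrite sumEFin lee_fin.
have mj : (m <= j)%N by near: j; exact: nbhs_infty_ge.
rewrite (eq_bigr (fun k => - 2 * h ^+ k.+1 - - 2 * h ^+ k)); last first.
  by move=> k _; rewrite exprS; field.
rewrite (telescope_sumr (fun k => - 2 * h ^+ k))//.
have : 0 <= h ^+ j by rewrite exprn_ge0// invr_ge0.
lra.
Unshelve. all: by end_near. Qed.

Lemma geom_small (e : R) : 0 < e -> exists m, 2 * h ^+ m < e.
Proof.
move=> e0; have : (fun k => 2 * h ^+ k) k @[k --> \oo] --> (2 * 0 : R).
  apply: cvgM; first exact: cvg_cst.
  by apply: cvg_expr; rewrite ger0_norm// invf_lt1// ltr1n.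
rewrite mulr0 => /cvgrPdist_lt/(_ e e0)[m _ /(_ m (leqnn m))].
by rewrite sub0r normrN ger0_norm ?mulr_ge0 ?exprn_ge0// => H; exists m.
Qed.

Lemma series_fin (f : nat -> R) N : (forall k, 0 <= f k) ->
  (forall k, (N <= k)%N -> f k <= h ^+ k) -> (\sum_(0 <= k <oo) (f k)%:E < +oo)%E.
Proof.
move=> f0 fh; rewrite (nneseries_split 0 N)//; last by move=> k _; rewrite lee_fin.
rewrite lte_add_pinfty//; first by rewrite sumEFin ltry.
by apply: le_lt_trans (geom_tail _ _) (ltry _) => k; rewrite lee_fin//; exact: fh.
Qed.

(** Nonnegative series are summed in [\bar R], where summability is mere finiteness; [fine] sends an
    infinite sum to 0. *)
Definition esum_fine (f : nat -> R) : R := fine (\sum_(0 <= k <oo) (f k)%:E)%E.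

Lemma esum_fineK (f : nat -> R) N : (forall k, 0 <= f k) ->
  (forall k, (N <= k)%N -> f k <= h ^+ k) ->
  (esum_fine f)%:E = (\sum_(0 <= k <oo) (f k)%:E)%E.
Proof.
move=> f0 fh; rewrite /esum_fine fineK// ge0_fin_numE; first exact: series_fin fh.
by apply: nneseries_ge0 => k _ _; rewrite lee_fin.
Qed.

Lemma esum_fine_split (f : nat -> R) N m : (N <= m)%N -> (forall k, 0 <= f k) ->
  (forall k, (N <= k)%N -> f k <= h ^+ k) ->
  \sum_(0 <= k < m) f k <= esum_fine f <= \sum_(0 <= k < m) f k + 2 * h ^+ m.
Proof.
move=> Nm f0 fh; rewrite -!lee_fin (esum_fineK f0 fh).
rewrite (nneseries_split 0 m)//; last by move=> k _; rewrite lee_fin.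
rewrite add0n sumEFin EFinD leeDl/=; last by apply: nneseries_ge0 => k _ _; rewrite lee_fin.
rewrite leeD2l//; apply: geom_tail => k; rewrite lee_fin// => mk.
exact: fh (leq_trans Nm mk).
Qed.

(** Near [x] the tails are uniformly at most [2 * h ^+ m], so the continuous partial sums control
    the sum. The first [N] terms may be large. *)
Lemma esum_fine_continuous (T : topologicalType) (f : nat -> T -> R) (x : T) N :
  (forall k, {for x, continuous (f k)}) -> (forall k y, 0 <= f k y) ->
  (\forall y \near x, forall k, (N <= k)%N -> f k y <= h ^+ k) ->
  {for x, continuous (fun y => esum_fine (f^~ y))}.
Proof.
move=> fc f0 fh; apply/cvgrPdist_lt => e e0.
have [m0 hm0] := geom_small (divr_gt0 e0 (ltr0n R 2)).
pose m := maxn N m0.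
have hm : 2 * h ^+ m < e / 2.
  apply: le_lt_trans hm0; rewrite ler_pM2l//.
  by rewrite ler_wiXn2l ?leq_maxr// ?invr_ge0// invf_le1// ler1n.
have Pc j : {for x, continuous (fun y => \sum_(0 <= k < j) f k y)}.
  elim: j => [|j IH].
    by rewrite (_ : (fun y => _) = (fun=> 0)); [exact: cvg_cst|apply/funext => y; rewrite big_nil].
  rewrite (_ : (fun y => _) = (fun y => \sum_(0 <= k < j) f k y + f j y)).
    by apply: cvgD; [exact: IH|exact: fc].
  by apply/funext => y; rewrite big_nat_recr.
have /cvgrPdist_lt/(_ _ (divr_gt0 e0 (ltr0n R 2))) Pn := Pc m.
have xh := nbhs_singleton fh.
near=> y.
have yh : forall k, (N <= k)%N -> f k y <= h ^+ k by near: y.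
have := esum_fine_split (leq_maxl N m0) (f0^~ y) yh.
have := esum_fine_split (leq_maxl N m0) (f0^~ x) xh.
have : `|\sum_(0 <= k < m) f k x - \sum_(0 <= k < m) f k y| < e / 2 by near: y; exact: Pn.
rewrite -/m; move: (\sum_(0 <= k < m) f k x) (\sum_(0 <= k < m) f k y) => a b.
move: (esum_fine _) (esum_fine _) (2 * h ^+ m) hm => s t q hq.
rewrite !ltr_norml => /andP[? ?] /andP[? ?] /andP[? ?]; apply/andP; split; lra.
Unshelve. all: by end_near. Qed.

End geometric_domination.

(** * Tent forms read in arbitrary charts *)

Section chart_densities.
Context (R : realType) (n : nat) (M : ptopologicalType) (X : complex_manifold R n M).
Local Notation C := (Borel (Cvec R n)).
Implicit Types (c : chart R n M) (D : disc X).

Definition bump D (z : Cvec R n) : R := Num.max 0 (1 - rnorm (z - dcenter D) / dradius D).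

Lemma bump_ge0 D z : 0 <= bump D z.
Proof. by rewrite le_max lexx. Qed.

Lemma bump_le1 D z : bump D z <= 1.
Proof.
by rewrite ge_max ler01 gerBl divr_ge0// ?rnorm_ge0// ltW// dradius_gt0.
Qed.

Lemma bump_gt0 D z : (0 < bump D z) = (rnorm (z - dcenter D) < dradius D).
Proof. by rewrite lt_max ltxx subr_gt0 ltr_pdivrMr ?dradius_gt0// mul1r. Qed.

Lemma bump_eq0 D z : ~ cdisc (dcenter D) (dradius D) z -> bump D z = 0.
Proof.
move=> zD; apply/eqP; rewrite eq_le bump_ge0 andbT leNgt.
by apply/negP; rewrite bump_gt0.
Qed.

Lemma dist_max0 (a b : R) : `|Num.max 0 a - Num.max 0 b| <= `|a - b|.
Proof.
rewrite ler_norml; have := ler_norm (a - b); have := ler_norm (b - a); rewrite distrC.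
by move: `|a - b| => t; case: (lerP 0 a); case: (lerP 0 b) => ? ? ? ?; lra.
Qed.

Lemma bump_continuous D : continuous (bump D).
Proof.
move=> z; have r0 := dradius_gt0 D; apply/rnorm_continuousR => e e0.
exists (e * dradius D) => [|y zy]; first exact: mulr_gt0.
apply: le_lt_trans (dist_max0 _ _) _.
rewrite [X in `|X|](_ : _ = (rnorm (y - dcenter D) - rnorm (z - dcenter D)) / dradius D); last by ring.
rewrite normrM [X in _ * X]ger0_norm ?invr_ge0 ?ltW//.
rewrite ltr_pdivrMr//; apply: le_lt_trans (ler_rnorm_dist _ _) _.
by rewrite opprB addrA subrK rnorm_dist.
Qed.

Definition overlap c c' : set (Cvec R n) := cmap c @` (dom c `&` dom c').

Lemma overlapP c c' z : overlap c c' z <-> rng c z /\ dom c' (cinv c z).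
Proof.
split=> [[x [cx c'x] <-]|[zr zD]]; first by rewrite cmapKx//; split=> //; exact: cmap_rng.
by exists (cinv c z); [split=> //; exact: cinv_dom|exact: cinvK].
Qed.

Lemma overlap_open c c' : open (overlap c c').
Proof.
have -> : overlap c c' = rng c `&` cinv c @^-1` (dom c').
  by apply/seteqP; split=> z /overlapP.
exact: (open_preimage_in (@rng_open _ _ _ c) (@cinv_continuous _ _ _ c) (dom_open c')).
Qed.

Lemma transition_biholomorphic c c' : atlas X c -> atlas X c' ->
  biholomorphic (overlap c c') (overlap c' c) (transition c c') (transition c' c).
Proof.
have half a b : atlas X a -> atlas X b -> forall z, overlap a b z ->
    [/\ overlap b a (transition a b z), transition b a (transition a b z) = z &
      differentiable (transition a b) z].
  move=> aX bX z ab; have dz : differentiable (transition a b) z.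
    exact: atlas_holomorphic aX bX _ ab.
  move: ab => [x [ax bx] xz]; rewrite -xz /transition/= in dz *.
  by rewrite cmapKx// cmapKx//; split=> //; exists x.
by move=> cX c'X; split; [exact: overlap_open|exact: overlap_open|exact: half|exact: half].
Qed.

(** The coefficient, in the chart [c], of [bump D] times the Lebesgue form of the chart of [D],
    extended by zero outside the overlap. *)
Definition dens D c (z : Cvec R n) : R :=
  if `[< overlap c (dchart D) z >]
  then bump D (transition c (dchart D) z) * jac2 (transition c (dchart D)) z else 0.

Lemma dens_ge0 D c z : 0 <= dens D c z.
Proof. by rewrite /dens; case: asboolP => // _; rewrite mulr_ge0 ?bump_ge0 ?jac2_ge0. Qed.

Lemma dens_transition D c c' x : atlas X c -> atlas X c' -> dom c x -> dom c' x ->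
  dens D c (cmap c x) = jac2 (transition c c') (cmap c x) * dens D c' (cmap c' x).
Proof.
move=> cX c'X cx c'x; have dX := disc_atlas D.
have oE b : dom b x -> `[< overlap b (dchart D) (cmap b x) >] = `[< dom (dchart D) x >].
  move=> bx; apply: asbool_equiv_eq; rewrite overlapP cmapKx//.
  by split=> [[]//|]; split=> //; exact: cmap_rng.
rewrite /dens !oE//; case: asboolP => [Dx|_]; last by rewrite mulr0.
have tE (b b' : chart R n M) : dom b x -> transition b b' (cmap b x) = cmap b' x.
  by move=> bx; rewrite /transition/= cmapKx.
have dT a b : atlas X a -> atlas X b -> dom a x -> dom b x ->
    differentiable (transition a b) (cmap a x).
  by move=> aX bX ax bx; apply: (atlas_holomorphic aX bX); exists x.
have dS : differentiable (transition c' (dchart D)) (transition c c' (cmap c x)).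
  by rewrite tE//; exact: dT.
have comp : \forall y \near cmap c x,
    transition c (dchart D) y = transition c' (dchart D) (transition c c' y).
  have : nbhs (cmap c x) (overlap c c').
    by apply: open_nbhs_nbhs; split; [exact: overlap_open|exists x].
  apply: filterS => y [x' [cx' c'x'] <-].
  by rewrite /transition/= !cmapKx.
have := jac2_comp (dT _ _ cX c'X cx c'x) dS (dT _ _ cX dX cx Dx) comp.
rewrite (tE c c' cx) => ->; rewrite (tE c (dchart D) cx) (tE c' (dchart D) c'x).
move: (bump _ _) (jac2 (transition c' _) _) (jac2 (transition c c') _) => p q r.
by rewrite mulrA [RHS]mulrC.
Qed.

(** The issue is the boundary of the overlap. The closed disc is compact, hence closed because [M]
    is Hausdorff, so a point outside the overlap has a neighbourhood that misses it, where the
    density vanishes. *)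
Lemma dens_continuous D c : atlas X c -> {in rng c, continuous (dens D c)}.
Proof.
move=> cX z /set_mem zr; have dX := disc_atlas D.
have [zO|zO] := pselect (overlap c (dchart D) z).
  have oz : nbhs z (overlap c (dchart D)).
    by apply: open_nbhs_nbhs; split=> //; exact: overlap_open.
  pose f y := bump D (transition c (dchart D) y) * jac2 (transition c (dchart D)) y.
  have fE y : overlap c (dchart D) y -> f y = dens D c y by move=> yO; rewrite /dens asboolT.
  have fc : f y @[y --> z] --> dens D c z.
    rewrite -fE//.
    exact: (cov_continuous (transition_biholomorphic cX dX) (fun y _ => @bump_continuous D y) (mem_set zO)).
  exact: cvg_trans (near_eq_cvg (filterS fE oz)) fc.
pose K := cinv (dchart D) @` ccdisc (dcenter D) (dradius D).
have cK : compact K by exact: closed_disc_compact.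
have oK : open (~` K).
  by apply: closed_openC; apply: compact_closed cK; exact: manifold_hausdorff X.
have zK : (~` K) (cinv c z).
  by move=> [y yD yz]; apply: zO; apply/overlapP; split=> //; rewrite -yz; exact: cinv_dom (ccdisc_rng yD).
have near0 : \forall y \near z, dens D c y = 0.
  have : nbhs z (rng c `&` cinv c @^-1` (~` K)).
    apply: open_nbhs_nbhs; split=> //.
    exact: (open_preimage_in (@rng_open _ _ _ c) (@cinv_continuous _ _ _ c) oK).
  apply: filterS => y [yr yK]; rewrite /dens; case: asboolP => // /overlapP[_ yD].
  rewrite bump_eq0 ?mul0r// => /= b; apply: yK; exists (transition c (dchart D) y).
    exact: ltW.
  by rewrite /transition/= cmapKx.
rewrite /prop_for /continuous_at (nbhs_singleton near0).
exact: (cvg_near_cst _ near0).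
Qed.

End chart_densities.

Section integral_support.
Context d (T : measurableType d) (R : realType) (mu : {measure set T -> \bar R}).

Lemma integral_support (D E : set T) (f : T -> \bar R) : E `<=` D ->
  (forall x, D x -> ~ E x -> f x = 0%E) ->
  (\int[mu]_(x in D) f x = \int[mu]_(x in E) f x)%E.
Proof.
move=> ED f0; rewrite integral_mkcond [RHS]integral_mkcond; apply: eq_integral => x _.
rewrite !patchE; case: ifPn => [/set_mem Dx|nD]; case: ifPn => // xE.
  by apply: f0 => // /mem_set; apply/negP.
by move: nD; rewrite mem_set//; exact: ED (set_mem xE).
Qed.

End integral_support.

Section geometric_series.
Context (R : realType).
Local Notation h := (2^-1 : R).

Lemma geom_scaled (b : nat -> \bar R) (q : R) m : 0 <= q -> (forall k, 0 <= b k)%E ->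
  (forall k, (k < m)%N -> b k = 0%E) -> (forall k, b k <= (q * h ^+ k)%:E)%E ->
  (\sum_(0 <= k <oo) b k <= (q * (2 * h ^+ m))%:E)%E.
Proof.
move=> q0 b0 bm bq; rewrite (nneseries_split 0 m)// add0n big_nat_cond big1 ?add0e; last first.
  by move=> k /andP[/andP[_ km] _]; exact: bm.
apply: (@le_trans _ _ (\sum_(m <= k <oo) (q%:E * (h ^+ k)%:E))%E).
  by apply: lee_nneseries => // k _; rewrite -EFinM.
rewrite nneseriesZl; last by move=> k _; rewrite lee_fin exprn_ge0// invr_ge0.
rewrite [leRHS]EFinM; apply: lee_wpmul2l; first by rewrite lee_fin.
by apply: geom_tail => // k; rewrite lee_fin exprn_ge0// invr_ge0.
Qed.

Lemma esum_fineZ (f : nat -> R) (c : R) : 0 <= c -> (forall k, 0 <= f k) ->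
  (\sum_(0 <= k <oo) (f k)%:E < +oo)%E ->
  (\sum_(0 <= k <oo) (c * f k)%:E = (c * esum_fine f)%:E)%E /\
  esum_fine (fun k => c * f k) = c * esum_fine f.
Proof.
move=> c0 f0 ffin.
have E : (\sum_(0 <= k <oo) (c * f k)%:E = (c * esum_fine f)%:E)%E.
  under eq_eseriesr do rewrite EFinM.
  rewrite nneseriesZl => [|k _]; last by rewrite lee_fin.
  rewrite [RHS]EFinM /esum_fine fineK// ge0_fin_numE//.
  by apply: nneseries_ge0 => k _ _; rewrite lee_fin.
by split=> //; rewrite {1}/esum_fine E.
Qed.

End geometric_series.

(** * The weighted form and its measure *)

Section norming_form.
Context (R : realType) (n : nat) (M : ptopologicalType) (X : complex_manifold R n M).
Local Notation C := (Borel (Cvec R n)).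
Local Notation lam := (@lamb R n).
Local Notation h := (2^-1 : R).
Variables (D : nat -> disc X) (a : nat -> R).
Hypothesis D_cover : forall x, exists k, dset (D k) x.
Hypothesis a_gt0 : forall k, 0 < a k.
Hypothesis a_dens : forall k l y, (l <= k)%N -> cdisc (dcenter (D l)) (dradius (D l)) y ->
  a k * dens (D k) (dchart (D l)) y <= h ^+ k.

Let f c z k := a k * dens (D k) c z.

Let f_ge0 c z k : 0 <= f c z k.
Proof. by rewrite mulr_ge0 ?dens_ge0// ltW. Qed.

Definition weighted_density c z : R := esum_fine (f c z).

Let f_transition c c' x : atlas X c -> atlas X c' -> dom c x -> dom c' x ->
  f c (cmap c x) = fun k => jac2 (transition c c') (cmap c x) * f c' (cmap c' x) k.
Proof.
move=> cX c'X cx c'x; apply/funext => k.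
rewrite /f (dens_transition (D k) cX c'X cx c'x).
exact: mulrCA.
Qed.

Let f_disc l x : dset (D l) x ->
  (\sum_(0 <= k <oo) (f (dchart (D l)) (cmap (dchart (D l)) x) k)%:E < +oo)%E.
Proof. by move=> [_ xD]; apply: (@series_fin R _ l) => // k lk; exact: a_dens. Qed.

Let f_fin c x : atlas X c -> dom c x -> (\sum_(0 <= k <oo) (f c (cmap c x) k)%:E < +oo)%E.
Proof.
move=> cX cx; have [l xl] := D_cover x; have [xD _] := xl.
rewrite (f_transition cX (disc_atlas (D l)) cx xD).
have [-> _] := esum_fineZ (jac2_ge0 (transition c (dchart (D l))) (cmap c x))
  (f_ge0 _ _) (f_disc xl).
exact: ltry.
Qed.

Lemma weighted_density_transition c c' x : atlas X c -> atlas X c' -> dom c x -> dom c' x ->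
  weighted_density c (cmap c x) =
  jac2 (transition c c') (cmap c x) * weighted_density c' (cmap c' x).
Proof.
move=> cX c'X cx c'x; rewrite /weighted_density (f_transition cX c'X cx c'x).
by have [_ ->] := esum_fineZ (jac2_ge0 (transition c c') (cmap c x)) (f_ge0 _ _) (f_fin c'X c'x).
Qed.

Lemma weighted_density_gt0 c z : atlas X c -> rng c z -> 0 < weighted_density c z.
Proof.
move=> cX [x cx <-]; have [l [lx xl]] := D_cover x.
have lX := disc_atlas (D l); set cl := dchart (D l) in lx xl lX.
apply: (@lt_le_trans _ _ (f c (cmap c x) l)).
  rewrite mulr_gt0// /dens -/cl asboolT; last by exists x.
  have xo : overlap c cl (cmap c x) by exists x.
  have [_ J] := biholomorphic_jacobian (transition_biholomorphic cX lX) xo.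
  rewrite mulr_gt0//; first by rewrite {1}/transition/= cmapKx// bump_gt0.
  rewrite lt_neqAle jac2_ge0 andbT; apply/eqP => J0.
  by move: J; rewrite -J0 mulr0 => /eqP; rewrite eq_sym oner_eq0.
rewrite -lee_fin /weighted_density /esum_fine fineK; last first.
  rewrite ge0_fin_numE; first exact: f_fin.
  by apply: nneseries_ge0 => k _ _; rewrite lee_fin.
apply: le_trans (@nneseries_lim_ge R _ xpredT 0 l.+1 _); last by move=> k _ _; rewrite lee_fin.
rewrite big_nat_recr//= leeDr//; apply: sume_ge0 => k _; rewrite lee_fin//.
Qed.

(* The series is dominated by a geometric one in the charts of the discs only;
   other charts are reached through the transition law. *)
Lemma weighted_density_continuous c : atlas X c -> {in rng c, continuous (weighted_density c)}.
Proof.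
move=> cX z /set_mem [x cx xz]; have [l [lx xl]] := D_cover x.
have lX := disc_atlas (D l); set cl := dchart (D l) in lx xl lX.
have zo : overlap c cl z by exists x.
have bT := transition_biholomorphic cX lX; have [_ _ OO _] := bT.
have [_ _ dT] := OO z zo; have oz : nbhs z (overlap c cl).
  by apply: open_nbhs_nbhs; split=> //; exact: overlap_open.
have Tz : transition c cl z = cmap cl x by rewrite -xz /transition/= cmapKx.
have cont_l : {for cmap cl x, continuous (weighted_density cl)}.
  apply: (@esum_fine_continuous R _ (fun k y => f cl y k) _ l) => [k|k y|].
  - apply: continuousM; first exact: cst_continuous.
    by apply: dens_continuous => //; apply/mem_set; exact: cmap_rng.
  - exact: f_ge0.
  - have : nbhs (cmap cl x) (cdisc (dcenter (D l)) (dradius (D l))).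
      by apply: open_nbhs_nbhs; split=> //; exact: cdisc_open.
    by apply: filterS => y yD k lk; exact: a_dens.
pose g y := jac2 (transition c cl) y * weighted_density cl (transition c cl y).
have gc : {for z, continuous g}.
  apply: continuousM.
    by apply: jac2_continuous; apply: filterS oz => y /OO[].
  apply: continuous_comp; first exact: differentiable_continuous.
  by rewrite Tz.
have gE y : overlap c cl y -> g y = weighted_density c y.
  move=> [x' [cx' lx'] <-]; rewrite (weighted_density_transition cX lX cx' lx').
  by rewrite /g /transition/= cmapKx.
have : g y @[y --> z] --> weighted_density c z by rewrite -gE.
exact: cvg_trans (near_eq_cvg (filterS gE oz)).
Qed.

Definition weighted_form : volume_form X.
Proof.
refine (@VolumeForm R n M X weighted_density weighted_density_gt0 weighted_density_continuous _).
move=> c c' x cX c'X cx c'x.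
by rewrite (weighted_density_transition cX c'X cx c'x) rmorphM/= jac2E.
Defined.

(** Made constant outside the range of the chart to be Borel on the whole space; the value there is
    irrelevant since [wbump k] vanishes outside the disc. *)
Definition param k : C -> Borel M := (cinv (dchart (D k)) : C -> Borel M) \_ (rng (dchart (D k))).

Lemma measurable_param k : measurable_fun setT (param k).
Proof.
have oR := @rng_open _ _ _ (dchart (D k)).
apply: ((measurable_restrictT _ _).1 (open_continuous_borel oR _)).
  exact: sub_sigma_algebra.
exact: cinv_continuous.
Qed.

Lemma param_rng k z : rng (dchart (D k)) z -> param k z = cinv (dchart (D k)) z.
Proof. by move=> zr; rewrite /param patchE mem_set. Qed.

Definition wbump k (z : C) : \bar R := (a k * bump (D k) z)%:E.

Lemma wbump_continuous k : continuous (fun z : Cvec R n => a k * bump (D k) z).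
Proof. by move=> z; apply: continuousM; [exact: cst_continuous|exact: bump_continuous]. Qed.

Lemma measurable_wbump k : measurable_fun setT (wbump k).
Proof. exact: (measurable_cont_on openT (fun z _ => @wbump_continuous k z)). Qed.

Lemma wbump_ge0 k z : (0 <= wbump k z)%E.
Proof. by rewrite lee_fin mulr_ge0 ?bump_ge0// ltW. Qed.

Lemma wbump_eq0 k z : ~ cdisc (dcenter (D k)) (dradius (D k)) z -> wbump k z = 0%E.
Proof. by move=> zD; rewrite /wbump bump_eq0// mulr0. Qed.

(** The tent measure of the [k]-th disc carried to [M] by its own chart: a measure by construction.
    Other charts are compared with it in [disc_measure_chart]. *)
Definition disc_measure k : {measure set (Borel M) -> \bar R} :=
  measure_function_pushforward__canonical__measure_function_Measure
    (density_measure lam (measurable_wbump k) (wbump_ge0 k)) (measurable_param k).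

Definition weighted_measure : {measure set (Borel M) -> \bar R} := mseries disc_measure 0.

Lemma disc_measureE k A :
  disc_measure k A = (\int[lam]_(z in param k @^-1` A) wbump k z)%E.
Proof. by []. Qed.

Lemma measurable_chart_image (c : chart R n M) (B : set (Borel M)) :
  measurable B -> B `<=` dom c -> measurable (cmap c @` B : set C).
Proof.
move=> mB Bc; have -> : cmap c @` B = rng c `&` cinv c @^-1` B.
  apply/seteqP; split => [_ [x Bx <-]|z [zr Bz]].
    by split; [exact: cmap_rng (Bc _ Bx)|rewrite /= cmapKx//; exact: Bc].
  by exists (cinv c z) => //; exact: cinvK.
apply: (open_continuous_borel (@rng_open _ _ _ c) (@cinv_continuous _ _ _ c)) => //.
by apply: sub_sigma_algebra; exact: rng_open.
Qed.

(** Both integrands vanish outside the overlap of the two charts; there the transition map is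
    biholomorphic and the change of variables applies. *)
Lemma disc_measure_chart k c (A : set (Borel M)) : atlas X c -> measurable A -> A `<=` dom c ->
  disc_measure k A = (\int[lam]_(z in cmap c @` A) (a k * dens (D k) c z)%:E)%E.
Proof.
move=> cX mA Ac; have kX := disc_atlas (D k); set ck := dchart (D k).
have mB := measurable_chart_image mA Ac.
have bT := transition_biholomorphic cX kX.
have := @change_of_variables R n _ _ _ _ (fun z => a k * bump (D k) z) _ bT
  (fun z _ => @wbump_continuous k z) (fun z _ => wbump_ge0 k z) mB.
rewrite disc_measureE => cov.
rewrite (@integral_support _ _ _ lam _ (overlap ck c `&` transition ck c @^-1` (cmap c @` A))).
- rewrite -[LHS]/(\int[lam]_(y in (overlap ck c `&` transition ck c @^-1` (cmap c @` A)))
    (a k * bump (D k) y)%:E)%E.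
  rewrite cov; symmetry.
  rewrite (@integral_support _ _ _ lam _ (cmap c @` A `&` overlap c ck)).
  + apply: eq_integral => z /set_mem [_ zO]; rewrite /dens asboolT//.
    by congr (_%:E); exact: mulrA.
  + by move=> z [].
  + move=> z zA zO; rewrite /dens asboolF ?mulr0// => zO'; exact: zO.
- move=> z [/overlapP[zr zc] [x Ax xz]]; rewrite /= param_rng//.
  suff -> : cinv ck z = x by [].
  rewrite -(cmapKx (Ac _ Ax)) xz /transition/= cmapKx//.
- move=> z zA zO; apply: wbump_eq0 => zD; apply: zO.
  have zr := disc_rng zD; move: zA; rewrite /= param_rng// => Az.
  split; first by apply/overlapP; split=> //; exact: Ac.
  by exists (cinv ck z).
Qed.

Lemma measure_of_weighted_form : measure_of_form weighted_form weighted_measure.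
Proof.
move=> c A cX mA Ac.
rewrite -[LHS]/(\sum_(0 <= k <oo) disc_measure k A)%E.
rewrite (eq_eseriesr (fun k _ => disc_measure_chart k cX mA Ac)).
have cA : cmap c @` A `<=` rng c by move=> _ [x /Ac cx <-]; exact: cmap_rng.
have mB := measurable_chart_image mA Ac.
rewrite -integral_nneseries//; last 2 first.
- move=> k; apply: measurable_funS (_ : measurable_fun (rng c : set C) _) => //.
    by apply: sub_sigma_algebra; exact: rng_open.
  apply: (measurable_cont_on (@rng_open _ _ _ c)) => z zr.
  apply: continuousM; first exact: cst_continuous.
  exact: dens_continuous.
- by move=> k z _; rewrite lee_fin f_ge0.
apply: eq_integral => z /set_mem[x Ax <-].
rewrite /= /weighted_density /esum_fine fineK// ge0_fin_numE; first exact: f_fin (Ac _ Ax).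
by apply: nneseries_ge0 => k _ _; rewrite lee_fin f_ge0.
Qed.

End norming_form.

(** * Norms *)

Section norm_estimates.
Context (R : realType) (n : nat) (M : ptopologicalType) (X : complex_manifold R n M).
Local Notation C := (Borel (Cvec R n)).
Local Notation lam := (@lamb R n).
Local Notation h := (2^-1 : R).
Variables (D : nat -> disc X) (a A : nat -> R).
Hypothesis D_cover : forall x, exists k, dset (D k) x.
Hypothesis a_gt0 : forall k, 0 < a k.
Hypothesis A_gt0 : forall k, 0 < A k.
Hypothesis aA : forall k, a k * A k <= h ^+ k.
Hypothesis mass_le : forall k u, negative_psh X u ->
  (mass u (D k) <= (A k)%:E * mass u (D 0))%E /\ (mass u (D 0) <= (A k)%:E * mass u (D k))%E.

Local Notation nu k := (disc_measure D a_gt0 k).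
Local Notation mu := (weighted_measure D a_gt0).

Lemma psh_measurable u : psh X u -> measurable_fun setT (u : Borel M -> \bar R).
Proof.
move=> pu; apply: (usc_measurable openT) => x _ r ur.
have [D' [D'x _]] := disc_ex X x; have cX := disc_atlas D'; set c := dchart D' in D'x cX.
have [us _ _] := pu c cX.
have := us (cmap c x) (cmap_rng D'x) r; rewrite /= cmapKx// => /(_ ur) nr.
have := @cmap_continuous _ _ _ c x (mem_set D'x) _ nr.
have : nbhs x (dom c) by apply: open_nbhs_nbhs; split=> //; exact: dom_open.
by apply: filterS2 => y cy; rewrite /= cmapKx.
Qed.

Lemma opp_measurable u : negative_psh X u -> measurable_fun setT (fun x : Borel M => - u x)%E.
Proof.
by move=> [pu _ _]; apply: (measurableT_comp (@oppe_measurable R setT)); exact: psh_measurable.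
Qed.

Lemma norm1_series u (E : set (Borel M)) : negative_psh X u -> measurable E ->
  norm1 mu E u = (\sum_(0 <= k <oo) \int[nu k]_(x in E) - u x)%E.
Proof.
move=> pu mE; have [_ u0 _] := pu.
rewrite /norm1 (eq_integral (fun x : Borel M => - u x)%E); last by move=> x _; rewrite lee0_abs.
apply: ge0_integral_measure_series => //; first by move=> x _; rewrite oppe_ge0.
by apply: measurable_funTS; exact: opp_measurable.
Qed.

Lemma disc_norm_le u k (E : set (Borel M)) : negative_psh X u -> measurable E ->
  (\int[nu k]_(x in E) (- u x) <= (a k)%:E * mass u (D k))%E.
Proof.
move=> pu mE; have [_ u0 _] := pu; have mu_ := opp_measurable pu.
apply: (@le_trans _ _ (\int[nu k]_x (- u x))%E).
  by apply: ge0_subset_integral => // x _; rewrite oppe_ge0.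
rewrite (ge0_integral_pushforward (measurable_param D k))//; last by move=> x _; rewrite oppe_ge0.
rewrite preimage_setT.
pose m := density_measure lam (measurable_wbump D a k) (wbump_ge0 D a_gt0 k).
pose g := (fun x : Borel M => - u x)%E \o param D k.
have g0 x : (0 <= g x)%E by rewrite oppe_ge0.
have mg : measurable_fun setT g by exact: (measurableT_comp mu_ (measurable_param D k)).
pose Q : set C := cdisc (dcenter (D k)) (dradius (D k)).
have mQ : measurable Q by exact: measurable_cdisc.
have mQC : measurable (~` Q) by exact: measurableC.
rewrite -[leLHS]/(\int[m]_x g x)%E -(setUv Q) ge0_integral_setU//; last 2 first.
- exact: measurable_funTS.
- by rewrite disj_set2E setICr.
rewrite (null_set_integral mQC (measurable_funTS mg)); last first.
  by apply: integral0_eq => z zQ; exact: wbump_eq0.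
rewrite adde0.
have a0 : 0 <= a k by exact: ltW.
apply: (@le_trans _ _ (\int[mscale (NngNum a0) lam]_(x in Q) g x)%E).
  apply: ge0_le_measure_integral => // S mS.
  change (\int[lam]_(z in S) wbump D a k z <= (a k)%:E * lam S)%E.
  rewrite -(integral_cst lam mS); apply: ge0_le_integral => //.
  - by move=> z _; exact: wbump_ge0.
  - by apply: measurable_funTS; exact: measurable_wbump.
  - by move=> z _; rewrite lee_fin ler_piMr// bump_le1.
rewrite ge0_integral_mscale//; last exact: measurable_funTS.
apply: lee_wpmul2l; first by rewrite lee_fin.
rewrite le_eqVlt; apply/orP; left; apply/eqP; apply: eq_integral => z /set_mem zQ.
by rewrite /g/= param_rng//; exact: disc_rng zQ.
Qed.

Lemma disc_norm_eq0 u k (E : set (Borel M)) : negative_psh X u -> measurable E ->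
  dset (D k) `<=` ~` E -> (\int[nu k]_(x in E) (- u x) = 0)%E.
Proof.
move=> pu mE kE; apply: null_set_integral => //.
  by apply: measurable_funTS; exact: opp_measurable.
rewrite disc_measureE; apply: integral0_eq => z zE; apply: wbump_eq0 => zQ.
apply: (kE (param D k z)) => //; rewrite param_rng; first exact: cinv_dset.
exact: disc_rng zQ.
Qed.

(** A point where [u] is finite lies in some disc, whose mass is finite by Harnack's inequality;
    comparison through [D 0] spreads this to every disc. *)
Lemma mass_fin u k : negative_psh X u -> (mass u (D k) < +oo)%E.
Proof.
move=> pu; have [_ u0 [x ux]] := pu; have [l lx] := D_cover x.
have wx : (- u x < +oo)%E by rewrite ltey; apply: contra ux => /eqP/eqP; rewrite eqe_oppLR.
have wf : (- u x)%E \is a fin_num by rewrite ge0_fin_numE// oppe_ge0.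
have lfin : (mass u (D l) < +oo)%E.
  by apply: le_lt_trans (harnack pu lx) _; rewrite -(fineK wf) -EFinM ltry.
have lf : mass u (D l) \is a fin_num by rewrite ge0_fin_numE// mass_ge0.
have m0fin : (mass u (D 0) < +oo)%E.
  by apply: le_lt_trans (mass_le l pu).2 _; rewrite -(fineK lf) -EFinM ltry.
have mf : mass u (D 0) \is a fin_num by rewrite ge0_fin_numE// mass_ge0.
by apply: le_lt_trans (mass_le k pu).1 _; rewrite -(fineK mf) -EFinM ltry.
Qed.

Lemma mass_fineK u k : negative_psh X u -> (fine (mass u (D k)))%:E = mass u (D k).
Proof. by move=> pu; rewrite fineK// ge0_fin_numE; [exact: mass_fin|exact: mass_ge0]. Qed.

(** The discs disjoint from [E] contribute nothing, the others a geometric tail. The case [m = 0]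
    bounds the whole norm; large [m] serves for complements of exhausting sets. *)
Lemma norm1_le_mass u (E : set (Borel M)) m : negative_psh X u -> measurable E ->
  (forall k, (k < m)%N -> dset (D k) `<=` ~` E) ->
  (norm1 mu E u <= (2 * h ^+ m)%:E * mass u (D 0))%E.
Proof.
move=> pu mE kE; have [_ u0 _] := pu; rewrite norm1_series//.
have q0 : 0 <= fine (mass u (D 0)) by apply: fine_ge0; exact: mass_ge0.
rewrite -(mass_fineK 0 pu) -EFinM [X in X%:E]mulrC; apply: geom_scaled => // k.
- by apply: integral_ge0 => x _; rewrite oppe_ge0.
- by move=> km; apply: disc_norm_eq0 => //; exact: kE.
apply: le_trans (disc_norm_le k pu mE) _.
apply: le_trans (lee_wpmul2l _ (mass_le k pu).1) _; first by rewrite lee_fin ltW.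
rewrite muleA -EFinM [leRHS]EFinM mass_fineK// [leRHS]muleC.
by apply: lee_wpmul2r; [exact: mass_ge0|rewrite lee_fin].
Qed.

Lemma norm1_le_mass0 u : negative_psh X u -> (norm1 mu setT u <= 2%:E * mass u (D 0))%E.
Proof.
move=> pu; have := norm1_le_mass (m := 0) pu measurableT; rewrite expr0 mulr1; exact.
Qed.

(** Integrate Harnack's inequality over [D 0] against its own tent measure. That measure is at least
    [t] because the tent is at least 1/2 on the disc of half the radius. *)
Lemma mass_le_norm1 : exists2 c : R, 0 < c &
  forall u, negative_psh X u -> (mass u (D 0) <= c%:E * norm1 mu setT u)%E.
Proof.
have r0 := dradius_gt0 (D 0).
pose s := dradius (D 0) / 2; have s0 : 0 < s by rewrite divr_gt0.
pose Q : set C := cdisc (dcenter (D 0)) s.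
have mQ : measurable Q by exact: measurable_cdisc.
pose t := a 0 / 2 * fine (lam Q).
have t0 : 0 < t by rewrite mulr_gt0 ?divr_gt0//; exact: lamb_fine_gt0.
have ms : measurable (dset (D 0) : set (Borel M)).
  by apply: sub_sigma_algebra; exact: dset_open.
have tle : (t%:E <= nu 0 (dset (D 0)))%E.
  rewrite disc_measureE /t EFinM lamb_fineK -(integral_cst lam mQ).
  apply: (@le_trans _ _ (\int[lam]_(z in Q) wbump D a 0 z)%E).
    apply: ge0_le_integral => //; first by move=> z _; rewrite lee_fin ltW// divr_gt0.
      by apply: measurable_funTS; exact: measurable_wbump.
    move=> z zQ; rewrite lee_fin; apply: ler_wpM2l; first exact: ltW.
    rewrite /bump le_max; apply/orP; right.
    rewrite lerBrDr -lerBrDl ler_pdivrMr//.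
    apply: le_trans (ltW zQ) _; rewrite /s; lra.
  apply: ge0_subset_integral => //.
  - exact: measurable_preimageT (measurable_param D 0) ms.
  - by apply: measurable_funTS; exact: measurable_wbump.
  - by move=> z _; exact: wbump_ge0.
  - move=> z zQ; have zD : cdisc (dcenter (D 0)) (dradius (D 0)) z.
      by apply: lt_trans zQ _; rewrite /s; lra.
    by rewrite /= param_rng; [exact: cinv_dset|exact: disc_rng zD].
exists (harnack_cst (D 0) / t) => [|u pu]; first by rewrite divr_gt0// harnack_cst_gt0.
have [_ u0 _] := pu; have H0 := harnack_cst_gt0 (D 0).
rewrite -invf_div lee_pdivlMl ?divr_gt0// EFinM -muleA norm1_series//.
apply: (@le_trans _ _ (\int[nu 0]_x (- u x))%E); last first.
  apply: le_trans (@nneseries_lim_ge R _ xpredT 0 1 _); first by rewrite big_nat1.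
  by move=> k _ _; apply: integral_ge0 => x _; rewrite oppe_ge0.
apply: (@le_trans _ _ (\int[nu 0]_(x in dset (D 0)) (- u x))%E); last first.
  by apply: ge0_subset_integral => //; [exact: opp_measurable|move=> x _; rewrite oppe_ge0].
apply: (@le_trans _ _ (\int[nu 0]_(x in dset (D 0)) ((harnack_cst (D 0))^-1%:E * mass u (D 0)))%E).
  rewrite (integral_cst (nu 0) ms) [leLHS]muleC; apply: lee_wpmul2l => //.
  by apply: mule_ge0; [rewrite lee_fin invr_ge0 ltW|exact: mass_ge0].
apply: ge0_le_integral => //.
- by move=> x _; apply: mule_ge0; [rewrite lee_fin invr_ge0 ltW|exact: mass_ge0].
- by apply: measurable_funTS; exact: opp_measurable.
- by move=> x xD; rewrite lee_pdivrMl//; exact: harnack.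
Qed.

End norm_estimates.

(** * Exhaustions by relatively compact open sets *)

Section exhaustion_sequence.
Context (R : realType) (n : nat) (M : ptopologicalType) (X : complex_manifold R n M).
Local Notation h := (2^-1 : R).

Lemma exhaustion_compact (E : nat -> set M) (K : set M) : exhaustion E -> compact K ->
  \forall j \near \oo, K `<=` E j.
Proof.
move=> [oE incE unE] cK.
have homoE : {homo E : i j / (i <= j)%N >-> i `<=` j}.
  by apply: homo_leq => [A x //|A B G AB BG x /AB/BG//|].
apply: (compact_near_coveringP K).1 cK _ _ (fun j x => E j x) _ _ => x _.
have [i _ xi] : (\bigcup_j E j) x by rewrite unE.
exists (E i, [set j | (i <= j)%N]); last by move=> [y j] /= [yi ij]; exact: homoE yi.
by split=> /=; [apply: open_nbhs_nbhs; split=> //; have [] := oE i|exists i].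
Qed.

Lemma exhaustion_disc (E : nat -> set M) (D : disc X) : exhaustion E ->
  \forall j \near \oo, dset D `<=` E j.
Proof.
move=> exE; pose K := cinv (dchart D) @` ccdisc (dcenter D) (dradius D).
have DK : dset D `<=` K.
  by move=> x [xD xr]; exists (cmap (dchart D) x); [exact: ltW|rewrite cmapKx].
have cK : compact K by exact: closed_disc_compact.
by apply: filterS (exhaustion_compact exE cK) => j KE; exact: subset_trans DK KE.
Qed.

(* [m j] is the largest [m <= j] such that [E j] contains the first [m] discs. *)
Lemma exhaustion_rank (D : nat -> disc X) (E : nat -> set M) : exhaustion E ->
  exists m : nat -> nat, (forall j k, (k < m j)%N -> dset (D k) `<=` E j) /\
    forall p, \forall j \near \oo, (p <= m j)%N.
Proof.
(* The bound [m <= j] makes a maximum exist even if [E j] contains all the discs. *)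
move=> exE; pose P j m := [forall k : 'I_m, `[< dset (D k) `<=` E j >]] && (m <= j)%N.
have P0 j : exists m, P j m by exists 0; rewrite /P andbT; apply/forallP => -[].
have Pub j m : P j m -> (m <= j)%N by case/andP.
exists (fun j => ex_maxn (P0 j) (Pub j)); split=> [j k|p].
  case: ex_maxnP => m /andP[/forallP Pm _] _ km.
  by have /asboolP := Pm (Ordinal km).
have : \forall j \near \oo, forall k : 'I_p, dset (D k) `<=` E j.
  by apply: filter_forall => k; exact: exhaustion_disc.
move=> near_p; near=> j; case: ex_maxnP => m _; apply.
rewrite /P; apply/andP; split; last by near: j; exact: nbhs_infty_ge.
by apply/forallP => k; apply/asboolP; move: k; near: j.
Unshelve. all: by end_near. Qed.

End exhaustion_sequence.

(** * Choice of the weights and the norming properties *)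

Lemma scaled_le (R : realType) (e s x : R) : 0 <= e -> 0 < s -> x <= s -> e / s * x <= e.
Proof. by move=> e0 s0 xs; rewrite mulrAC ler_pdivrMr// ler_wpM2l. Qed.

(** For fixed [k] only the discs [l <= k] impose conditions, so a finite sum [s k] dominates all the
    suprema involved. For fixed [l] every term from the [l]-th on is controlled, which is enough for
    convergence on that disc. *)
Lemma weights_ex (R : realType) (n : nat) (M : ptopologicalType) (X : complex_manifold R n M)
    (D : nat -> disc X) (A : nat -> R) : (forall k, 0 < A k) ->
  exists a : nat -> R, [/\ forall k, 0 < a k, forall k, a k * A k <= 2^-1 ^+ k &
    forall k l y, (l <= k)%N -> cdisc (dcenter (D l)) (dradius (D l)) y ->
      a k * dens (D k) (dchart (D l)) y <= 2^-1 ^+ k].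
Proof.
move=> A0.
have /choice[B HB] (kl : nat * nat) : exists b : R, 0 < b /\
    forall y, ccdisc (dcenter (D kl.2)) (dradius (D kl.2)) y ->
      dens (D kl.1) (dchart (D kl.2)) y <= b.
  have cK := @compact_ccdisc R n (dcenter (D kl.2)) (dradius (D kl.2)).
  have [|b b0 hb] := compact_ub (f := dens (D kl.1) (dchart (D kl.2))) cK; last by exists b.
  move=> y yD; apply: dens_continuous; first exact: disc_atlas.
  by apply/mem_set; exact: ccdisc_rng yD.
pose s k := A k + \sum_(l < k.+1) B (k, nat_of_ord l).
have S0 k : 0 <= \sum_(l < k.+1) B (k, nat_of_ord l).
  by apply: sumr_ge0 => l _; have [/ltW] := HB (k, nat_of_ord l).
have s0 k : 0 < s k by rewrite ltr_pwDl.
have h0 k : 0 < (2^-1 : R) ^+ k by rewrite exprn_gt0// invr_gt0.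
exists (fun k => 2^-1 ^+ k / s k); split=> [k|k|k l y lk yl].
- by rewrite divr_gt0.
- by apply: scaled_le; rewrite ?(ltW (h0 k))// lerDl.
apply: scaled_le; rewrite ?(ltW (h0 k))//.
have [_ /(_ y (ltW yl)) dB] := HB (k, l); apply: le_trans dB _.
rewrite /s (bigD1 (Ordinal (lk : (l < k.+1)%N)))//= addrCA lerDl addr_ge0 ?(ltW (A0 k))//.
by apply: sumr_ge0 => i _; have [/ltW] := HB (k, nat_of_ord i).
Qed.

Theorem theorem5p1 (R : realType) (n : nat) (M : ptopologicalType)
    (X : complex_manifold R n M) :
  connected [set: M] -> exists V : volume_form X, norming V.
Proof.
move=> cM; have [D D_cover] := disc_cover X.
have /choice[A HA] (k : nat) : exists A : R, 0 < A /\ forall u, negative_psh X u ->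
    (mass u (D k) <= A%:E * mass u (D 0%N))%E /\ (mass u (D 0%N) <= A%:E * mass u (D k))%E.
  by have [A A0 H] := mass_equiv (D 0%N) (D k) cM; exists A.
have A0 k : 0 < A k by have [] := HA k.
have mass_le k u : negative_psh X u -> (mass u (D k) <= (A k)%:E * mass u (D 0%N))%E /\
    (mass u (D 0%N) <= (A k)%:E * mass u (D k))%E by have [_] := HA k; apply.
have [a [a0 aA a_dens]] := weights_ex D A0.
exists (weighted_form D_cover a0 a_dens); exists (weighted_measure D a0).
  exact: measure_of_weighted_form.
have total u (pu : negative_psh X u) := norm1_le_mass0 D_cover a0 aA mass_le pu.
split=> [u pu|F cF|E exE].
- apply: le_lt_trans (total u pu) _.
  by rewrite -(mass_fineK D_cover mass_le 0 pu) -EFinM ltry.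
- have [N _ HN] : \forall N \near \oo, forall x, F x -> exists2 k, (k < N)%N & dset (D k) x.
    apply: (compact_near_coveringP F).1 cF _ _ _ _ _ => x _.
    have [k xk] := D_cover x; exists (dset (D k), [set N | (k < N)%N]).
      by split=> /=; [apply: open_nbhs_nbhs; split=> //; exact: dset_open|exists k.+1].
    by move=> [y N] /= [yk kN]; exists k.
  (* The factors are those of norm against mass of [D 0], of mass of [D 0] against mass of [D k],
     and of mass of [D k] against [- u z]. The sum [Q] bounds every [q k] at once and is positive
     even for an empty range of indices. *)
  pose q k := 2 * (A k * harnack_cst (D k)).
  have q0 k : 0 < q k by rewrite !mulr_gt0// harnack_cst_gt0.
  pose Q := 1 + \sum_(k < N) q k.
  have Q0 : 0 < Q by rewrite ltr_pwDl// sumr_ge0// => k _; exact: ltW.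
  exists Q^-1 => [|u pu z Fz]; first by rewrite invr_gt0.
  have [_ u0 _] := pu; have [k kN zk] := HN N (leqnn N) z Fz.
  rewrite leeNr lee_pdivrMl//; apply: le_trans (total u pu) _.
  apply: (@le_trans _ _ ((q k)%:E * - u z)%E); last first.
    apply: lee_wpmul2r; first by rewrite oppe_ge0.
    rewrite lee_fin /Q (bigD1 (Ordinal kN))//= addrCA lerDl addr_ge0// sumr_ge0// => i _.
    exact: ltW.
  rewrite [(q k)%:E]EFinM -muleA; apply: (@lee_wpmul2l R 2%:E) => //.
  apply: le_trans (mass_le k u pu).2 _; rewrite EFinM -muleA.
  by apply: lee_wpmul2l; [rewrite lee_fin ltW|exact: harnack].
- have [m [mE m_oo]] := exhaustion_rank D exE.
  have [c c0 mass_norm] := mass_le_norm1 D a0.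
  (* [2 * 2^-1 ^+ m j] bounds the tail by the mass of [D 0], and [c] returns from that mass to the
     norm. *)
  exists (fun j => c * (2 * 2^-1 ^+ m j)); split=> [j||u pu j].
  + by rewrite !mulr_gt0// exprn_gt0// invr_gt0.
  + apply/cvgrPdist_lt => e e0; have [p pe] := geom_small (divr_gt0 e0 c0).
    apply: filterS (m_oo p) => j pj; rewrite sub0r normrN ger0_norm; last first.
      by rewrite !mulr_ge0 ?exprn_ge0 ?(ltW c0)// invr_ge0.
    rewrite mulrC -ltr_pdivlMr//; apply: le_lt_trans pe; rewrite ler_pM2l//.
    by apply: ler_wiXn2l pj; rewrite ?invr_ge0// invf_le1// ler1n.
  + have mEj : measurable (~` E j : set (Borel M)).
      by apply: measurableC; apply: sub_sigma_algebra; have [oE _ _] := exE; have [] := oE j.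
    apply: (le_trans (norm1_le_mass D_cover a0 aA mass_le (m := m j) pu mEj _)).
      by move=> k km; rewrite setCK; exact: mE.
    rewrite [c * _]mulrC (EFinM _ c) -muleA; apply: lee_wpmul2l; last exact: mass_norm.
    by rewrite lee_fin mulr_ge0// exprn_ge0// invr_ge0.
Qed.
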